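(* Let $H>0$ and let $(\psi(t),\ t\ge 0)$ be the nonnegative $H$-selfsimilar Sato process $$\psi(t)=\int_{\ln(t^{-H})}^\infty e^{-s}\,d\bar Y_s,\qquad t\ge 0,$$ where $\bar Y=(\bar Y_s,\ s\in\mathbb{R})$ is a double sided subordinator without drift such that $\bar Y_0=0$ and $\kappa:=\mathbb{E}\bar Y_1=\mathbb{E}\psi(1)\in(0,\infty)$. Let $\rho$ be the Lévy measure of $\bar Y_1$ (it is concentrated on $\mathbb{R}_+$), and let $\nu$ be the Lévy measure of $\psi$. (a2) Given $a>0$, let $r^{(a)}(t):=a^H UV\,\mathbf{1}_{[aU^{1/H},\infty)}(t)$, $t\ge 0$, where $U$ is a standard uniform random variable and $V$ has the distribution $\kappa^{-1}x\,\rho(dx)$, with $U$, $V$ and $(\psi(t),\ t\ge0)$ independent. Then $$\big\{\psi(t)+a^H UV\,\mathbf{1}_{[aU^{1/H},\infty)}(t),\ t\ge 0\big\}\ \overset{(\mathrm{law})}{=}\ \{\psi(t),\ t\ge 0\}\ \text{ under }\ \mathbb{E}\Big[\frac{\psi(a)}{\kappa a^H};\ \cdot\ \Big].$$ (b2) Let $G$ be a standard exponential random variable, let $U$ be standard uniform and let $V$ have distribution $\kappa^{-1}x\,\rho(dx)$, with $G,U,V$ independent. Then $$\nu(F)=\kappa\,\mathbb{E}\Big[(UV)^{-1}e^{GU^{1/H}}F\big(G^H UV\,\mathbf{1}_{[GU^{1/H},\infty)}\big)\Big]$$ for every measurable functional $F:\mathbb{R}_+^{[0,\infty)}\to\mathbb{R}_+$.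 Therefore $\nu$ is the law of the process $(G^HUV\,\mathbf{1}_{[GU^{1/H},\infty)}(t),\ t\ge 0)$ under the measure $\kappa(UV)^{-1}e^{GU^{1/H}}\,d\mathbb{P}$. (c2) Let $a>0$. The components of the decomposition $\psi\overset{(\mathrm{law})}{=}(\psi\,|\,\psi(a)=0)+\mathcal{L}^{(a)}$ (independent terms) can be identified as $$(\psi(t),\ t\ge 0\ |\ \psi(a)=0)\ \overset{(\mathrm{law})}{=}\ (\psi(t\vee a)-\psi(a),\ t\ge 0)\quad\text{and}\quad(\mathcal{L}^{(a)}_t,\ t\ge 0)\ \overset{(\mathrm{law})}{=}\ (\psi(t\wedge a),\ t\ge 0).$$ The Lévy measures $\nu_a$ and $\tilde\nu_a$ of $(\psi(t),\ t\ge 0\,|\,\psi(a)=0)$ and of $(\mathcal{L}^{(a)}_t,\ t\ge0)$, respectively, are given by $$\nu_a(F)=\int_{-\infty}^{\ln(a^{-H})}\int_0^\infty F\big(xe^{-s}\mathbf{1}_{[e^{-s/H},\infty)}\big)\,\rho(dx)\,ds$$ and $$\tilde\nu_a(F)=\int_{\ln(a^{-H})}^{\infty}\int_0^\infty F\big(xe^{-s}\mathbf{1}_{[e^{-s/H},\infty)}\big)\,\rho(dx)\,ds$$ for every measurable functional $F:\mathbb{R}_+^{[0,\infty)}\to\mathbb{R}_+$.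
   Context: A double sided Lévy process $\bar Y=(\bar Y_s,s\in\mathbb{R})$ has stationary and independent increments, càdlàg paths, and $\bar Y_0=0$ a.s.; it is a double sided subordinator if it is nondecreasing. The integral defining $\psi(t)$ is a pathwise (improper) integral, and $\psi(0)=0$ (with $\ln(0^{-H})=+\infty$). An $H$-selfsimilar Sato process is an additive process $(X_t,t\ge0)$ (i.e. $X_0=0$ a.s., independent increments, stochastically continuous) with $(X_{ct},t\ge0)\overset{(\mathrm{law})}{=}(c^HX_t,t\ge0)$ for all $c>0$ (the law of $X_1$ is then selfdecomposable). One has $\mathbb{E}\psi(t)=\kappa t^H$. For a nonnegative infinitely divisible process $\psi=(\psi(x),x\in E)$ with no drift, its Lévy measure is the unique measure $\nu$ on $\mathbb{R}_+^E$ (all functions $E\to\mathbb{R}_+$, with the cylindrical $\sigma$-algebra) such that for all $n\ge1$, $\alpha_i\ge 0$, $x_i\in E$, $$\mathbb{E}\Big[e^{-\sum_{i=1}^n\alpha_i\psi(x_i)}\Big]=\exp\Big\{-\int_{\mathbb{R}_+^E}\big(1-e^{-\sum_{i=1}^n\alpha_i y(x_i)}\big)\nu(dy)\Big\},$$ and which has no mass at the zero function $0_E$ in the sense that $\nu(A)=\nu_*(A\setminus\{0_E\})$ for every cylindrical-measurable $A$, where $\nu_*$ is the inner measure. Write $\nu(F)=\int F\,d\nu$; measurability of functionals is with respect to the cylindrical $\sigma$-algebra. Here $E=[0,\infty)$. Equality in law of processes means equality of finite-dimensional distributions. For a nonnegative random variable $Z$ with $\mathbb{E}Z=1$, ''$\psi$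 under $\mathbb{E}[Z;\ \cdot\ ]$'' means the law of $\psi$ under $Z\,d\mathbb{P}$. Standard uniform means uniform on $[0,1]$; standard exponential means exponential with mean $1$. For a nonnegative infinitely divisible process $\psi$ without drift with Lévy measure $\nu$ and $a\in E$, $(\psi\,|\,\psi(a)=0)$ and $\mathcal{L}^{(a)}$ denote independent nonnegative infinitely divisible processes without drift with Lévy measures $\nu_a(dy)=\mathbf{1}_{\{y(a)=0\}}\nu(dy)$ and $\tilde\nu_a(dy)=\mathbf{1}_{\{y(a)>0\}}\nu(dy)$, so that $\psi\overset{(\mathrm{law})}{=}(\psi\,|\,\psi(a)=0)+\mathcal{L}^{(a)}$; when $\mathbb{P}[\psi(a)=0]>0$, $(\psi\,|\,\psi(a)=0)$ has the ordinary conditional law of $\psi$ given $\{\psi(a)=0\}$. *)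

(* Defs.v *)
From HB Require Import structures.
From mathcomp Require Import all_boot all_order all_algebra.
From mathcomp Require Import all_classical all_reals all_analysis.

Set Implicit Arguments.
Unset Strict Implicit.
Unset Printing Implicit Defensive.

Import Order.TTheory GRing.Theory Num.Theory.
Import numFieldNormedType.Exports.

Local Open Scope classical_set_scope.
Local Open Scope ring_scope.

(** * Nonnegative functions on the half-line, with the cylindrical
    sigma-algebra *)

Definition path_space (R : realType) : Type := {nonneg R} -> {nonneg R}.

Definition zero_path (R : realType) : path_space R := fun=> 0%:nng.

HB.instance Definition _ (R : realType) := Choice.on (path_space R).
HB.instance Definition _ (R : realType) :=
  isPointed.Build (path_space R) (@zero_path R).

Definition one_dim_cylinders (R : realType) : set (set (path_space R)) :=
  [set A | exists t : {nonneg R}, exists2 B : set R,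
     measurable B & A = [set y : path_space R | B (y t)%:num]].

Definition paths (R : realType) := g_sigma_algebraType (@one_dim_cylinders R).

Definition step (R : realType) (c u t : R) : R := c * \1_(`[u, +oo[) t.

(** The path [c 1_[u, +oo[].  The absolute value only makes it total: [c] is
    nonnegative almost surely (almost everywhere) wherever it is used. *)
Definition step_path (R : realType) (c u : R) : paths R :=
  fun t => (`|step c u t%:num|)%:nng.

Lemma measurable_zero_at (R : realType) (a : {nonneg R}) :
  measurable [set y : paths R | (y a)%:num = 0].
Proof.
apply: sub_sigma_algebra; exists a.
by exists [set 0 : R]; [exact: measurable_set1|].
Qed.

Lemma measurable_pos_at (R : realType) (a : {nonneg R}) :
  measurable [set y : paths R | 0 < (y a)%:num].
Proof.
apply: sub_sigma_algebra; exists a; exists `]0, +oo[%classic.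
  exact: measurable_itv.
by apply/seteqP; split => y /=; rewrite in_itv/= andbT.
Qed.

(** * Laws and independence *)

(** Equality of the finite-dimensional distributions of [X] under [mu] and of
    [X'] under [mu']. *)
Definition eq_law (R : realType) (I : Type)
    d (T : measurableType d) (mu : set T -> \bar R) (X : I -> T -> R)
    d' (T' : measurableType d') (mu' : set T' -> \bar R) (X' : I -> T' -> R) :=
  forall (n : nat) (t : n.-tuple I) (B : set (n.-tuple R)), measurable B ->
    mu [set w | B [tuple X (tnth t i) w | i < n]] =
    mu' [set w | B [tuple X' (tnth t i) w | i < n]].

(** The measure [Z dP]. *)
Definition weighted (R : realType) d (T : measurableType d)
    (P : set T -> \bar R) (Z : T -> R) (A : set T) : \bar R :=
  \int[P]_(w in A) (Z w)%:E.

Definition sigma_rv (R : realType) (T : Type) (Z : T -> R) : set (set T) :=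
  preimage_set_system setT Z measurable.

Definition sigma_process (R : realType) (I T : Type) (X : I -> T -> R) :
    set (set T) :=
  <<s \bigcup_i sigma_rv (X i) >>.

Definition mutually_independent (R : realType) d (T : measurableType d)
    (P : set T -> \bar R) (I : finType) (F : I -> set (set T)) :=
  forall (J : {set I}) (A : I -> set T), (forall i, i \in J -> F i (A i)) ->
    P (\bigcap_(i in [set` J]) A i) = (\prod_(i in J) P (A i))%E.

(** * Lévy processes and Lévy measures *)

Section levy.
Context (R : realType) d (T : measurableType d) (P : probability T R).

Record double_sided_levy (Y : R -> T -> R) : Prop := {
  levy_measurable : forall s, measurable_fun setT (Y s) ;
  levy_cadlag : forall w x, (Y ^~ w) @ at_right x --> Y x w /\
                            cvg ((Y ^~ w) @ at_left x) ;
  levy_start : {ae P, forall w, Y 0 w = 0} ;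
  levy_stationary : forall (h s t : R) (B : set R), s <= t -> measurable B ->
    P [set w | B (Y (t + h) w - Y (s + h) w)] =
    P [set w | B (Y t w - Y s w)] ;
  levy_independent : forall (n : nat) (s : nat -> R),
    {homo s : i j / (i <= j)%N >-> i <= j} ->
    mutually_independent P
      (fun i : 'I_n => sigma_rv (fun w => Y (s i.+1) w - Y (s i) w)) }.

(** [Z] is a driftless nonnegative infinitely divisible variable whose Lévy
    measure is [rho]: there is no linear term in the Laplace exponent. *)
Definition driftless_levy_measure (Z : T -> R)
    (rho : {measure set R -> \bar R}) :=
  rho `]-oo, 0]%classic = 0%E /\
  forall alpha : R, 0 <= alpha ->
    'E_P[fun w => expR (- (alpha * Z w))]%E =
    expeR (- \int[rho]_(x in `]0%R, +oo[) (1 - expR (- (alpha * x)))%:E).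

Definition inner_measure (nu : {measure set (paths R) -> \bar R})
    (A : set (paths R)) : \bar R :=
  ereal_sup [set nu B | B in [set B | measurable B /\ B `<=` A]].

(** [X] is a driftless nonnegative infinitely divisible process with Lévy
    measure [nu]. *)
Definition levy_measure_of (X : {nonneg R} -> T -> R)
    (nu : {measure set (paths R) -> \bar R}) :=
  (forall (n : nat) (alpha : 'I_n -> R) (x : 'I_n -> {nonneg R}),
     (forall i, 0 <= alpha i) ->
     'E_P[fun w => expR (- \sum_(i < n) alpha i * X (x i) w)]%E =
     expeR (- \int[nu]_y
       (1 - expR (- \sum_(i < n) alpha i * (y (x i))%:num))%:E)) /\
  (forall A, measurable A -> nu A = inner_measure nu (A `\ @zero_path R)).

End levy.

(** * The Sato process *)

(** [ln (t^-H)], equal to [+oo] at [t = 0]. *)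
Definition log_level (R : realType) (H : R) (t : {nonneg R}) : \bar R :=
  if t%:num == 0 then +oo%E else (ln (t%:num `^ (- H)))%:E.

(** The pathwise integral of [e^-s] with respect to [dY_s] over
    [s > ln (t^-H)], for the Lebesgue-Stieltjes measure of each path of [Y].
    A Lévy process has no fixed jumps, so including the endpoint would change
    each [sato H Y t] on a null set only.  [fine] discards the null set where
    the integral is infinite. *)
Definition sato (R : realType) (T : Type) (H : R) (Y : T -> cumulative R R)
    (t : {nonneg R}) (w : T) : R :=
  fine (\int[lebesgue_stieltjes_measure (Y w)]_(s in
          [set s : R | (log_level H t < s%:E)%E]) (expR (- s))%:E).

(* Main.v *)
Require Import Defs.
From HB Require Import structures.
From mathcomp Require Import all_boot all_order all_algebra.
From mathcomp Require Import all_classical all_reals all_analysis.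
From mathcomp Require Import measurable_realfun.
From mathcomp Require Import ring lra.

Set Implicit Arguments.
Unset Strict Implicit.
Unset Printing Implicit Defensive.

Import Order.TTheory GRing.Theory Num.Theory.
Import numFieldNormedType.Exports.
Import HBNNSimple.

Local Open Scope classical_set_scope.
Local Open Scope ring_scope.

(** Under [(s, x) |-> x e^-s 1_[e^(-s/H), +oo[], the Lévy measure [nu] is the
    image of [ds] times [rho]: the Laplace functional of [psi] is the limit of
    those of Riemann-Stieltjes sums, which are functions of independent
    increments of [Ybar], and a Lévy measure is determined by the Laplace
    functional.  Cutting [s] at [ln (a^-H)] gives (c2).
    Differentiating the Laplace functional in the coefficient at [a] gives
    [E[psi(a) e^-<alpha, psi>] =
     E[e^-<alpha, psi>] * \int y(a) e^-<alpha, y> nu(dy)],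
    where only [s >= ln (a^-H)] contributes; there [e^-s = a^H u] with [u]
    uniform under [e^-s ds / a^H], which is (a2).  Averaging the same
    substitution over an exponential [a = G], each [s] is weighted by
    [P(G > e^(-s/H)) = e^-(e^(-s/H))], which the density in (b2) cancels. *)

(** * Convergence and densities *)

(** A measurable set of paths depends on countably many coordinates, so the zero path is not a
    measurable singleton. The normalisation of [nu] by inner measures is therefore exploited by
    comparing [nu] with an image measure carried by a measurable set that misses the zero path; away
    from it, the density [1 - e^(- y(t))] turns a Lévy measure into a finite one, which Laplace
    functionals determine. The Riemann-Stieltjes sums are taken from below: their step kernels lie
    under the true kernel, so one convergence lemma serves the Lebesgue measure and the Stieltjes
    measure of every path, even where the integral is infinite. The integral defining [psi] leaves
    out the endpoint of its range while the right-continuous jump paths include it, so two kernels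
    are carried along; for finitely many times they differ at finitely many [s]. Finally [rho] is
    given as a mere measure; its sigma-finiteness, on which Tonelli rests, is drawn from its finite
    Laplace exponent. *)

Section integral_tools.
Local Open Scope ereal_scope.
Context d (T : measurableType d) (R : realType).
Implicit Types (mu : {measure set T -> \bar R}) (f : T -> \bar R).

(** No integrability of [f] is needed: the bound [f_ n <= f] replaces the
    upper half of Fatou's lemma. *)
Lemma cvg_integral_le mu (f_ : nat -> T -> \bar R) f :
  (forall n, measurable_fun setT (f_ n)) ->
  (forall n x, 0 <= f_ n x) -> (forall n x, f_ n x <= f x) ->
  (forall x, f_ ^~ x @ \oo --> f x) ->
  \int[mu]_x f_ n x @[n --> \oo] --> \int[mu]_x f x.
Proof.
move=> mf f0 lef cf.
have mfl : measurable_fun setT f.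
  by apply: (emeasurable_fun_cvg f_) => // x _; exact: cf.
have le1 n : \int[mu]_x f_ n x <= \int[mu]_x f x.
  by apply: ge0_le_integral.
have le2 : \int[mu]_x f x <= limn_einf (fun n => \int[mu]_x f_ n x).
  have := fatou mu measurableT mf (fun n x _ => f0 n x).
  congr (_ <= _); apply: eq_integral => x _.
  by have [-> _] := cvg_limn_einf_sup (cf x).
rewrite limn_einf_lim in le2.
have le3 n : einfs (fun n => \int[mu]_x f_ n x) n <= \int[mu]_x f_ n x.
  by apply: ereal_inf_lbound; exists n => //=.
have h : limn (einfs (fun n => \int[mu]_x f_ n x)) = \int[mu]_x f x.
  apply/eqP; rewrite eq_le le2 andbT; apply: lime_le.
    exact: is_cvg_einfs.
  by apply: nearW => n; exact: le_trans (le3 n) (le1 n).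
apply: (@squeeze_cvge _ _ _ _
   (einfs (fun n => \int[mu]_x f_ n x)) _ (cst (\int[mu]_x f x))).
- by apply: nearW => n; rewrite le3 le1.
- by rewrite -h; exact: is_cvg_einfs.
- exact: cvg_cst.
Qed.

End integral_tools.

(** As [0^-1 = 0], the product [f (f^2)^-1] equals [f^-1] even where [f] vanishes, and the real
    power is applied to the nonnegative [f^2]. *)
Lemma measurable_fun_inv d (T : measurableType d) (R : realType) (f : T -> R) :
  measurable_fun setT f -> measurable_fun setT (fun x => (f x)^-1).
Proof.
move=> mf.
have -> : (fun x => (f x)^-1) = (fun x => f x * (f x ^+ 2) `^ (-1)).
  apply/funext => x; rewrite powR_inv1 ?sqr_ge0//.
  have [->|fx] := eqVneq (f x) 0; first by rewrite invr0 mul0r.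
  by rewrite expr2 invfM mulrA divff// mul1r.
apply: measurable_funM => //.
apply: (measurableT_comp (measurable_powR (-1))).
exact: measurable_funX.
Qed.

Section density.
Local Open Scope ereal_scope.
Context d (T : measurableType d) (R : realType).
Variables (mu : {measure set T -> \bar R}) (Z : T -> R).
Hypotheses (mZ : measurable_fun setT Z) (Z0 : forall x, (0 <= Z x)%R).

Let weighted0 : weighted mu Z set0 = 0.
Proof. exact: integral_set0. Qed.

Let weighted_ge0 A : 0 <= weighted mu Z A.
Proof. by apply: integral_ge0 => x _; rewrite lee_fin. Qed.

Let weighted_sigma_additive : semi_sigma_additive (weighted mu Z).
Proof.
move=> F mF tF mUF; rewrite /weighted; apply: cvg_toP.
  apply: ereal_nondecreasing_is_cvgn => m n mn.
  apply: lee_sum_nneg_natr => // k _ _; apply: integral_ge0 => /= x _.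
  by rewrite lee_fin.
rewrite ge0_integral_bigcup//=.
- exact/measurable_funTS/measurable_EFinP.
- by move=> x _; rewrite lee_fin.
Qed.

Let density : {measure set T -> \bar R} :=
  HB.pack (weighted mu Z)
    (isMeasure.Build _ _ _ (weighted mu Z) weighted0 weighted_ge0
      weighted_sigma_additive).

(** Packing a weighted integral as a measure opens it to the uniqueness theorems for measures. The
    change of density is checked on simple functions and passes to the limit monotonically. *)
Lemma weighted_measure : exists m : {measure set T -> \bar R},
  (forall A, m A = weighted mu Z A) /\
  forall f : T -> \bar R, measurable_fun setT f -> (forall x, 0 <= f x) ->
    \int[m]_x f x = \int[mu]_x (f x * (Z x)%:E).
Proof.
exists density; split=> // f mf f0.
have mZE : measurable_fun setT (EFin \o Z) by exact/measurable_EFinP.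
pose h := nnsfun_approx measurableT mf.
have -> : \int[density]_x f x = limn (fun n => \int[density]_x (h n x)%:E).
  under eq_integral => x _ do
    rewrite -(cvg_lim _ (cvg_nnsfun_approx measurableT mf (fun x _ => f0 x) I))//.
  apply: monotone_convergence => //.
  - by move=> n; exact/measurable_EFinP.
  - by move=> n x _ /=; rewrite lee_fin.
  - by move=> x _ a b ab; rewrite lee_fin; exact/lefP/nd_nnsfun_approx.
have -> : \int[mu]_x (f x * (Z x)%:E) =
    limn (fun n => \int[mu]_x ((h n x)%:E * (Z x)%:E)).
  rewrite (eq_integral (fun x => limn (fun n => (h n x)%:E * (Z x)%:E))); last first.
    move=> x _; apply/esym/cvg_lim => //; apply: cvgeZr => //.
    exact: (cvg_nnsfun_approx measurableT mf (fun x _ => f0 x)).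
  apply: monotone_convergence => //.
  - by move=> n; apply: emeasurable_funM => //; exact/measurable_EFinP.
  - by move=> n x _ /=; rewrite mule_ge0// lee_fin.
  - move=> x _ a b ab; rewrite lee_wpmul2r// ?lee_fin//.
    exact/lefP/nd_nnsfun_approx.
congr (limn _); apply/funext => n; rewrite integralT_nnsfun sintegralE.
under [RHS]eq_integral => x _.
  rewrite fimfunE -fsumEFin// ge0_mule_fsuml; last first.
    by move=> r; exact: nnfun_muleindic_ge0.
  over.
rewrite ge0_integral_fsum//; last 2 first.
- by move=> r; apply: emeasurable_funM => //; apply/measurable_EFinP/measurable_funM.
- by move=> r x _; rewrite mule_ge0 ?lee_fin//; exact: nnfun_muleindic_ge0.
apply: eq_fsbigr => r; rewrite inE => -[t _ <-].
under [RHS]eq_integral do rewrite EFinM -muleA.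
rewrite ge0_integralZl//; last 3 first.
- by apply: emeasurable_funM => //; exact/measurable_EFinP.
- by move=> x _; rewrite mule_ge0 ?lee_fin.
- by rewrite lee_fin.
congr (_ * _); rewrite /= /weighted integral_mkcond.
by apply: eq_integral => x _; rewrite epatch_indic muleC.
Qed.

End density.

Section integral_push.
Local Open Scope ereal_scope.
Context d1 d2 d (T1 : measurableType d1) (T2 : measurableType d2)
  (S : measurableType d) (R : realType).
Variables (m1 : {measure set T1 -> \bar R}) (m2 : {measure set T2 -> \bar R}).
Variables (p1 : T1 -> S) (p2 : T2 -> S) (z1 : T1 -> R) (z2 : T2 -> R).
Hypotheses (mp1 : measurable_fun setT p1) (mp2 : measurable_fun setT p2).
Hypotheses (mz1 : measurable_fun setT z1) (mz2 : measurable_fun setT z2).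
Hypotheses (z10 : forall x, (0 <= z1 x)%R) (z20 : forall x, (0 <= z2 x)%R).

(** The hypothesis on events says that two images of measures with densities coincide, and equal
    measures have equal nonnegative integrals. *)
Lemma integral_pushE :
  (forall A, measurable A -> \int[m1]_(x in p1 @^-1` A) (z1 x)%:E =
                             \int[m2]_(x in p2 @^-1` A) (z2 x)%:E) ->
  forall f : S -> \bar R, measurable_fun setT f -> (forall x, 0 <= f x) ->
    \int[m1]_x (f (p1 x) * (z1 x)%:E) = \int[m2]_x (f (p2 x) * (z2 x)%:E).
Proof.
move=> h f mf f0.
have [w1 [w1E i1]] := weighted_measure m1 mz1 z10.
have [w2 [w2E i2]] := weighted_measure m2 mz2 z20.
rewrite -(i1 (f \o p1))//.
rewrite -(i2 (f \o p2))//.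
rewrite -[LHS](@ge0_integral_pushforward _ _ _ _ _ p1 mp1 w1 setT f)//.
rewrite -[RHS](@ge0_integral_pushforward _ _ _ _ _ p2 mp2 w2 setT f)//.
  apply: eq_measure_integral => A mA _.
  by have := h A mA; rewrite -[LHS]w1E -[RHS]w2E.
- exact: measurableT_comp.
- by move=> x; exact: f0.
- exact: measurableT_comp.
- by move=> x; exact: f0.
Qed.

End integral_push.

(** * Laplace functionals determine laws *)

Section cutoff.
Context (R : realType).
Implicit Types (w x c : R).

Lemma bernoulli_ineq x n : 0 <= x <= 1 -> 1 - n%:R * x <= (1 - x) ^+ n.
Proof.
move=> /andP[x0 x1]; elim: n => [|n ih]; first by rewrite expr0 mul0r subr0.
rewrite exprS; have le1 : (1 - x) * (1 - n%:R * x) <= (1 - x) * (1 - x) ^+ n.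
  by apply: ler_wpM2l => //; rewrite subr_ge0.
apply: le_trans le1; rewrite -natr1.
have : 0 <= (n%:R : R) * x * x by rewrite !mulr_ge0.
nra.
Qed.

(** From [w <= e^(-(1 - w))] and [x <= e^x] comes the bound [m w^m <= (1 - w)^-1]; the remaining
    factor [w^m] still tends to 0. *)
Lemma cvg_natmul_exprn w : 0 <= w < 1 ->
  m%:R * w ^+ (2 * m) @[m --> \oo] --> (0 : R).
Proof.
move=> /andP[w0 w1].
have ub m : m%:R * w ^+ m <= (1 - w)^-1.
  have h1 : w ^+ m <= expR (- (m%:R * (1 - w))).
    rewrite -mulrN expRM_natl lerXn2r ?nnegrE ?expR_ge0//.
    by have := expR_ge1Dx (- (1 - w)); lra.
  have h2 : m%:R * (1 - w) <= expR (m%:R * (1 - w)).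
    by apply: le_trans (expR_ge1Dx _); lra.
  have p : 0 < 1 - w by rewrite subr_gt0.
  rewrite -[leRHS]mul1r ler_pdivlMr// mulrAC.
  apply: (@le_trans _ _ (expR (m%:R * (1 - w)) * expR (- (m%:R * (1 - w))))).
    by apply: ler_pM => //; rewrite ?mulr_ge0 ?exprn_ge0// ltW.
  by rewrite -expRD subrr expR0.
apply: (@squeeze_cvgr _ _ _ _ (cst 0) (fun m => (1 - w)^-1 * w ^+ m)).
- near=> m; rewrite mulr_ge0 ?exprn_ge0//= mul2n -addnn exprD mulrA.
  by rewrite ler_wpM2r ?exprn_ge0.
- exact: cvg_cst.
- rewrite -[X in _ --> X](mulr0 (1 - w)^-1); apply: cvgMr => //.
  by apply: cvg_expr; rewrite ger0_norm.
Unshelve. all: by end_near. Qed.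

(** At [w = e^(- l x)] this is a polynomial in [e^(- l x)]: it turns Laplace
    transforms into masses of rays. *)
Lemma cvg_cutoff w : 0 <= w <= 1 ->
  (1 - w ^+ (2 * m)) ^+ (m * 2 ^ (2 * m)) @[m --> \oo] -->
  ((w < 2^-1)%R%:R : R).
Proof.
move=> /andP[w0 w1].
have wm m : 0 <= w ^+ (2 * m) <= 1 by rewrite exprn_ge0//= exprn_ile1.
(* The exponent [m 2^(2m)] times [w^(2m)] is [m (2w)^(2m)]. Below 1/2 this tends to 0 and
   Bernoulli's inequality gives the limit 1; from 1/2 on it is at least [m], and the power is at
   most [e^(-m) <= 1/(m + 1)]. *)
have [w2|w2] := ltP w 2^-1.
  apply: (@squeeze_cvgr _ _ _ _
      (fun m => 1 - m%:R * (2 * w) ^+ (2 * m)) (cst 1)).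
  - near=> m; apply/andP; split; last first.
      by apply: exprn_ile1; have := wm m; lra.
    apply: le_trans (bernoulli_ineq _ (wm m)).
    by rewrite natrM natrX exprMn mulrA.
  - rewrite -[X in _ --> X]subr0; apply: cvgB; first exact: cvg_cst.
    apply: cvg_natmul_exprn; lra.
  - exact: cvg_cst.
apply: (@squeeze_cvgr _ _ _ _ (cst 0) (fun m => (m%:R + 1)^-1)).
- near=> m; apply/andP; split; first by apply: exprn_ge0; have := wm m; lra.
  have h1 : (2^-1 : R) ^+ (2 * m) <= w ^+ (2 * m).
    by rewrite lerXn2r// nnegrE.
  apply: (@le_trans _ _ (expR (- m%:R))).
    rewrite (_ : - m%:R = (- 2^-1 ^+ (2 * m)) *+ (m * 2 ^ (2 * m))); last first.
      rewrite mulNrn; congr (- _); rewrite -[RHS]mulr_natl natrM natrX -mulrA.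
      by rewrite -exprMn divff// expr1n mulr1.
    rewrite -[X in expR X]mulr_natl expRM_natl lerXn2r ?nnegrE ?expR_ge0//.
      by have := wm m; lra.
    by apply: le_trans (expR_ge1Dx _); rewrite lerD2l lerN2.
  rewrite expRN lef_pV2 ?posrE ?expR_gt0// ?ltr_wpDl//; by rewrite addrC expR_ge1Dx.
- exact: cvg_cst.
- have := @cvg_harmonic R.
  by apply: cvg_trans; apply: near_eq_cvg; near=> m; rewrite /harmonic/= -natr1.
Unshelve. all: by end_near. Qed.

End cutoff.

Section laplace_uniqueness.
Local Open Scope ereal_scope.
Context (R : realType).

Let D : set R := `[0%R, +oo[.

Let mD : measurable D. Proof. exact: measurable_itv. Qed.

Lemma measurable_expRN (l : R) : measurable_fun setT (fun x => expR (- (l * x))).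
Proof.
apply: measurableT_comp; first exact: measurable_expR.
by apply: measurable_funN; exact: mulrl_measurable.
Qed.

Lemma expRN_le1 (x : R) : (0 <= x)%R -> (expR (- x) <= 1)%R.
Proof. by move=> x0; rewrite -expR0 ler_expR oppr_le0. Qed.

Section poly.
Variables (m : {measure set R -> \bar R}) (l : R).
Hypotheses (moo : m setT < +oo) (l0 : (0 <= l)%R).

Let finD : m D < +oo.
Proof. by apply: le_lt_trans moo; rewrite le_measure ?inE. Qed.

Let monomial_integrable (a : R) i :
  m.-integrable D (EFin \o (fun x => a * expR (- (l * x)) ^+ i)%R).
Proof.
apply: measurable_bounded_integrable => //.
- apply: measurable_funTS; apply: measurable_funM => //.
  by apply: measurable_funX; exact: measurable_expRN.
- exists `|a|%R; split; first exact: num_real.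
  move=> M aM x; rewrite /D /= in_itv/= andbT => x0; rewrite normrM.
  apply: le_trans (ltW aM); rewrite ler_piMr// ger0_norm ?exprn_ge0 ?expR_ge0//.
  by apply: exprn_ile1; [exact: expR_ge0|apply: expRN_le1; exact: mulr_ge0].
Qed.

(** Through this, equality of Laplace transforms at the multiples of [l] becomes equality of the
    integrals of every polynomial in [e^(- l x)]. The finite mass makes each monomial integrable. *)
Lemma integral_poly_expRN (p : {poly R}) :
  \int[m]_(x in D) (p.[expR (- (l * x))])%:E =
  \sum_(i < size p) (p`_i)%:E * \int[m]_(x in D) (expR (- ((i%:R * l) * x)))%:E.
Proof.
under eq_integral => x _ do rewrite horner_coef -sumEFin.
rewrite (integral_sum mD (fun i : 'I__ => monomial_integrable p`_i i)).
apply: eq_bigr => i _; under eq_integral do rewrite /= EFinM.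
rewrite integralZl//; last first.
  by have := monomial_integrable 1 i; congr (_.-integrable _ _);
    apply/funext => x; rewrite /= mul1r.
by congr (_ * _); apply: eq_integral => x _; rewrite -expRM_natl mulrN mulrA.
Qed.

End poly.

Variables m1 m2 : {measure set R -> \bar R}.
Hypotheses (m1oo : m1 setT < +oo) (m2oo : m2 setT < +oo).
Hypotheses (m1N : m1 `]-oo, 0%R[%classic = 0) (m2N : m2 `]-oo, 0%R[%classic = 0).
Hypothesis m12 : forall l : R, (0 <= l)%R ->
  \int[m1]_x (expR (- (l * x)))%:E = \int[m2]_x (expR (- (l * x)))%:E.

Let setTN : setT `\` `]-oo, 0%R[%classic = D :> set R.
Proof. by rewrite setTD setCitvl. Qed.

Let mD12 (l : R) : (0 <= l)%R ->
  \int[m1]_(x in D) (expR (- (l * x)))%:E =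
  \int[m2]_(x in D) (expR (- (l * x)))%:E.
Proof.
move=> l0; have := m12 l0.
have mE : measurable_fun setT (fun x : R => (expR (- (l * x)))%:E).
  by apply/measurable_EFinP; exact: measurable_expRN.
have p0 (x : R) : setT x -> 0 <= (expR (- (l * x)))%:E.
  by rewrite lee_fin expR_ge0.
rewrite (ge0_negligible_integral _ _ mE p0 m1N)//.
by rewrite (ge0_negligible_integral _ _ mE p0 m2N)// setTN.
Qed.

(** For [l > 0], [e^(- l x) < e^(- l c)] means [x > c]: the polynomials converge to the indicator of
    the ray and are dominated by 1, which is integrable for a finite measure. *)
Let eq_halfline (p_ : nat -> {poly R}) (l c : R) : (0 < l)%R -> (0 <= c)%R ->
  (forall n w, (0 <= w <= 1)%R -> (`|(p_ n).[w]| <= 1)%R) ->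
  (forall w, (0 < w <= 1)%R ->
    (p_ n).[w] @[n --> \oo] --> ((w < expR (- (l * c)))%R%:R : R)) ->
  m1 `]c, +oo[%classic = m2 `]c, +oo[%classic.
Proof.
move=> l0 c0 p1 pc.
have cvg_m (m : {measure set R -> \bar R}) : m setT < +oo ->
    \int[m]_(x in D) ((p_ n).[expR (- (l * x))])%:E @[n --> \oo] -->
    m `]c, +oo[%classic.
  move=> moo.
  have ui (x : R) : D x -> (0 < expR (- (l * x)) <= 1)%R.
    rewrite /D /= in_itv/= andbT => x0.
    by rewrite expR_gt0 expRN_le1// mulr_ge0// ltW.
  have [] := @dominated_convergence _ _ _ m D mD
      (fun n x => ((p_ n).[expR (- (l * x))])%:E)
      (fun x => (\1_(`]c, +oo[) x)%:E) (cst 1).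
  - move=> n; apply/measurable_EFinP/measurable_funTS.
    under [X in measurable_fun _ X]eq_fun do rewrite horner_coef.
    apply: measurable_sum => i; apply: measurable_funM => //.
    by apply: measurable_funX; exact: measurable_expRN.
  - by apply/measurable_EFinP/measurable_funTS; exact: measurable_indic.
  - apply: aeW => x Dx; apply: cvg_EFin; first exact: nearW.
    have := pc _ (ui x Dx); congr (_ --> _).
    rewrite indicE; congr (_%:R); rewrite ltr_expR ltrN2 ltr_pM2l//.
    by rewrite mem_setE in_itv/= andbT.
  - apply: (@measurable_bounded_integrable _ _ _ m (cst 1%R)) => //.
      by apply: le_lt_trans moo; rewrite le_measure ?inE.
    exists 1%R; split; first exact: num_real.
    by move=> M M1 x _; rewrite /= normr1 ltW.
  - apply: aeW => x n Dx; rewrite lee_fin p1//.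
    by have /andP[/ltW -> ->] := ui x Dx.
  - move=> _ _; rewrite integral_indic// setIidl//.
    by move=> x; rewrite /D /= !in_itv/= !andbT => /ltW; exact: le_trans.
have h1 := cvg_m _ m1oo; have h2 := cvg_m _ m2oo.
rewrite -(cvg_lim _ h1)// -(cvg_lim _ h2)//.
congr (lim (_ @ \oo)); apply/funext => n; rewrite !(integral_poly_expRN _ (ltW l0))//.
by apply: eq_bigr => i _; rewrite mD12// mulr_ge0// ltW.
Qed.

(** Here the threshold is [e^0 = 1], the end of the unit interval, out of reach of the cutoff at
    1/2; the polynomials [1 - w^n] separate [w < 1] from [w = 1]. *)
Let eq_halfline0 : m1 `]0%R, +oo[%classic = m2 `]0%R, +oo[%classic.
Proof.
apply: (@eq_halfline (fun n => 1 - 'X^n)%R 1%R) => //.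
- move=> n w /andP[w0 w1]; rewrite !hornerE.
  by rewrite ger0_norm ?subr_ge0 ?exprn_ile1// gerBl exprn_ge0.
- move=> w /andP[w0]; rewrite mulr0 oppr0 expR0 le_eqVlt => /predU1P[->|w1].
    rewrite ltxx (_ : (fun n => _) = cst (0 : R)%R); first exact: cvg_cst.
    by apply/funext => n; rewrite !hornerE expr1n subrr.
  rewrite w1 -[X in _ --> X]subr0.
  under eq_fun do rewrite !hornerE.
  by apply: cvgB; [exact: cvg_cst|apply: cvg_expr; rewrite gtr0_norm].
Qed.

(** The rate [ln 2 / c] sends the point [c] to 1/2, the threshold of the cutoff polynomials. *)
Let eq_halfline_gt0 (c : R) : (0 < c)%R -> m1 `]c, +oo[%classic = m2 `]c, +oo[%classic.
Proof.
move=> c0; have l20 : (0 < ln 2 :> R)%R by rewrite ln_gt0// ltr1n.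
apply: (@eq_halfline (fun n => (1 - 'X^(2 * n)) ^+ (n * 2 ^ (2 * n)))%R
  (ln 2 / c)) => //.
- by rewrite divr_gt0.
- exact: ltW.
- move=> n w /andP[w0 w1]; rewrite !hornerE normrX.
  apply: exprn_ile1; first exact: normr_ge0.
  by rewrite ger0_norm ?subr_ge0 ?exprn_ile1// gerBl exprn_ge0.
- move=> w /andP[/ltW w0 w1].
  rewrite divfK ?gt_eqF// expRN lnK ?posrE//.
  under eq_fun do rewrite !hornerE.
  by apply: cvg_cutoff; rewrite w0.
Qed.

(** Open right rays form a pi-system that generates the Borel sets. A ray starting below 0 carries
    the whole mass, which is the Laplace transform at 0. *)
Lemma laplace_unique A : measurable A -> m1 A = m2 A.
Proof.
have eqT : m1 setT = m2 setT.
  have := m12 (lexx 0%R).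
  by under eq_integral do rewrite mul0r oppr0 expR0;
     under [in RHS]eq_integral do rewrite mul0r oppr0 expR0;
     rewrite !integral_cst// !mul1e.
pose G := @RGenOInfty.G R.
have mE : measurable = <<s G >> by rewrite -[RHS]RGenOInfty.measurableE.
pose g (k : nat) : set R := `](- k%:R)%R, +oo[%classic.
apply: (measure_unique G g) => //.
- move=> _ _ [x ->] [y ->]; exists (Num.max x y).
  by apply/seteqP; split => z /=; rewrite !in_itv/= !andbT gt_max;
    [move=> [-> ->]|move=> /andP[]].
- by move=> k; exists (- k%:R)%R.
- apply/seteqP; split => // x _; exists (Num.trunc `|x|).+1 => //=.
  rewrite /g /= in_itv/= andbT ltrNl; apply: le_lt_trans (truncnS_gt _).
  by rewrite -normrN ler_norm.
- move=> _ [c ->]; have [c0|c0|<-] := ltgtP 0%R c.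
  + exact: eq_halfline_gt0.
  + have full (m : {measure set R -> \bar R}) : m `]-oo, 0%R[%classic = 0 ->
        m `]c, +oo[%classic = m setT.
      move=> mN; rewrite -(setUv `]c, +oo[%classic) measureU//; last 2 first.
      * exact: measurableC.
      * exact: setICr.
      rewrite [X in _ + X](_ : _ = 0) ?adde0//.
      apply: (subset_measure0 _ _ _ mN) => //; first exact: measurableC.
      move=> x /=; rewrite !in_itv/= andbT => /negP; rewrite -leNgt => xc.
      exact: le_lt_trans xc c0.
    by rewrite !full.
  + exact: eq_halfline0.
- move=> k; apply: (@le_lt_trans _ _ (m1 setT)) => //.
  by apply: le_measure => //; rewrite inE; [exact: measurable_itv|exact: measurableT].
Qed.

End laplace_uniqueness.

Section laplace_step.
Local Open Scope ereal_scope.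
Context d (T : measurableType d) (R : realType).
Variables (m1 m2 : {measure set T -> \bar R}) (X z1 z2 : T -> R).
Hypotheses (mX : measurable_fun setT X) (X0 : forall x, (0 <= X x)%R).
Hypotheses (mz1 : measurable_fun setT z1) (mz2 : measurable_fun setT z2).
Hypotheses (z10 : forall x, (0 <= z1 x)%R) (z20 : forall x, (0 <= z2 x)%R).
Hypotheses (fin1 : \int[m1]_x (z1 x)%:E < +oo).
Hypotheses (fin2 : \int[m2]_x (z2 x)%:E < +oo).

(** One-dimensional uniqueness applied to the images under [X] of the measures with densities [z1]
    and [z2]. The weights leave room for what concerns the other coordinates of a path. *)
Lemma laplace_unique_weighted :
  (forall l : R, (0 <= l)%R ->
    \int[m1]_x (expR (- (l * X x)) * z1 x)%:E =
    \int[m2]_x (expR (- (l * X x)) * z2 x)%:E) ->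
  forall B : set R, measurable B ->
    \int[m1]_(x in X @^-1` B) (z1 x)%:E = \int[m2]_(x in X @^-1` B) (z2 x)%:E.
Proof.
move=> h B mB.
have [w1 [w1E i1]] := weighted_measure m1 mz1 z10.
have [w2 [w2E i2]] := weighted_measure m2 mz2 z20.
pose Xf : {mfun T >-> R} := HB.pack X (isMeasurableFun.Build _ _ _ _ X mX).
have neg0 (w : {measure set T -> \bar R}) :
    pushforward w Xf `]-oo, 0%R[%classic = 0.
  rewrite /pushforward (_ : _ @^-1` _ = set0) ?measure0//.
  by apply/seteqP; split => // x /=; rewrite in_itv/= ltNge X0.
have lap (w : {measure set T -> \bar R}) (l : R) :
    \int[pushforward w Xf]_x (expR (- (l * x)))%:E =
    \int[w]_x (expR (- (l * X x)))%:E.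
  rewrite ge0_integral_pushforward//.
  by apply/measurable_EFinP; exact: measurable_expRN.
have mlX (l : R) : measurable_fun setT (fun x => (expR (- (l * X x)))%:E).
  apply/measurable_EFinP.
  exact: (measurableT_comp (measurable_expRN l) mX).
suff : pushforward w1 Xf B = pushforward w2 Xf B.
  by rewrite /pushforward w1E w2E => e; exact: e.
apply: laplace_unique => //.
- by rewrite -[X in X < _]/(w1 (Xf @^-1` setT)) w1E; exact: fin1.
- by rewrite -[X in X < _]/(w2 (Xf @^-1` setT)) w2E; exact: fin2.
- exact: neg0.
- exact: neg0.
- move=> l l0; have := h l l0; rewrite !lap.
  have p0 x : 0 <= (expR (- (l * X x)))%:E by rewrite lee_fin expR_ge0.
  by rewrite (i1 _ (mlX l) p0) (i2 _ (mlX l) p0).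
Qed.

End laplace_step.

(** * Path space: evaluations, exponentials and cylinders *)

Section paths_measurability.
Context (R : realType).

Lemma measurable_eval (t : {nonneg R}) :
  measurable_fun setT (fun y : paths R => (y t)%:num).
Proof.
move=> _ B mB; rewrite setTI; apply: sub_sigma_algebra.
by exists t, B.
Qed.

Lemma measurable_to_paths d (T : measurableType d) (f : T -> paths R) :
  (forall t, measurable_fun setT (fun w => (f w t)%:num)) ->
  measurable_fun setT f.
Proof.
move=> mf; apply: (@measurability _ _ T (paths R) setT f (@one_dim_cylinders R)) => //.
move=> _ [_ [t [B mB ->]] <-].
by have := mf t measurableT B mB; rewrite !setTI.
Qed.

(** The test functional [e^(-<alpha, y>)] of a Laplace transform. Coefficients and times are kept in
    one list, so that adding a coordinate is a cons and multiplying functionals is a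
    concatenation. *)
Definition path_exp (s : seq (R * {nonneg R})) (y : paths R) : R :=
  expR (- \sum_(p <- s) p.1 * (y p.2)%:num).

Definition nneg_coefs (s : seq (R * {nonneg R})) := all (fun p => 0 <= p.1) s.

Lemma path_exp_ge0 s y : 0 <= path_exp s y.
Proof. exact: expR_ge0. Qed.

Lemma nneg_coefs_sum_ge0 s (y : paths R) : nneg_coefs s ->
  0 <= \sum_(p <- s) p.1 * (y p.2)%:num.
Proof.
by move=> /allP s0; rewrite big_seq; apply: sumr_ge0 => p ps;
  rewrite mulr_ge0// s0.
Qed.

Lemma path_exp_le1 s y : nneg_coefs s -> path_exp s y <= 1.
Proof. by move=> s0; apply: expRN_le1; exact: nneg_coefs_sum_ge0. Qed.

Lemma path_exp_cons p s y :
  path_exp (p :: s) y = expR (- (p.1 * (y p.2)%:num)) * path_exp s y.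
Proof. by rewrite /path_exp big_cons opprD expRD. Qed.

Lemma path_exp_cat s1 s2 y :
  path_exp (s1 ++ s2) y = path_exp s1 y * path_exp s2 y.
Proof. by rewrite /path_exp big_cat opprD expRD. Qed.

Lemma measurable_path_exp s : measurable_fun setT (path_exp s).
Proof.
apply: measurableT_comp; first exact: measurable_expR.
apply: measurable_funN; apply: measurable_sum => p.
by apply: measurable_funM => //; exact: measurable_eval.
Qed.

(** Lists of sides and times, with repeated times allowed: intersection is concatenation, which
    makes the cylinders a pi-system. *)
Definition cylinder (l : seq (set R * {nonneg R})) : set (paths R) :=
  foldr (fun p A => [set y : paths R | p.1 (y p.2)%:num] `&` A) setT l.

Definition borel_sides (l : seq (set R * {nonneg R})) :=
  foldr (fun p A => measurable p.1 /\ A) True l.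

Lemma cylinder_cat l1 l2 : cylinder (l1 ++ l2) = cylinder l1 `&` cylinder l2.
Proof. by elim: l1 => [|p l ih] /=; rewrite ?setTI// ih setIA. Qed.

Lemma borel_sides_cat l1 l2 :
  borel_sides l1 -> borel_sides l2 -> borel_sides (l1 ++ l2).
Proof. by elim: l1 => [|p l ih] //= [mp ml] m2; split => //; exact: ih. Qed.

Lemma measurable_cylinder l : borel_sides l -> measurable (cylinder l).
Proof.
elim: l => [_|p l ih /= [mp ml]] /=; first exact: measurableT.
apply: measurableI; last exact: ih.
by rewrite -[X in measurable X]setTI; exact: measurable_eval.
Qed.

End paths_measurability.

Section paths_uniqueness.
Local Open Scope ereal_scope.
Context (R : realType).
Variables m1 m2 : {measure set (paths R) -> \bar R}.
Hypotheses (m1oo : m1 setT < +oo).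
Hypothesis m12 : forall s, nneg_coefs s ->
  \int[m1]_y (path_exp s y)%:E = \int[m2]_y (path_exp s y)%:E.

Let m12T : m1 setT = m2 setT.
Proof.
have := m12 (isT : nneg_coefs [::]).
by under eq_integral do rewrite /path_exp big_nil oppr0 expR0;
   under [in RHS]eq_integral do rewrite /path_exp big_nil oppr0 expR0;
   rewrite !integral_cst// !mul1e.
Qed.

Let m2oo : m2 setT < +oo. Proof. by rewrite -m12T. Qed.

Let fin (m : {measure set (paths R) -> \bar R}) (A : set (paths R)) s :
  m setT < +oo -> measurable A -> nneg_coefs s ->
  \int[m]_y (path_exp s y * \1_A y)%:E < +oo.
Proof.
move=> moo mA s0; apply: le_lt_trans moo.
rewrite -[leRHS]mul1e -integral_cst//; apply: ge0_le_integral => //.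
- by move=> y _; rewrite lee_fin mulr_ge0 ?path_exp_ge0.
- apply/measurable_EFinP; apply: measurable_funM; first exact: measurable_path_exp.
  exact: measurable_indic.
- move=> y _; rewrite lee_fin mulr_ile1 ?path_exp_ge0 ?path_exp_le1//.
Qed.

(** The coordinates are passed one at a time from exponentials to events. *)
Let eq_cylinder l s : borel_sides l -> nneg_coefs s ->
  \int[m1]_y (path_exp s y * \1_(cylinder l) y)%:E =
  \int[m2]_y (path_exp s y * \1_(cylinder l) y)%:E.
Proof.
elim: l s => [|[B t] l ih] s.
  move=> _ s0 /=.
  under eq_integral do rewrite indicT mulr1.
  under [in RHS]eq_integral do rewrite indicT mulr1.
  exact: m12.
move=> /= [mB ml] s0.
have mz : measurable_fun setT (fun y => path_exp s y * \1_(cylinder l) y)%R.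
  apply: measurable_funM; first exact: measurable_path_exp.
  by apply: measurable_indic; apply: measurable_cylinder.
have z0 y : (0 <= path_exp s y * \1_(cylinder l) y)%R.
  by rewrite mulr_ge0 ?path_exp_ge0.
have mc := measurable_cylinder ml.
have := laplace_unique_weighted (measurable_eval t) (fun y => ge0 (y t)) mz mz z0
  z0 (fin m1oo mc s0) (fin m2oo mc s0) _ mB.
have E (m : {measure set (paths R) -> \bar R}) :
    \int[m]_y (path_exp s y *
      \1_([set y : paths R | B (y t)%:num] `&` cylinder l) y)%:E =
    \int[m]_(y in (fun y : paths R => (y t)%:num) @^-1` B)
      (path_exp s y * \1_(cylinder l) y)%:E.
  rewrite [RHS]integral_mkcond; apply: eq_integral => y _.
  rewrite epatch_indic indicI /= mulrA [in RHS]muleC -EFinM; congr (_%:E).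
  by rewrite mulrCA mulrA.
rewrite -!E; apply=> a a0.
have := ih ((a, t) :: s) ml; rewrite /= a0 => /(_ s0).
by under eq_integral do rewrite path_exp_cons -mulrA;
   under [in RHS]eq_integral do rewrite path_exp_cons -mulrA.
Qed.

(** The cylinders are a generating pi-system, and the whole space is the cylinder of the empty list;
    equality on them is the case where every exponential has been traded for an event. *)
Lemma paths_laplace_unique A : measurable A -> m1 A = m2 A.
Proof.
pose G := [set A : set (paths R) | exists2 l, borel_sides l & A = cylinder l].
apply: (measure_unique G (fun=> setT)) => //.
- apply/seteqP; split.
    apply: smallest_sub; first exact: smallest_sigma_algebra.
    move=> _ [t [B mB ->]]; apply: sub_sigma_algebra; exists [:: (B, t)] => //=.
    by rewrite setIT.
  apply: smallest_sub; first exact: sigma_algebra_measurable.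
  by move=> _ [l ml ->]; exact: measurable_cylinder.
- move=> _ _ [l1 ml1 ->] [l2 ml2 ->]; exists (l1 ++ l2).
    exact: borel_sides_cat.
  by rewrite cylinder_cat.
- by move=> _; exists [::].
- by rewrite bigcup_const.
- move=> _ [l ml ->]; have := eq_cylinder ml (isT : nneg_coefs [::]).
  under eq_integral do rewrite /path_exp big_nil oppr0 expR0 mul1r.
  under [in RHS]eq_integral do rewrite /path_exp big_nil oppr0 expR0 mul1r.
  by rewrite !integral_indic ?setIT//; exact: measurable_cylinder.
Qed.

End paths_uniqueness.

Section process_paths.
Context (R : realType).

(** The absolute value provides the nonnegativity that the type of paths demands; it changes nothing
    for a nonnegative process. *)
Definition process_path (T : Type) (X : {nonneg R} -> T -> R) (w : T) : paths R :=
  fun t => (`|X t w|)%:nng.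

Lemma process_pathE (T : Type) (X : {nonneg R} -> T -> R) w t :
  0 <= X t w -> (process_path X w t)%:num = X t w.
Proof. by move=> X0; rewrite /= ger0_norm. Qed.

Lemma measurable_process_path d (T : measurableType d)
    (X : {nonneg R} -> T -> R) : (forall t, measurable_fun setT (X t)) ->
  measurable_fun setT (process_path X).
Proof.
move=> mX; apply: measurable_to_paths => t /=.
by apply: measurableT_comp; [exact: normr_measurable|exact: mX].
Qed.

(** An event on finitely many coordinates is the preimage of a measurable set of paths, so the
    images of the two measures on path space are compared by their Laplace functionals. *)
Lemma eq_law_laplace d (T : measurableType d) d' (T' : measurableType d')
    (mu : {measure set T -> \bar R}) (mu' : {measure set T' -> \bar R})
    (X : {nonneg R} -> T -> R) (X' : {nonneg R} -> T' -> R) :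
  (mu setT < +oo)%E ->
  (forall t, measurable_fun setT (X t)) ->
  (forall t, measurable_fun setT (X' t)) ->
  (forall t w, 0 <= X t w) -> (forall t w, 0 <= X' t w) ->
  (forall s, nneg_coefs s ->
    \int[mu]_w (expR (- \sum_(p <- s) p.1 * X p.2 w))%:E =
    \int[mu']_w (expR (- \sum_(p <- s) p.1 * X' p.2 w))%:E)%E ->
  eq_law mu X mu' X'.
Proof.
move=> muoo mX mX' X0 X'0 XX' n t B mB.
pose f : {mfun T >-> paths R} := HB.pack (process_path X)
  (isMeasurableFun.Build _ _ _ _ _ (measurable_process_path mX)).
pose f' : {mfun T' >-> paths R} := HB.pack (process_path X')
  (isMeasurableFun.Build _ _ _ _ _ (measurable_process_path mX')).
pose A := [set y : paths R | B [tuple (y (tnth t i))%:num | i < n]].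
have mA : measurable A.
  rewrite -[A]setTI.
  have : measurable_fun setT
      (fun y : paths R => [tuple (y (tnth t i))%:num | i < n]).
    apply/measurable_fun_tnthP => i.
    rewrite (_ : _ \o _ = fun y : paths R => (y (tnth t i))%:num).
      exact: measurable_eval.
    by apply/funext => y /=; rewrite tnth_mktuple.
  exact.
suff : pushforward mu f A = pushforward mu' f' A.
  rewrite /pushforward; congr (_ = _); congr (_ _); apply/seteqP; split => w /=;
    rewrite /A /=; congr B; apply: eq_mktuple => i /=;
    by rewrite ger0_norm.
apply: paths_laplace_unique => //.
move=> s s0; have mE := measurable_path_exp s.
have mEE : measurable_fun setT (fun y : paths R => (path_exp s y)%:E).
  exact/measurable_EFinP.
have p0 : {in setT, forall y : paths R, 0 <= (path_exp s y)%:E}%E.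
  by move=> y _; rewrite lee_fin path_exp_ge0.
have push d0 (S : measurableType d0) (m : {measure set S -> \bar R})
    (g : {mfun S >-> paths R}) :
  (\int[pushforward m g]_y (path_exp s y)%:E = \int[m]_w (path_exp s (g w))%:E)%E.
  by rewrite ge0_integral_pushforward.
rewrite !push.
have E (S : Type) (Z : {nonneg R} -> S -> R) w : (forall t w, 0 <= Z t w) ->
    path_exp s (process_path Z w) = expR (- \sum_(p <- s) p.1 * Z p.2 w).
  by move=> Z0; rewrite /path_exp; under eq_bigr do rewrite process_pathE//.
transitivity (\int[mu]_w (expR (- \sum_(p <- s) p.1 * X p.2 w))%:E)%E.
  by apply: eq_integral => w _; congr (_%:E); exact: E.
rewrite XX'//; apply: eq_integral => w _; congr (_%:E); exact/esym/E.
Qed.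

End process_paths.

(** * Uniqueness of Lévy measures on path space *)

Section countable_coordinates.
Context (R : realType).

Let determined (A : set (paths R)) :=
  exists t : nat -> {nonneg R}, forall y y' : paths R,
    (forall k, y (t k) = y' (t k)) -> A y -> A y'.

(** The sets that depend on countably many coordinates form a sigma-algebra containing the
    one-dimensional cylinders. *)
Lemma measurable_paths_determined (A : set (paths R)) :
  measurable A -> determined A.
Proof.
move: A; apply: smallest_sub; first split => /=.
- by exists (fun=> 0%:nng).
- move=> A [t tA]; exists t => y y' yy'; rewrite setTD => nA A'.
  by apply: nA; apply: tA A' => k; rewrite yy'.
- move=> F dF; have [t tF] := choice dF.
  (* A single sequence lists the coordinates [t i j] of all the sets in the union; an integer that
     codes no pair is sent to time 0. *)
  exists (fun k => if @unpickle (nat * nat)%type k is Some ij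
                   then t ij.1 ij.2 else 0%:nng).
  move=> y y' yy' [i _ Fy]; exists i => //; apply: tF Fy => j.
  by have := yy' (pickle (i, j)); rewrite pickleK.
- move=> _ [t [B mB ->]]; exists (fun=> t) => y y' yy' /=.
  by rewrite (yy' 0%N).
Qed.

End countable_coordinates.

Section levy_measure_uniqueness.
Local Open Scope ereal_scope.
Context (R : realType).
Variables n1 n2 : {measure set (paths R) -> \bar R}.
Hypothesis n1oo : forall s, nneg_coefs s ->
  \int[n1]_y (1 - path_exp s y)%:E < +oo.
Hypothesis n12 : forall s, nneg_coefs s ->
  \int[n1]_y (1 - path_exp s y)%:E = \int[n2]_y (1 - path_exp s y)%:E.

Let pos (t : {nonneg R}) := [set y : paths R | 0 < (y t)%:num]%R.

Let onem_measurable s : measurable_fun setT (fun y : paths R => 1 - path_exp s y)%R.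
Proof. by apply: measurable_funB => //; exact: measurable_path_exp. Qed.

Let onem_ge0 s (y : paths R) : nneg_coefs s -> (0 <= 1 - path_exp s y)%R.
Proof. by move=> s0; rewrite subr_ge0 path_exp_le1. Qed.

(** The identity [1 - e^(-s-u) = (1 - e^(-s)) + e^(-s) (1 - e^(-u))] expresses the Laplace
    functional of the tilted measure [(1 - e^(-u)) dn] by values known for [n]. *)
Let tilted_laplace (n : {measure set (paths R) -> \bar R}) s u :
  nneg_coefs s -> nneg_coefs u ->
  \int[n]_y (1 - path_exp (s ++ u) y)%:E =
  \int[n]_y (1 - path_exp s y)%:E +
  \int[n]_y ((path_exp s y)%:E * (1 - path_exp u y)%:E).
Proof.
move=> s0 u0; rewrite -ge0_integralD//.
- by apply: eq_integral => y _; rewrite path_exp_cat -EFinM -EFinD; congr (_%:E); ring.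
- by move=> y _; rewrite lee_fin onem_ge0.
- exact/measurable_EFinP.
- by move=> y _; rewrite mule_ge0// lee_fin ?path_exp_ge0 ?onem_ge0.
- apply: emeasurable_funM; apply/measurable_EFinP => //.
  exact: measurable_path_exp.
Qed.

(** The density [1 - e^(- y(t))] makes both measures finite, so Laplace functionals identify the
    tilted measures; it is positive where [y(t) > 0], and dividing by it there recovers [n1] and
    [n2]. *)
Let eq_on_pos t (A : set (paths R)) : measurable A -> n1 (A `&` pos t) = n2 (A `&` pos t).
Proof.
move=> mA; pose u := [:: (1%R, t)] : seq (R * {nonneg R}).
have u0 : nneg_coefs u by rewrite /= ler01.
have mu := onem_measurable u; have u_ge0 y := onem_ge0 y u0.
have [m1 [m1E i1]] := weighted_measure n1 mu u_ge0.
have [m2 [m2E i2]] := weighted_measure n2 mu u_ge0.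
have m12 B : measurable B -> m1 B = m2 B.
  apply: paths_laplace_unique; first by rewrite m1E; exact: n1oo.
  move=> s s0; have ms : measurable_fun setT (fun y => (path_exp s y)%:E).
    by apply/measurable_EFinP; exact: measurable_path_exp.
  have p0 y : 0 <= (path_exp s y)%:E by rewrite lee_fin path_exp_ge0.
  rewrite (i1 _ ms p0) (i2 _ ms p0).
  have su0 : nneg_coefs (s ++ u) by rewrite /nneg_coefs all_cat; apply/andP.
  have := n12 su0; rewrite (tilted_laplace n1 s0 u0) (tilted_laplace n2 s0 u0) -(n12 s0).
  set a := integral _ _ (fun y => (1 - path_exp s y)%:E).
  have fa : a \is a fin_num.
    rewrite ge0_fin_numE ?n1oo//; apply: integral_ge0 => y _.
    by rewrite lee_fin onem_ge0.
  move=> e; rewrite -[LHS](addeK _ fa) -[RHS](addeK _ fa).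
  by rewrite [_ + a in LHS]addeC [_ + a in RHS]addeC e.
have mpos : measurable (pos t) := measurable_pos_at t.
pose f y := ((\1_(A `&` pos t) y : R) / (1 - path_exp u y))%:E.
have mf : measurable_fun setT f.
  apply/measurable_EFinP; apply: measurable_funM.
    by apply: measurable_indic; exact: measurableI.
  exact: measurable_fun_inv.
have f0 y : 0 <= f y by rewrite lee_fin divr_ge0// onem_ge0.
have fE y : f y * (1 - path_exp u y)%:E = (\1_(A `&` pos t) y)%:E.
  rewrite -EFinM; congr (_%:E); rewrite indicE.
  have [|_] := boolP (y \in _); last by rewrite !mul0r.
  rewrite inE => -[_ yt]; rewrite divfK// subr_eq0 eq_sym lt_eqF//.
  by rewrite /path_exp big_seq1 mul1r -expR0 ltr_expR oppr_lt0.
have h : \int[m1]_y f y = \int[m2]_y f y by apply: eq_measure_integral => B mB _; exact: m12.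
move: h; rewrite (i1 _ mf f0) (i2 _ mf f0).
under eq_integral do rewrite fE.
under [in RHS]eq_integral do rewrite fE.
by rewrite !integral_indic ?setIT//; exact: measurableI.
Qed.

(** Let countably many times determine [A]. A path of [A] that vanished at all of them would put the
    zero path in [A]; hence [A] is a countable union of pieces where some [y(t_k) > 0], made
    disjoint for additivity. *)
Let eq_off_zero (A : set (paths R)) : measurable A -> ~ A (@zero_path R) -> n1 A = n2 A.
Proof.
move=> mA A0; have [t tA] := measurable_paths_determined mA.
pose F k := A `&` pos (t k).
have FE : A = \bigcup_k seqDU F k.
  rewrite -seqDU_bigcup_eq; apply/seteqP; split => [y Ay|y [k _ []]//].
  apply: contrapT => nF; apply: A0; apply: (tA _ _ _ Ay) => k; apply/val_inj => /=.
  apply/eqP; rewrite eq_le ge0 andbT leNgt; apply/negP => yk.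
  by apply: nF; exists k => //; split.
have mF k : measurable (F k) by apply: measurableI => //; exact: measurable_pos_at.
have mFD k : measurable (seqDU F k).
  by apply: measurableD => //; apply: bigsetU_measurable => i _.
have tF : trivIset setT (seqDU F) := @trivIset_seqDU _ F.
rewrite FE !measure_bigcup//.
apply: eq_eseriesr => k _.
rewrite (_ : seqDU F k = seqDU F k `&` pos (t k)); first exact: eq_on_pos.
by rewrite setIidl// => y -[[]].
Qed.

Hypothesis n1_inner : forall A : set (paths R), measurable A ->
  n1 A = inner_measure n1 (A `\ @zero_path R).
Hypothesis n2_zero : exists S : set (paths R), [/\ measurable S, ~ S (@zero_path R) &
  forall A : set (paths R), measurable A -> n2 A = n2 (A `&` S)].

(** Each measurable part of [A] without the zero path has the same mass under both measures. The
    supremum over such parts gives [n1 A <= n2 A], and the part [A] intersected with the carrier of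
    [n2] gives the converse. *)
Lemma levy_measure_unique (A : set (paths R)) : measurable A -> n1 A = n2 A.
Proof.
move=> mA; rewrite n1_inner// /inner_measure; apply/eqP; rewrite eq_le.
apply/andP; split.
  apply: ge_ereal_sup => _ [B [mB BA] <-].
  rewrite eq_off_zero//; last by move=> /BA [_ /(_ erefl)].
  by apply: le_measure; rewrite ?inE// => y /BA [].
have [S [mS S0 n2S]] := n2_zero.
rewrite n2S//; apply: ereal_sup_ubound; exists (A `&` S).
  split; first exact: measurableI.
  by move=> y [Ay Sy]; split => // y0; apply: S0; rewrite -y0.
apply: eq_off_zero; first exact: measurableI.
by move=> [_ /S0].
Qed.

End levy_measure_uniqueness.

(** * Independence *)

Section independence.
Local Open Scope ereal_scope.
Context (R : realType) d (T : measurableType d) (P : probability T R).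

Lemma integral_le1_fin (Z : T -> R) : measurable_fun setT Z ->
  (forall w, (0 <= Z w <= 1)%R) -> \int[P]_w (Z w)%:E \is a fin_num.
Proof.
move=> mZ Z01; rewrite ge0_fin_numE; last first.
  by apply: integral_ge0 => w _; rewrite lee_fin; have /andP[] := Z01 w.
apply: (@le_lt_trans _ _ (\int[P]_w (cst 1 w))); last first.
  rewrite integral_cst// mul1e; exact: le_lt_trans (probability_le1 P _) (ltry _).
apply: ge0_le_integral => //.
- by move=> w _; rewrite lee_fin; have /andP[] := Z01 w.
- exact/measurable_EFinP.
- by move=> w _; rewrite lee_fin; have /andP[] := Z01 w.
Qed.

(** Independence is the statement for indicators of events; the factors are made general one after
    the other. *)
Lemma indep_expectation_prod n (F : 'I_n -> set (set T)) (Z : 'I_n -> T -> R) :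
  mutually_independent P F ->
  (forall i A, F i A -> measurable A) ->
  (forall i B, measurable B -> F i (Z i @^-1` B)) ->
  (forall i w, (0 <= Z i w <= 1)%R) ->
  \int[P]_w (\prod_(i < n) Z i w)%:E = \prod_(i < n) \int[P]_w (Z i w)%:E.
Proof.
move=> indep mF FZ Z01.
have mZ i : measurable_fun setT (Z i).
  by move=> _ B mB; rewrite setTI; apply: mF (FZ i B mB).
(* The factors of index below [k] are already general, the others are indicators. The case [k = 0]
   is independence itself, the case [k = n] is the claim. *)
pose w k (A : 'I_n -> set T) (i : 'I_n) : T -> R :=
  if (i < k)%N then Z i else \1_(A i).
have mw k A i : (forall i, F i (A i)) -> measurable_fun setT (w k A i).
  by move=> FA; rewrite /w; case: ifP => // _; apply: measurable_indic; exact: mF.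
have w01 k A i x : (0 <= w k A i x <= 1)%R.
  by rewrite /w; case: ifP => // _; rewrite indicE; case: (_ \in _); rewrite ?lexx ler01.
suff claim k A : (k <= n)%N -> (forall i, F i (A i)) ->
    \int[P]_x (\prod_(i < n) w k A i x)%:E = \prod_(i < n) \int[P]_x (w k A i x)%:E.
  have := claim n (fun i => Z i @^-1` setT) (leqnn n) (fun i => FZ i _ measurableT).
  rewrite /w; under eq_integral do under eq_bigr do rewrite ltn_ord.
  by under [in RHS]eq_bigr do rewrite ltn_ord.
elim: k A => [|k ih] A kn FA.
  rewrite /w /=.
  transitivity (\int[P]_x (\1_(\bigcap_(i in [set` [set: 'I_n]%SET]) A i) x)%:E).
    apply: eq_integral => x _; congr (_%:E); rewrite indicE.
    have [xA|xA] := boolP (x \in _).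
      rewrite big1// => i _; rewrite indicE mem_set//.
      by move: xA; rewrite inE => /(_ i); apply; rewrite /= finset.in_setT.
    have [i xAi] : exists i, ~ A i x.
      apply/existsNP; apply: contraNnot xA => h.
      by rewrite inE => i _; exact: h.
    by rewrite (bigD1 i)//= indicE memNset// mul0r.
  rewrite integral_indic//; last first.
    by apply: fin_bigcap_measurable => // i _; exact: mF.
  rewrite setIT; apply: (etrans (indep _ A (fun i _ => FA i))).
  apply: eq_big => [i|i _]; first by rewrite inE.
  by rewrite integral_indic ?setIT//; exact: mF.
pose i0 := Ordinal kn.
pose z x := (\prod_(i < n | i != i0) w k A i x)%R.
have mz : measurable_fun setT z.
  rewrite (_ : z = fun x =>
      (\prod_(i < n) (if i != i0 then w k A i x else 1))%R); last first.
    by apply/funext => x; rewrite /z big_mkcond.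
  by apply: measurable_prod => i _; case: (i != i0) => //; exact: mw.
have z01 x : (0 <= z x <= 1)%R.
  rewrite /z; apply/andP; split.
    by apply: prodr_ge0 => i _; have /andP[] := w01 k A i x.
  by apply: prodr_ile1 => i _; exact: w01.
pose c := \prod_(i < n | i != i0) \int[P]_x (w k A i x)%:E.
have cfin : c \is a fin_num.
  rewrite /c; apply: (big_ind (fun x => x \is a fin_num)) => //.
    by move=> x y; exact: fin_numM.
  by move=> i _; apply: integral_le1_fin => //; exact: mw.
have c0 : (0 <= fine c)%R.
  apply: fine_ge0; apply: prode_ge0 => i _; apply: integral_ge0 => x _.
  by rewrite lee_fin; have /andP[] := w01 k A i x.
have wk i : i != i0 -> w k.+1 A i = w k A i.
  move=> ii0; rewrite /w ltnS leq_eqVlt; case: eqP => [ik|//].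
  by move: ii0; rewrite -val_eqE /= ik eqxx.
have w0 : w k.+1 A i0 = Z i0 by rewrite /w /= ltnSn.
have -> : \prod_(i < n) \int[P]_x (w k.+1 A i x)%:E = \int[P]_x (Z i0 x)%:E * c.
  rewrite (bigD1 i0)//= w0; congr (_ * _).
  by apply: eq_bigr => i ii0; rewrite wk.
have -> : \int[P]_x (\prod_(i < n) w k.+1 A i x)%:E = \int[P]_x ((Z i0 x)%:E * (z x)%:E).
  apply: eq_integral => x _; rewrite -EFinM; congr (_%:E).
  rewrite (bigD1 i0)//= w0; congr (_ * _)%R.
  by apply: eq_bigr => i ii0; rewrite wk.
have mabs : measurable_fun setT (fun x : R => `|x|%:E).
  by apply/measurable_EFinP; exact: normr_measurable.
have Zabs x : `|Z i0 x|%:E = (Z i0 x)%:E.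
  by rewrite ger0_norm//; have /andP[] := Z01 i0 x.
(* The induction hypothesis with the event that [Z i0] lies in [B], at index [i0], gives the
   factorisation for indicators of [B]; [integral_pushE] extends it from sets to a function
   nonnegative on the whole line, whence [|x|] in place of [x]. *)
suff key : \int[P]_x (`|Z i0 x|%:E * (z x)%:E) =
    \int[P]_x (`|Z i0 x|%:E * (cst (fine c) x)%:E).
  rewrite -[in RHS](fineK cfin) -ge0_integralZr//; last 2 first.
  - exact/measurable_EFinP.
  - by move=> x _; rewrite lee_fin; have /andP[] := Z01 i0 x.
  transitivity (\int[P]_x (`|Z i0 x|%:E * (z x)%:E)).
    by apply: eq_integral => x _; rewrite Zabs.
  by rewrite key; apply: eq_integral => x _; rewrite Zabs.
apply: (@integral_pushE _ _ _ _ _ _ _ P P (Z i0) (Z i0) z (cst (fine c))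
  (mZ i0) (mZ i0) mz (measurable_cst _) _ _ _ _ mabs) => //.
- by move=> x; have /andP[] := z01 x.
- move=> B mB.
  pose A' i := if i == i0 then Z i0 @^-1` B else A i.
  have FA' i : F i (A' i) by rewrite /A'; case: eqP => // ->; exact: FZ.
  have wA' i : i != i0 -> w k A' i = w k A i.
    by move=> /negbTE ii0; rewrite /w /A' ii0.
  have wA'0 : w k A' i0 = \1_(Z i0 @^-1` B) by rewrite /w /A' /= ltnn eqxx.
  have mZB : measurable (Z i0 @^-1` B) by exact: mF (FZ i0 B mB).
  have := ih A' (ltnW kn) FA'.
  rewrite [in X in _ = X -> _](bigD1 i0)//= wA'0 integral_indic// setIT.
  rewrite [X in _ = _ * X -> _](_ : _ = c); last first.
    by apply: eq_bigr => i ii0; rewrite wA'.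
  rewrite integral_cst// fineK// [X in _ -> _ = X]muleC => <-.
  rewrite integral_mkcond; apply: eq_integral => x _.
  rewrite epatch_indic -EFinM; congr (_%:E).
  rewrite (bigD1 i0)//= wA'0 mulrC; congr (_ * _)%R.
  by apply: eq_bigr => i ii0; rewrite wA'.
Qed.

End independence.

Section joint_law.
Local Open Scope ereal_scope.
Context (R : realType) d (T : measurableType d) (P : probability T R).

Lemma indep2_expectation (F1 F2 : set (set T)) (Z1 Z2 : T -> R) :
  mutually_independent P (tnth [tuple F1; F2]) ->
  (forall A, F1 A -> measurable A) -> (forall A, F2 A -> measurable A) ->
  (forall B, measurable B -> F1 (Z1 @^-1` B)) ->
  (forall B, measurable B -> F2 (Z2 @^-1` B)) ->
  (forall w, (0 <= Z1 w <= 1)%R) -> (forall w, (0 <= Z2 w <= 1)%R) ->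
  \int[P]_w (Z1 w * Z2 w)%:E = \int[P]_w (Z1 w)%:E * \int[P]_w (Z2 w)%:E.
Proof.
move=> indep m1 m2 FZ1 FZ2 Z1b Z2b.
have := @indep_expectation_prod _ _ _ _ _ _ (tnth [tuple Z1; Z2]) indep.
rewrite !big_ord_recl big_ord0 mule1.
rewrite !(tnth_nth (fun=> 0%R)) /= => <-.
- apply: eq_integral => w _; congr (_%:E).
  by rewrite !big_ord_recl big_ord0 mulr1 !(tnth_nth (fun=> 0%R)).
- by case=> -[|[|//]] i A; rewrite (tnth_nth set0)/=; [exact: m1|exact: m2].
- by case=> -[|[|//]] i B mB; rewrite (tnth_nth set0) (tnth_nth (fun=> 0%R))/=;
    [exact: FZ1|exact: FZ2].
- by case=> -[|[|//]] i w; rewrite (tnth_nth (fun=> 0%R))/=.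
Qed.

Lemma indep3_expectation (F1 F2 F3 : set (set T)) (Z1 Z2 Z3 : T -> R) :
  mutually_independent P (tnth [tuple F1; F2; F3]) ->
  (forall A, F1 A -> measurable A) -> (forall A, F2 A -> measurable A) ->
  (forall A, F3 A -> measurable A) ->
  (forall B, measurable B -> F1 (Z1 @^-1` B)) ->
  (forall B, measurable B -> F2 (Z2 @^-1` B)) ->
  (forall B, measurable B -> F3 (Z3 @^-1` B)) ->
  (forall w, (0 <= Z1 w <= 1)%R) -> (forall w, (0 <= Z2 w <= 1)%R) ->
  (forall w, (0 <= Z3 w <= 1)%R) ->
  \int[P]_w (Z1 w * (Z2 w * Z3 w))%:E =
  \int[P]_w (Z1 w)%:E * (\int[P]_w (Z2 w)%:E * \int[P]_w (Z3 w)%:E).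
Proof.
move=> indep m1 m2 m3 FZ1 FZ2 FZ3 Z1b Z2b Z3b.
have := @indep_expectation_prod _ _ _ _ _ _ (tnth [tuple Z1; Z2; Z3]) indep.
rewrite !big_ord_recl big_ord0 mule1.
rewrite !(tnth_nth (fun=> 0%R)) /= => <-.
- apply: eq_integral => w _; congr (_%:E).
  by rewrite !big_ord_recl big_ord0 mulr1 !(tnth_nth (fun=> 0%R)).
- by case=> -[|[|[|//]]] i A; rewrite (tnth_nth set0)/=;
    [exact: m1|exact: m2|exact: m3].
- by case=> -[|[|[|//]]] i B mB;
    rewrite (tnth_nth set0) (tnth_nth (fun=> 0%R))/=;
    [exact: FZ1|exact: FZ2|exact: FZ3].
- by case=> -[|[|[|//]]] i w; rewrite (tnth_nth (fun=> 0%R))/=.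
Qed.

Section weighted_pair.
Context d1 d2 (S1 : measurableType d1) (S2 : measurableType d2).
Variables (U : {mfun T >-> S1}) (V : {mfun T >-> S2}) (Z : T -> R).
Variables (PU : probability S1 R) (PV : probability S2 R).
Hypotheses (mZ : measurable_fun setT Z) (Z01 : forall w, (0 <= Z w <= 1)%R).
Hypothesis UVZ : forall A B, measurable A -> measurable B ->
  \int[P]_(w in U @^-1` A `&` V @^-1` B) (Z w)%:E =
  \int[P]_w (Z w)%:E * (PU A * PV B).

Let Z0 w : (0 <= Z w)%R. Proof. by have /andP[] := Z01 w. Qed.

Let c := fine (\int[P]_w (Z w)%:E).

Let cE : \int[P]_w (Z w)%:E = c%:E.
Proof. by rewrite fineK// integral_le1_fin. Qed.

Let c0 : (0 <= c)%R.
Proof. by rewrite -lee_fin -cE; apply: integral_ge0 => w _; rewrite lee_fin. Qed.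

Let mUV : measurable_fun setT (fun w => (U w, V w)).
Proof. exact: measurable_fun_pair. Qed.

(** Dividing the weight by its mass [c] gives each rectangle exactly the product of the two
    probabilities, which characterises the product measure. If [c = 0], both sides vanish by
    monotonicity. *)
Let joint_set C : measurable C ->
  \int[P]_(w in (fun w => (U w, V w)) @^-1` C) (Z w)%:E = c%:E * (PU \x PV) C.
Proof.
move=> mC.
have mpre D : measurable D -> measurable ((fun w => (U w, V w)) @^-1` D).
  by move=> mD; rewrite -[X in measurable X]setTI; exact: mUV.
have mZE D : measurable_fun D (EFin \o Z).
  by apply: measurable_funTS; exact/measurable_EFinP.
have [c00|cn0] := eqVneq c 0%R.
  rewrite c00 mul0e; apply/eqP; rewrite eq_le integral_ge0 ?andbT; last first.
    by move=> w _; rewrite lee_fin.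
  apply: (@le_trans _ _ (\int[P]_w (Z w)%:E)); last by rewrite cE c00.
  apply: ge0_subset_integral => //; first exact: mpre.
  by move=> w _; rewrite lee_fin.
have mZc : measurable_fun setT (fun w => Z w / c)%R by exact: measurable_funM.
have Zc0 w : (0 <= Z w / c)%R by rewrite divr_ge0.
have [m [mE _]] := weighted_measure P mZc Zc0.
have mD D : measurable D -> m D = c^-1%:E * \int[P]_(w in D) (Z w)%:E.
  move=> hD; rewrite mE /weighted.
  under eq_integral do rewrite mulrC EFinM.
  rewrite ge0_integralZl ?lee_fin ?invr_ge0//.
  by move=> w _; rewrite lee_fin.
pose f : {mfun T >-> (S1 * S2)%type} :=
  HB.pack (fun w => (U w, V w)) (isMeasurableFun.Build _ _ _ _ _ mUV).
have -> : (PU \x PV) C = m (f @^-1` C).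
  apply: (@product_measure_unique _ _ _ _ _ PU PV (pushforward m f) _ C mC).
  move=> A B mA mB.
  transitivity (c^-1%:E * \int[P]_(w in U @^-1` A `&` V @^-1` B) (Z w)%:E).
    apply: mD; apply: measurableI;
      by rewrite -[X in measurable X]setTI; exact: measurable_funPT.
  by rewrite UVZ// cE muleA -EFinM mulVf// mul1e.
by rewrite mD; [rewrite muleA -EFinM divff// mul1e|exact: mpre].
Qed.

Lemma weighted_joint_law (k : S1 * S2 -> \bar R) :
  measurable_fun setT k -> (forall p, 0 <= k p) ->
  \int[P]_w (k (U w, V w) * (Z w)%:E) =
  \int[P]_w (Z w)%:E * \int[PU]_u \int[PV]_v k (u, v).
Proof.
move=> mk k0; rewrite cE.
transitivity (\int[PU \x PV]_p (k p * c%:E)).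
  apply: (@integral_pushE _ _ _ _ _ _ _ P (PU \x PV) (fun w => (U w, V w)) id
    Z (cst c)) => //.
  move=> A mA; rewrite joint_set//.
  exact/esym/(integral_cst (PU \x PV) mA c%:E).
rewrite ge0_integralZr// muleC; congr (_ * _).
by rewrite fubini_tonelli1.
Qed.

End weighted_pair.

End joint_law.

(** * Differentiation of Laplace functionals *)

Section laplace_derivative.
Context (R : realType).

Lemma onem_expRN_ge (x : R) : 0 <= x -> x / (1 + x) <= 1 - expR (- x).
Proof.
move=> x0; have p : 0 < 1 + x by rewrite ltr_wpDr.
have h : expR (- x) <= (1 + x)^-1.
  by rewrite expRN lef_pV2 ?posrE ?expR_gt0//; exact: expR_ge1Dx.
have -> : x / (1 + x) = 1 - (1 + x)^-1 by field; rewrite gt_eqF.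
by rewrite lerD2l lerN2.
Qed.

Lemma onem_expRN_le (x : R) : 1 - expR (- x) <= x.
Proof. by rewrite lerBlDr -lerBlDl expR_ge1Dx. Qed.

(** The difference quotient [(1 - e^(- h z)) / h] with [h = 1 / (n + 1)], which tends to [z] from
    below. *)
Definition diffq (n : nat) (z : R) : R := n.+1%:R * (1 - expR (- (n.+1%:R^-1 * z))).

Lemma diffq_ge0 n z : 0 <= z -> 0 <= diffq n z.
Proof.
by move=> z0; rewrite mulr_ge0// subr_ge0 expRN_le1// mulr_ge0// invr_ge0.
Qed.

Lemma diffq_le n z : diffq n z <= z.
Proof.
rewrite /diffq mulrC -ler_pdivlMr// mulrC; exact: onem_expRN_le.
Qed.

Lemma diffq_ge n z : 0 <= z -> z / (1 + n.+1%:R^-1 * z) <= diffq n z.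
Proof.
move=> z0; rewrite /diffq.
have -> : z / (1 + n.+1%:R^-1 * z) =
    n.+1%:R * (n.+1%:R^-1 * z / (1 + n.+1%:R^-1 * z)).
  by rewrite !mulrA divff ?mul1r// pnatr_eq0.
by rewrite ler_wpM2l// onem_expRN_ge// mulr_ge0.
Qed.

Lemma cvg_pertinv (u : R) : (1 + n.+1%:R^-1 * u)^-1 @[n --> \oo] --> (1 : R).
Proof.
rewrite -[X in _ --> X]invr1; apply: cvgV; first exact: oner_neq0.
rewrite -[X in _ --> X]addr0; apply: cvgD; first exact: cvg_cst.
rewrite -[X in _ --> X](mul0r u); apply: cvgMl.
exact: cvg_harmonic.
Qed.

Lemma cvg_diffq z : 0 <= z -> diffq n z @[n --> \oo] --> z.
Proof.
move=> z0; apply: (@squeeze_cvgr _ _ _ _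
  (fun n => z * (1 + n.+1%:R^-1 * z)^-1) (cst z)).
- by near=> n; rewrite diffq_ge// diffq_le.
- by rewrite -[X in _ --> X]mulr1; apply: cvgMr; exact: cvg_pertinv.
- exact: cvg_cst.
Unshelve. all: by end_near. Qed.

Lemma measurable_diffq d (T : measurableType d) (f : T -> R) n :
  measurable_fun setT f -> measurable_fun setT (fun x => diffq n (f x)).
Proof.
move=> mf; apply: measurable_funM => //; apply: measurable_funB => //.
exact: (measurableT_comp (measurable_expRN _) mf).
Qed.

Local Open Scope ereal_scope.

(** Differentiating [a |-> E[W exp(- a Z)]] at [0], along [a = 1 / (n + 1)]. *)
Lemma laplace_derivative d (T : measurableType d) (mu : {measure set T -> \bar R})
    d' (S : measurableType d') (m : {measure set S -> \bar R})
    (W Z : T -> R) (b g : S -> R) :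
  measurable_fun setT W -> measurable_fun setT Z ->
  measurable_fun setT b -> measurable_fun setT g ->
  (forall x, (0 <= W x)%R) -> (forall x, (0 <= Z x)%R) ->
  (forall x, (0 <= b x)%R) -> (forall x, (0 <= g x)%R) ->
  0 < \int[mu]_x (W x)%:E < +oo -> \int[mu]_x (W x * Z x)%:E < +oo ->
  \int[m]_x (b x * (1 - expR (- g x)))%:E < +oo ->
  (forall n, \int[mu]_x (W x * expR (- (n.+1%:R^-1 * Z x)))%:E =
    \int[mu]_x (W x)%:E *
    expeR (- \int[m]_x (b x * (1 - expR (- (n.+1%:R^-1 * g x))))%:E)) ->
  \int[mu]_x (W x * Z x)%:E =
  \int[mu]_x (W x)%:E * \int[m]_x (b x * g x)%:E.
Proof.
move=> mW mZ mb mg W0 Z0 b0 g0 /andP[cpos coo] WZoo D0oo lap.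
have inv0 n : (0 <= (n.+1%:R^-1 : R))%R by rewrite invr_ge0.
have mexp d0 (X : measurableType d0) (f : X -> R) (l : R) : measurable_fun setT f ->
    measurable_fun setT (fun x => expR (- (l * f x))).
  by move=> mf; exact: (measurableT_comp (measurable_expRN l) mf).
set c := fine (\int[mu]_x (W x)%:E).
have cE : \int[mu]_x (W x)%:E = c%:E by rewrite fineK// ge0_fin_numE ?ltW.
have c0 : (0 < c)%R by rewrite -lte_fin -cE.
pose q n x : R := (1 - expR (- (n.+1%:R^-1 * x)))%R.
have q0 n x : (0 <= x)%R -> (0 <= q n x)%R.
  by move=> x0; rewrite subr_ge0 expRN_le1// mulr_ge0.
have mq d0 (X : measurableType d0) (f : X -> R) n : measurable_fun setT f ->
    measurable_fun setT (fun x => q n (f x)).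
  by move=> mf; apply: measurable_funB => //; exact: mexp.
pose Dn n := \int[m]_x (b x * q n (g x))%:E.
have Dn_le n : Dn n <= Dn 0%N.
  apply: ge0_le_integral => //.
  - by move=> x _; rewrite lee_fin mulr_ge0// q0.
  - by apply/measurable_EFinP/measurable_funM => //; exact: mq.
  - by apply/measurable_EFinP/measurable_funM => //; exact: mq.
  - move=> x _; rewrite lee_fin ler_wpM2l// /q lerD2l lerN2 ler_expR lerN2.
    by rewrite ler_wpM2r// invr1 invf_le1// ler1n.
have Dn0 n : 0 <= Dn n.
  by apply: integral_ge0 => x _; rewrite lee_fin mulr_ge0// q0.
have Dnoo n : Dn n < +oo.
  apply: le_lt_trans (Dn_le n) _; apply: le_lt_trans D0oo.
  rewrite /Dn le_eqVlt; apply/orP; left; apply/eqP.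
  by apply: eq_integral => x _; rewrite /q invr1 mul1r.
pose dl n := fine (Dn n).
have DnE n : Dn n = (dl n)%:E.
  by apply/esym/fineK; rewrite (ge0_fin_numE (Dn0 n)); exact: Dnoo.
have dl0 n : (0 <= dl n)%R by rewrite fine_ge0.
have dl_le n : (dl n <= dl 0%N)%R.
  by apply: fine_le (Dn_le n); rewrite DnE.
have cvgL : \int[mu]_x (W x * diffq n (Z x))%:E @[n --> \oo] -->
    \int[mu]_x (W x * Z x)%:E.
  apply: cvg_integral_le.
  - by move=> n; apply/measurable_EFinP/measurable_funM => //; exact: measurable_diffq.
  - by move=> n x; rewrite lee_fin mulr_ge0// diffq_ge0.
  - by move=> n x; rewrite lee_fin ler_wpM2l// diffq_le.
  - by move=> x; apply: cvg_EFin; [exact: nearW|apply: cvgMr; exact: cvg_diffq].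
have cvgR : \int[m]_x (b x * diffq n (g x))%:E @[n --> \oo] -->
    \int[m]_x (b x * g x)%:E.
  apply: cvg_integral_le.
  - by move=> n; apply/measurable_EFinP/measurable_funM => //; exact: measurable_diffq.
  - by move=> n x; rewrite lee_fin mulr_ge0// diffq_ge0.
  - by move=> n x; rewrite lee_fin ler_wpM2l// diffq_le.
  - by move=> x; apply: cvg_EFin; [exact: nearW|apply: cvgMr; exact: cvg_diffq].
have RE n : \int[m]_x (b x * diffq n (g x))%:E = (n.+1%:R * dl n)%:E.
  rewrite EFinM -DnE -ge0_integralZl//.
  - by apply: eq_integral => x _; rewrite -EFinM mulrCA.
  - by apply/measurable_EFinP/measurable_funM => //; exact: mq.
  - by move=> x _; rewrite lee_fin mulr_ge0// q0.
(* The exponential form of the Laplace transform enters here: the difference quotient of the left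
   side is the one of [e^(-x)] evaluated at the exponent [dl n]. *)
have LE n : \int[mu]_x (W x * diffq n (Z x))%:E =
    (c * (n.+1%:R * (1 - expR (- dl n))))%:E.
  have e1 : \int[mu]_x (W x)%:E = \int[mu]_x (W x * q n (Z x))%:E +
      \int[mu]_x (W x * expR (- (n.+1%:R^-1 * Z x)))%:E.
    rewrite -ge0_integralD//.
    - by apply: eq_integral => x _; rewrite -EFinD -mulrDr subrK mulr1.
    - by move=> x _; rewrite lee_fin mulr_ge0// q0.
    - by apply/measurable_EFinP/measurable_funM => //; exact: mq.
    - by move=> x _; rewrite lee_fin mulr_ge0// expR_ge0.
    - by apply/measurable_EFinP/measurable_funM => //; exact: mexp.
  have e2 : \int[mu]_x (W x * q n (Z x))%:E = (c * (1 - expR (- dl n)))%:E.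
    move: e1; rewrite lap cE -/(Dn n) DnE /= -EFinM => e1.
    rewrite -[LHS](addeK _ (isT : (c * expR (- dl n))%:E \is a fin_num)) -e1 -EFinB.
    by congr (_%:E); ring.
  rewrite mulrCA EFinM -e2 -ge0_integralZl//.
  - by apply: eq_integral => x _; rewrite -EFinM mulrCA.
  - by apply/measurable_EFinP/measurable_funM => //; exact: mq.
  - by move=> x _; rewrite lee_fin mulr_ge0// q0.
have WZ0 : 0 <= \int[mu]_x (W x * Z x)%:E.
  by apply: integral_ge0 => x _; rewrite lee_fin mulr_ge0.
pose K := fine (\int[mu]_x (W x * Z x)%:E).
have KE : \int[mu]_x (W x * Z x)%:E = K%:E by rewrite fineK// ge0_fin_numE.
have L_le n : (c * (n.+1%:R * (1 - expR (- dl n))) <= K)%R.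
  rewrite -lee_fin -LE -KE; apply: ge0_le_integral => //.
  - by move=> x _; rewrite lee_fin mulr_ge0// diffq_ge0.
  - by apply/measurable_EFinP/measurable_funM => //; exact: measurable_diffq.
  - by apply/measurable_EFinP/measurable_funM.
  - by move=> x _; rewrite lee_fin ler_wpM2l// diffq_le.
(* The finiteness of the integral of [b g] comes out of this bound. Since
   [1 - e^(-x) >= x / (1 + x)] and [dl n <= dl 0], the finite [K] controls [(n + 1) dl n]
   uniformly. *)
have ndl_le n : (n.+1%:R * dl n <= K / c * (1 + dl 0%N))%R.
  have p : (0 < 1 + dl n)%R by rewrite ltr_wpDr.
  apply: (@le_trans _ _ (K / c * (1 + dl n))%R); last first.
    rewrite ler_wpM2l ?lerD2l// divr_ge0 ?(ltW c0)//.
    by rewrite -lee_fin -KE.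
  rewrite -ler_pdivrMr// ler_pdivlMr// mulrC; apply: le_trans (L_le n).
  rewrite ler_wpM2l ?(ltW c0)// -mulrA ler_wpM2l//.
  exact: onem_expRN_ge.
have r0 : 0 <= \int[m]_x (b x * g x)%:E.
  by apply: integral_ge0 => x _; rewrite lee_fin mulr_ge0.
have roo : \int[m]_x (b x * g x)%:E < +oo.
  apply: (@le_lt_trans _ _ (K / c * (1 + dl 0%N))%:E); last exact: ltry.
  rewrite -(cvg_lim _ cvgR)//; apply: lime_le; first by apply/cvg_ex; eexists; exact: cvgR.
  by apply: nearW => n; rewrite RE lee_fin.
pose r := fine (\int[m]_x (b x * g x)%:E).
have rE : \int[m]_x (b x * g x)%:E = r%:E by rewrite fineK// ge0_fin_numE.
have ndl_r n : (n.+1%:R * dl n <= r)%R.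
  rewrite -lee_fin -RE -rE; apply: ge0_le_integral => //.
  - by move=> x _; rewrite lee_fin mulr_ge0// diffq_ge0.
  - by apply/measurable_EFinP/measurable_funM => //; exact: measurable_diffq.
  - by apply/measurable_EFinP/measurable_funM.
  - by move=> x _; rewrite lee_fin ler_wpM2l// diffq_le.
have rr0 : (0 <= r)%R by rewrite -lee_fin -rE.
have cvgr : (n.+1%:R * dl n)%R @[n --> \oo] --> r.
  have := cvgR; rewrite rE => /fine_cvg.
  by under eq_fun do rewrite /= RE.
have cvgl : (c * (n.+1%:R * (1 - expR (- dl n))))%R @[n --> \oo] --> K.
  have := cvgL; rewrite KE => /fine_cvg.
  by under eq_fun do rewrite /= LE.
rewrite KE rE cE -EFinM; congr (_%:E).
suff : (c * (n.+1%:R * (1 - expR (- dl n))))%R @[n --> \oo] --> (c * r)%R.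
  by move=> h; rewrite -(cvg_lim _ cvgl)// -(cvg_lim _ h).
(* As [(n + 1) dl n <= r], the lower bound [x / (1 + x)] for [1 - e^(-x)] has a denominator of at
   most [1 + r / (n + 1)], which tends to 1. *)
apply: cvgMr; apply: (@squeeze_cvgr _ _ _ _
  (fun n => n.+1%:R * dl n * (1 + n.+1%:R^-1 * r)^-1)%R
  (fun n => n.+1%:R * dl n)%R) => //.
- near=> n; apply/andP; split; last by rewrite ler_wpM2l// onem_expRN_le.
  rewrite -mulrA ler_wpM2l//; apply: le_trans (onem_expRN_ge (dl0 n)).
  rewrite ler_wpM2l// lef_pV2 ?posrE ?ltr_wpDr ?mulr_ge0// lerD2l.
  by rewrite mulrC ler_pdivlMr// mulrC.
- by rewrite -[X in _ --> X]mulr1; apply: cvgM => //; exact: cvg_pertinv.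
Unshelve. all: by end_near. Qed.

End laplace_derivative.

(** * Sigma-finiteness from a finite Laplace exponent *)

Lemma sigma_finite_measure_of d (T : measurableType d) (R : realType)
    (mu : {measure set T -> \bar R}) : sigma_finite setT mu ->
  exists mu' : {sigma_finite_measure set T -> \bar R},
    mu = mu' :> {measure set T -> \bar R}.
Proof.
move=> sf.
case: mu sf => f c sf.
pose fm : {measure set T -> \bar R} := Measure.Pack c.
exists (HB.pack_for {sigma_finite_measure set T -> \bar R} f fm
  (Measure_isSigmaFinite.Build d T R fm sf)).
by case: c @fm sf.
Qed.

(** Markov's inequality for [1 - e^(-x)], which is at least [1 - e^(-1/(k+1))] beyond [1/(k+1)],
    bounds the mass of that ray; the null half-line completes the exhaustion. *)
Lemma levy_sigma_finite (R : realType) (rho : {measure set R -> \bar R}) :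
  rho `]-oo, 0]%classic = 0%E ->
  (\int[rho]_(x in `]0%R, +oo[) (1 - expR (- x))%:E < +oo)%E ->
  sigma_finite setT rho.
Proof.
move=> rho0 rhoo.
exists (fun k => `]-oo, 0]%classic `|` `]k.+1%:R^-1, +oo[%classic).
  apply/seteqP; split => // x _.
  have [x0|x0] := leP x 0; first by exists 0%N => //; left; rewrite /= in_itv.
  exists (Num.trunc x^-1) => //; right; rewrite /= in_itv/= andbT.
  by rewrite invf_plt ?posrE// truncnS_gt.
move=> k; split; first by apply: measurableU; exact: measurable_itv.
apply: le_lt_trans (measureU2 _ _ _) _; [exact: measurable_itv..|].
rewrite [X in (X + _)%E]rho0 add0e.
pose e : R := 1 - expR (- k.+1%:R^-1).
have k0 : 0 < k.+1%:R^-1 :> R by rewrite invr_gt0.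
have e0 : 0 < e by rewrite subr_gt0 -expR0 ltr_expR oppr_lt0.
have ineq : (e%:E * rho `]k.+1%:R^-1%R, +oo[%classic <=
    \int[rho]_(x in `]0%R, +oo[) (1 - expR (- x))%:E)%E.
  have mf (D : set R) : measurable D ->
      measurable_fun D (fun x : R => (1 - expR (- x))%:E).
    move=> mD; apply: measurable_funTS; apply/measurable_EFinP.
    apply: measurable_funB => //.
    by apply: measurableT_comp; [exact: measurable_expR|exact: oppr_measurable].
  have sub : (`]k.+1%:R^-1, +oo[%classic : set R) `<=` `]0, +oo[%classic.
    by move=> x /=; rewrite !in_itv/= !andbT; exact: lt_trans.
  apply: (@le_trans _ _ (\int[rho]_(x in `]k.+1%:R^-1%R, +oo[) (1 - expR (- x))%:E)%E).
    rewrite -integral_cst; last exact: measurable_itv.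
    apply: ge0_le_integral => //.
    - by move=> x _; rewrite lee_fin ltW.
    - by apply: mf; exact: measurable_itv.
    - move=> x /=; rewrite in_itv/= andbT => xk.
      by rewrite lee_fin /e lerD2l lerN2 ler_expR lerN2 ltW.
  apply: ge0_subset_integral => //; [by apply: mf; exact: measurable_itv|].
  by move=> x /=; rewrite in_itv/= andbT => x0; rewrite lee_fin subr_ge0 expRN_le1// ltW.
have := le_lt_trans ineq rhoo.
by rewrite -[X in (_ < X)%E](@gt0_muley _ e%:E) ?lte_fin// lte_pmul2l ?lte_fin.
Qed.

(** * The image of ds times rho on path space *)

Lemma pushforward_measure_of d d' (T : measurableType d) (T' : measurableType d')
    (R : realType) (mu : {measure set T -> \bar R}) (f : T -> T') :
  measurable_fun setT f -> exists m : {measure set T' -> \bar R},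
  forall F : T' -> \bar R, measurable_fun setT F -> (forall y, 0 <= F y)%E ->
    (\int[m]_y F y = \int[mu]_x F (f x))%E.
Proof.
move=> mf; pose g : {mfun T >-> T'} :=
  HB.pack f (isMeasurableFun.Build _ _ _ _ _ mf).
unshelve eexists (pushforward mu g); first exact: mf.
by move=> F mF F0; rewrite ge0_integral_pushforward.
Qed.

Section jump_measure.
Local Open Scope ereal_scope.
Context (R : realType) (H : R) (rho : {sigma_finite_measure set R -> \bar R}).
Hypotheses (H0 : (0 < H)%R) (rho0 : rho `]-oo, 0%R]%classic = 0).

Definition jump_of (p : measurableTypeR R * R) : paths R :=
  step_path (p.2 * expR (- p.1)) (expR (- p.1 / H)).

(** The strict inequality is the range of integration of [sato]; the closed version [ckern] below is
    the value at [t] of the jump path at level [s] with [x = 1]. They differ only at the level of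
    [t]. *)
Definition kern (t : {nonneg R}) (s : R) : R :=
  (expR (- s) * (log_level H t < s%:E)%E%:R)%R.

Definition ckern (t : {nonneg R}) (s : R) : R :=
  (expR (- s) * (log_level H t <= s%:E)%E%:R)%R.

Lemma log_level_le (t : {nonneg R}) s :
  (log_level H t <= s%:E) = (expR (- s / H) <= t%:num)%R.
Proof.
rewrite /log_level; case: eqVneq => [->|t0].
  by rewrite leye_eq; apply/esym/negbTE; rewrite -ltNge expR_gt0.
have tp : (0 < t%:num)%R by rewrite lt_neqAle eq_sym t0 ge0.
rewrite lee_fin ln_powR -[in RHS](lnK tp) ler_expR ler_pdivrMr//.
by rewrite mulNr lerNl mulrC.
Qed.

Lemma jump_num s x t : (0 <= x)%R -> ((jump_of (s, x) t)%:num = x * ckern t s)%R.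
Proof.
move=> x0; rewrite /jump_of /= /step indicE mem_setE in_itv/= andbT.
rewrite /ckern log_level_le mulrA ger0_norm//.
by rewrite !mulr_ge0// expR_ge0.
Qed.

Lemma ckern_ge0 t s : (0 <= ckern t s)%R.
Proof. by rewrite mulr_ge0// expR_ge0. Qed.

Lemma kern_ge0 t s : (0 <= kern t s)%R.
Proof. by rewrite mulr_ge0// expR_ge0. Qed.

Lemma measurable_expRopp : measurable_fun setT (fun s : R => expR (- s)).
Proof. by apply: measurableT_comp; [exact: measurable_expR|exact: oppr_measurable]. Qed.

Lemma measurable_level_gt t : measurable [set s : R | log_level H t < s%:E].
Proof.
rewrite /log_level; case: ifP => _.
  by rewrite (_ : mkset _ = set0)//; apply/seteqP; split => // s /=; rewrite ltNge leey.
rewrite (_ : mkset _ = `]ln (t%:num `^ (- H)), +oo[%classic); first exact: measurable_itv.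
by apply/seteqP; split => s /=; rewrite in_itv/= andbT lte_fin.
Qed.

Lemma measurable_level_ge t : measurable [set s : R | log_level H t <= s%:E].
Proof.
rewrite /log_level; case: ifP => _.
  by rewrite (_ : mkset _ = set0)//; apply/seteqP; split => // s /=; rewrite leNgt ltry.
rewrite (_ : mkset _ = `[ln (t%:num `^ (- H)), +oo[%classic); first exact: measurable_itv.
by apply/seteqP; split => s /=; rewrite in_itv/= andbT lee_fin.
Qed.

Lemma kernE t s :
  kern t s = (expR (- s) * \1_([set s : R | (log_level H t < s%:E)%E]) s)%R.
Proof. by rewrite indicE mem_setE. Qed.

Lemma ckernE t s :
  ckern t s = (expR (- s) * \1_([set s : R | (log_level H t <= s%:E)%E]) s)%R.
Proof. by rewrite indicE mem_setE. Qed.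

Lemma measurable_kern t : measurable_fun setT (kern t).
Proof.
rewrite (_ : kern t = fun s => expR (- s) *
    \1_([set s : R | (log_level H t < s%:E)%E]) s)%R; last first.
  by apply/funext => s; exact: kernE.
apply: measurable_funM; first exact: measurable_expRopp.
by apply: measurable_indic; exact: measurable_level_gt.
Qed.

Lemma measurable_ckern t : measurable_fun setT (ckern t).
Proof.
rewrite (_ : ckern t = fun s => expR (- s) *
    \1_([set s : R | (log_level H t <= s%:E)%E]) s)%R; last first.
  by apply/funext => s; exact: ckernE.
apply: measurable_funM; first exact: measurable_expRopp.
by apply: measurable_indic; exact: measurable_level_ge.
Qed.

Lemma measurable_jump_of : measurable_fun setT jump_of.
Proof.
apply: measurable_to_paths => t.
rewrite (_ : (fun w => _) = fun p => `|p.2 * ckern t p.1|%R); last first.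
  apply/funext => -[s x] /=; rewrite /step indicE mem_setE in_itv/= andbT.
  by rewrite /ckern log_level_le mulrA.
apply: measurableT_comp; first exact: normr_measurable.
apply: measurable_funM => //.
exact: (measurableT_comp (measurable_ckern t)).
Qed.

Lemma integral_rho_pos (h : R -> \bar R) : measurable_fun setT h ->
  (forall x, 0 <= h x) ->
  \int[rho]_x h x = \int[rho]_(x in `]0%R, +oo[) h x.
Proof.
move=> mh h0; rewrite (ge0_negligible_integral _ _ mh (fun x _ => h0 x) rho0)//.
by rewrite setTD setCitvl.
Qed.

Lemma measurable_integral_rho (h : measurableTypeR R * R -> \bar R) :
  measurable_fun setT h -> (forall p, 0 <= h p) ->
  measurable_fun setT (fun s : R => \int[rho]_(x in `]0%R, +oo[) h (s, x)).
Proof.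
move=> mh h0.
rewrite (_ : (fun s => _) = fubini_F rho h).
  exact: measurable_fun_fubini_tonelli_F.
apply/funext => s; rewrite /fubini_F integral_rho_pos//.
exact: (measurableT_comp mh).
Qed.

Definition is_jump_measure (m : {measure set (paths R) -> \bar R}) :=
  forall F : paths R -> \bar R, measurable_fun setT F -> (forall y, 0 <= F y) ->
    \int[m]_y F y =
    \int[lebesgue_measure]_s \int[rho]_(x in `]0%R, +oo[) F (jump_of (s, x)).

Lemma jump_measure_exists : exists m, is_jump_measure m.
Proof.
have [m mE] := pushforward_measure_of (lebesgue_measure \x rho) measurable_jump_of.
exists m => F mF F0.
have mk := measurableT_comp mF measurable_jump_of.
rewrite (mE F mF F0) (fubini_tonelli1 (F \o jump_of) mk (fun p => F0 _)).
apply: eq_integral => s _; rewrite /fubini_F integral_rho_pos//.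
- exact: (measurableT_comp mk).
- by move=> x; exact: F0.
Qed.

(** The Laplace exponent of the variable whose Lévy measure is [rho]. *)
Definition levy_exponent (l : R) : \bar R :=
  \int[rho]_(x in `]0%R, +oo[) (1 - expR (- (l * x)))%:E.

Lemma measurable_levy_exponent_comp (f : R -> R) : measurable_fun setT f ->
  (forall s, (0 <= f s)%R) ->
  measurable_fun setT (fun s => levy_exponent (f s)).
Proof.
move=> mf f0.
(* The absolute value makes the integrand nonnegative also for [x <= 0], a null set of [rho], so
   that Tonelli applies on the whole plane. *)
pose k (p : measurableTypeR R * R) := (`|1 - expR (- (f p.1 * p.2))|)%:E.
have mk : measurable_fun setT k.
  apply/measurable_EFinP; apply: measurableT_comp; first exact: normr_measurable.
  apply: measurable_funB => //.
  apply: (measurableT_comp measurable_expRopp); apply: measurable_funM => //.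
  exact: measurableT_comp.
rewrite (_ : (fun s => _) = fubini_F rho k).
  by apply: measurable_fun_fubini_tonelli_F => // p; rewrite lee_fin.
apply/funext => s; rewrite /fubini_F integral_rho_pos//; last first.
- by move=> x; rewrite lee_fin.
- exact: (measurableT_comp mk).
apply: eq_integral => x; rewrite inE/= in_itv/= andbT => x0.
by rewrite /k ger0_norm// subr_ge0 expRN_le1// mulr_ge0// ltW.
Qed.

(** Disposes of all the mismatches between strict and large inequalities at the levels of finitely
    many times. *)
Lemma integral_lebesgue_off_finite (L : seq R) (h1 h2 : R -> \bar R) :
  measurable_fun setT h1 -> measurable_fun setT h2 ->
  (forall s, 0 <= h1 s) -> (forall s, 0 <= h2 s) ->
  (forall s, s \notin L -> h1 s = h2 s) ->
  \int[lebesgue_measure]_s h1 s = \int[lebesgue_measure]_s h2 s.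
Proof.
move=> mh1 mh2 h10 h20 h12.
apply: ge0_ae_eq_integral => //; exists [set` L]; split.
- apply: countable_measurable; first by move=> t; exact: measurable_set1.
  exact/finite_set_countable/finite_seq.
- by apply: countable_lebesgue_measure0; exact/finite_set_countable/finite_seq.
- move=> s /= /not_implyP[_] h; apply/negPn/negP => sL; apply: h; exact: h12.
Qed.

(** A jump path is [x] times a function of [s], so the integral over [x] is a Laplace exponent
    evaluated at a combination of kernels. *)
Lemma jump_measure_laplace m (sg : seq (R * {nonneg R})) :
  is_jump_measure m -> nneg_coefs sg ->
  \int[m]_y (1 - path_exp sg y)%:E =
  \int[lebesgue_measure]_s levy_exponent (\sum_(p <- sg) p.1 * ckern p.2 s)%R.
Proof.
move=> mE sg0.
have mF : measurable_fun setT (fun y : paths R => (1 - path_exp sg y)%:E).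
  apply/measurable_EFinP; apply: measurable_funB; first exact: measurable_cst.
  exact: measurable_path_exp.
have F0 (y : paths R) : 0 <= (1 - path_exp sg y)%:E.
  by rewrite lee_fin subr_ge0 path_exp_le1.
rewrite (mE _ mF F0).
apply: eq_integral => s _; apply: eq_integral => x; rewrite inE/= in_itv/= andbT => x0.
rewrite /path_exp; congr (1 - expR (- _))%:E; rewrite mulr_suml.
by apply: eq_bigr => p _; rewrite jump_num ?ltW// mulrA mulrAC.
Qed.

End jump_measure.

(** Each finite-dimensional law and each Laplace functional involves finitely many times, so
    nonnegativity almost everywhere at each single time lets the process be replaced by its absolute
    value. *)
Lemma eq_law_laplace_ae (R : realType) d (T : measurableType d)
    d' (T' : measurableType d')
    (mu : {measure set T -> \bar R}) (mu' : {measure set T' -> \bar R})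
    (X : {nonneg R} -> T -> R) (X' : {nonneg R} -> T' -> R) :
  (mu setT < +oo)%E ->
  (forall t, measurable_fun setT (X t)) ->
  (forall t, measurable_fun setT (X' t)) ->
  (forall t, {ae mu, forall w, 0 <= X t w}) ->
  (forall t, {ae mu', forall w, 0 <= X' t w}) ->
  (forall s, nneg_coefs s ->
    \int[mu]_w (expR (- \sum_(p <- s) p.1 * X p.2 w))%:E =
    \int[mu']_w (expR (- \sum_(p <- s) p.1 * X' p.2 w))%:E)%E ->
  eq_law mu X mu' X'.
Proof.
have E d0 (S : measurableType d0) (m : {measure set S -> \bar R})
    (Z : {nonneg R} -> S -> R) (mZ : forall t, measurable_fun setT (Z t))
    (Z0 : forall t, {ae m, forall w, 0 <= Z t w}) :
  (forall s, \int[m]_w (expR (- \sum_(p <- s) p.1 * `|Z p.2 w|))%:E =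
    \int[m]_w (expR (- \sum_(p <- s) p.1 * Z p.2 w))%:E)%E /\
  eq_law m Z m (fun t w => `|Z t w|).
  split=> [s|n t B mB].
  - have Zs : {ae m, forall w, forall p, p \in s -> 0 <= Z p.2 w}.
      elim: s => [|p s ih]; first exact: aeW.
      apply: filterS2 ih (Z0 p.2) => w h hp q.
      by rewrite inE => /orP[/eqP ->//|]; exact: h.
    have mA (Z' : {nonneg R} -> S -> R) : (forall t, measurable_fun setT (Z' t)) ->
        measurable_fun setT (fun w => (expR (- \sum_(p <- s) p.1 * Z' p.2 w))%:E).
      move=> mZ'; apply/measurable_EFinP.
      apply: (measurableT_comp (@measurable_expRopp R)).
      by apply: measurable_sum => p; exact: measurable_funM.
    apply: ge0_ae_eq_integral => //.
    + by apply: (mA (fun t w => `|Z t w|)) => t; exact: measurableT_comp.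
    + exact: mA.
    + apply: filterS Zs => w h _; congr (expR (- _))%:E.
      by apply: eq_big_seq => p ps; rewrite ger0_norm// h.
  - have Zs : {ae m, forall w, forall i : 'I_n, 0 <= Z (tnth t i) w}.
      have : forall s : seq 'I_n, {ae m, forall w, forall i, i \in s -> 0 <= Z (tnth t i) w}.
        elim=> [|p s ih]; first exact: aeW.
        apply: filterS2 ih (Z0 (tnth t p)) => w h hp q.
        by rewrite inE => /orP[/eqP ->//|]; exact: h.
      move=> /(_ (enum 'I_n)); apply: filterS => w h i; apply: h.
      exact: mem_enum.
    have mA (Z' : {nonneg R} -> S -> R) : (forall t, measurable_fun setT (Z' t)) ->
        measurable [set w | B [tuple Z' (tnth t i) w | i < n]].
      move=> mZ'; rewrite -[X in measurable X]setTI.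
      have : measurable_fun setT (fun w => [tuple Z' (tnth t i) w | i < n]).
        apply/measurable_fun_tnthP => i.
        rewrite (_ : _ \o _ = Z' (tnth t i)); first exact: mZ'.
        by apply/funext => y /=; rewrite tnth_mktuple.
      exact.
    have mB' := mA (fun t w => `|Z t w|) (fun t => measurableT_comp
      (@normr_measurable R setT) (mZ t)).
    set A1 := [set w | _]; set A2 := [set w | _].
    have mA1 : measurable A1 by exact: mA.
    rewrite -(setIT A1) -(setIT A2) -!integral_indic//.
    apply: ge0_ae_eq_integral => //.
    + by apply/measurable_EFinP; exact: measurable_indic.
    + by apply/measurable_EFinP; exact: measurable_indic.
    + apply: filterS Zs => w h _; congr (_%:E); rewrite !indicE.
      have e : [tuple Z (tnth t i) w | i < n] = [tuple `|Z (tnth t i) w| | i < n].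
        by apply: eq_mktuple => i; rewrite ger0_norm.
      congr (_%:R); congr nat_of_bool; by apply/idP/idP; rewrite !inE /A1 /A2 /= e.
move=> muoo mX mX' X0 X'0 XX' n t B mB.
have [e1 e2] := E _ _ mu X mX X0; have [e1' e2'] := E _ _ mu' X' mX' X'0.
rewrite e2// e2'//; move: n t B mB.
suff : eq_law mu (fun t w => `|X t w|) mu' (fun t w => `|X' t w|) by [].
apply: eq_law_laplace => //.
- by move=> s; exact: measurableT_comp.
- by move=> s; exact: measurableT_comp.
- by move=> s s0; rewrite e1 e1'; exact: XX'.
Qed.

(** * Riemann-Stieltjes sums of the Sato process *)

Section grid.
Context (R : realType) (H : R).

(** Mesh [1/(n + 1)] on the window from [-(n + 1)] to [n + 1], hence [2 (n + 1)^2] cells: the window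
    grows while the mesh shrinks. *)
Definition grid (n i : nat) : R := i%:R / n.+1%:R - n.+1%:R.

Definition grid_size (n : nat) : nat := (2 * n.+1 * n.+1)%N.

(** Open on the left and closed on the right, so that the Stieltjes measure of a cell is an
    increment of the path. *)
Definition cell (n i : nat) : set R := `]grid n i, grid n i.+1]%classic.

Lemma grid_step n i : grid n i.+1 - grid n i = n.+1%:R^-1.
Proof. by rewrite /grid -[i.+1%:R]natr1 mulrDl mul1r; ring. Qed.

Lemma grid_lt n i : grid n i < grid n i.+1.
Proof. by rewrite -subr_gt0 grid_step invr_gt0. Qed.

Lemma grid_le n i j : (i <= j)%N -> grid n i <= grid n j.
Proof. by move=> ij; rewrite /grid lerD2r ler_wpM2r ?invr_ge0// ler_nat. Qed.

Lemma measurable_cell n i : measurable (cell n i).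
Proof. exact: measurable_itv. Qed.

Lemma cellP n i s : cell n i s <-> grid n i < s <= grid n i.+1.
Proof. by rewrite /cell /= in_itv. Qed.

Lemma cell_exists n s : - n.+1%:R < s <= n.+1%:R ->
  exists2 i, (i < grid_size n)%N & cell n i s.
Proof.
move=> /andP[s1 s2].
have ex : exists i, s <= grid n i.+1.
  exists (grid_size n).-1; rewrite prednK//; apply: le_trans s2 _.
  rewrite /grid /grid_size !natrM mulfK ?pnatr_eq0//; lra.
case: (ex_minnP ex) => i si imin; exists i.
  have := imin (grid_size n).-1; rewrite prednK// => h.
  suff /h : s <= grid n (grid_size n) by rewrite -ltnS prednK.
  apply: le_trans s2 _.
  by rewrite /grid /grid_size !natrM mulfK ?pnatr_eq0//; lra.
apply/cellP; rewrite si andbT.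
case: i si imin => [_ _|i si imin]; first by rewrite /grid mul0r sub0r.
by rewrite ltNge; apply/negP => /imin; rewrite ltnn.
Qed.

Lemma cell_uniq n i j s : cell n i s -> cell n j s -> i = j.
Proof.
move=> /cellP/andP[i1 i2] /cellP/andP[j1 j2]; apply/eqP; rewrite eqn_leq.
apply/andP; split; rewrite leqNgt; apply/negP => /(grid_le n) h.
  by have := lt_le_trans i1 (le_trans j2 h); rewrite ltxx.
by have := lt_le_trans j1 (le_trans i2 h); rewrite ltxx.
Qed.

Definition step_sum (n : nat) (c : nat -> R) (s : R) : R :=
  \sum_(i < grid_size n) c i * \1_(cell n i) s.

Lemma step_sum_cell n c i s : (i < grid_size n)%N -> cell n i s ->
  step_sum n c s = c i.
Proof.
move=> iM si; rewrite /step_sum (bigD1 (Ordinal iM))//= indicE mem_set// mulr1.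
rewrite big1 ?addr0// => j ji; rewrite indicE memNset ?mulr0// => sj.
by move: ji; rewrite -val_eqE /= (cell_uniq sj si) eqxx.
Qed.

Lemma step_sum_off n c s : (forall i, (i < grid_size n)%N -> ~ cell n i s) ->
  step_sum n c s = 0.
Proof.
move=> h; apply: big1 => i _; rewrite indicE memNset ?mulr0//; exact: h.
Qed.

Lemma measurable_step_sum n c : measurable_fun setT (step_sum n c).
Proof.
apply: measurable_sum => i; apply: measurable_funM => //.
by apply: measurable_indic; exact: measurable_cell.
Qed.

Lemma step_sum_ge0 n c s : (forall i, 0 <= c i) -> 0 <= step_sum n c s.
Proof. by move=> c0; apply: sumr_ge0 => i _; rewrite mulr_ge0. Qed.

(** At most one cell contains [s], so [g] can be moved inside the sum; [g 0 = 0] removes what lies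
    outside the window. *)
Lemma integral_step_sum (mu : {measure set (measurableTypeR R) -> \bar R}) n
    (c : nat -> R) (g : R -> \bar R) :
  g 0 = 0%E -> (forall i, 0 <= g (c i))%E ->
  (\int[mu]_s g (step_sum n c s) =
   \sum_(i < grid_size n) g (c i) * mu (cell n i))%E.
Proof.
move=> g0 gc0.
transitivity (\int[mu]_s (\sum_(i < grid_size n) g (c i) * (\1_(cell n i) s)%:E))%E.
  apply: eq_integral => s _.
  have [[i iM si]|h] := pselect (exists2 i, (i < grid_size n)%N & cell n i s).
    rewrite (step_sum_cell _ iM si) (bigD1 (Ordinal iM))//= indicE mem_set//.
    rewrite mule1 big1 ?adde0// => j ji; rewrite indicE memNset ?mule0// => sj.
    by move: ji; rewrite -val_eqE /= (cell_uniq sj si) eqxx.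
  rewrite step_sum_off => [|i iM si]; last by apply: h; exists i.
  rewrite g0 big1// => i _; rewrite indicE memNset ?mule0// => si.
  by apply: h; exists i.
have mi (i : 'I_(grid_size n)) :
    measurable_fun setT (fun s : measurableTypeR R => (\1_(cell n i) s : R)%:E).
  apply/measurable_EFinP; apply: measurable_indic; exact: measurable_cell.
rewrite ge0_integral_sum//.
- apply: eq_bigr => i _.
  have i0 s : setT s -> (0 <= (\1_(cell n i) s : R)%:E)%E by rewrite lee_fin.
  rewrite (ge0_integralZl mu measurableT (mi i) i0 (gc0 i)).
  by rewrite integral_indic ?setIT//; exact: measurable_cell.
- by move=> i; apply: emeasurable_funM => //; exact: measurable_cst.
- by move=> i s _; rewrite mule_ge0// ?lee_fin.
Qed.

(** The exponential is taken at the right end of the cell and the indicator at the left end: both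
    are minima over the cell, so the step kernel stays below [kern]. *)
Definition cell_coef (n i : nat) (t : {nonneg R}) : R :=
  expR (- grid n i.+1) * (log_level H t < (grid n i)%:E)%E%:R.

Definition kern_approx (n : nat) (t : {nonneg R}) : R -> R :=
  step_sum n (fun i => cell_coef n i t).

Lemma cell_coef_ge0 n i t : 0 <= cell_coef n i t.
Proof. by rewrite mulr_ge0// expR_ge0. Qed.

Lemma kern_approx_ge0 n t s : 0 <= kern_approx n t s.
Proof. by apply: step_sum_ge0 => i; exact: cell_coef_ge0. Qed.

Lemma kern_approx_le n t s : kern_approx n t s <= kern H t s.
Proof.
have [[i iM si]|h] := pselect (exists2 i, (i < grid_size n)%N & cell n i s).
  rewrite /kern_approx (step_sum_cell _ iM si) /cell_coef /kern.
  move/cellP : si => /andP[s1 s2].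
  have [li|_] := boolP (log_level H t < (grid n i)%:E)%E; last first.
    by rewrite mulr0 mulr_ge0// expR_ge0.
  by rewrite (lt_trans li) ?lte_fin// !mulr1 ler_expR lerN2.
rewrite /kern_approx step_sum_off; first exact: kern_ge0.
by move=> i iM si; apply: h; exists i.
Qed.

(** Once [s] lies in the window and the mesh is smaller than the distance from [s] down to the
    level, the left end of the cell of [s] is above the level, and the approximation is at least
    [e^(- s - 1/(n + 1))]. *)
Lemma cvg_kern_approx t s : kern_approx n t s @[n --> \oo] --> kern H t s.
Proof.
have [ls|ls] := boolP (log_level H t < s%:E)%E; last first.
  have k0 : kern H t s = 0 by rewrite /kern (negbTE ls) mulr0.
  rewrite k0 (_ : (fun n => _) = cst 0); first exact: cvg_cst.
  apply/funext => n; apply/eqP; rewrite eq_le kern_approx_ge0 andbT -k0.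
  exact: kern_approx_le.
have kE : kern H t s = expR (- s) by rewrite /kern ls mulr1.
have [l [lt_l ls']] : exists l : R, (log_level H t <= l%:E)%E /\ l < s.
  move: ls; rewrite /log_level; case: ifP => _; first by rewrite ltNge leey.
  by rewrite lte_fin => ls; exists (ln (t%:num `^ (- H))).
have small (e : R) : 0 < e -> \forall n \near \oo, n.+1%:R^-1 < e.
  move=> e0; have := @cvg_harmonic R => /cvgrPdist_lt/(_ _ e0).
  by apply: filterS => n; rewrite /harmonic/= sub0r normrN ger0_norm// invr_ge0.
rewrite kE; apply: (@squeeze_cvgr _ _ _ _ (fun n => expR (- s - n.+1%:R^-1))
  (cst (expR (- s)))).
- have sl : 0 < s - l by rewrite subr_gt0.
  have s1 : 0 < (`|s| + 1)^-1 by rewrite invr_gt0 ltr_wpDl.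
  near=> n; apply/andP; split; last by rewrite -kE; exact: kern_approx_le.
  have sN : `|s| < n.+1%:R.
    have : n.+1%:R^-1 < (`|s| + 1)^-1 by near: n; exact: small.
    by rewrite ltf_pV2 ?posrE ?ltr_wpDl// => /(lt_trans _); apply; rewrite ltrDl.
  have nl : n.+1%:R^-1 < s - l by near: n; exact: small.
  have sN' : - n.+1%:R < s <= n.+1%:R.
    by move: sN; rewrite ltr_norml => /andP[-> /ltW ->].
  have [i iM si] := cell_exists sN'.
  rewrite /kern_approx (step_sum_cell _ iM si) /cell_coef.
  move/cellP : si => /andP[g1 g2]; have := grid_step n i.
  set v := n.+1%:R^-1 in nl * => gs.
  have lg : l < grid n i by lra.
  have -> : (log_level H t < (grid n i)%:E)%E by apply: le_lt_trans lt_l _; rewrite lte_fin.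
  rewrite mulr1 ler_expR; lra.
- have h : - s - n.+1%:R^-1 @[n --> \oo] --> - s.
    rewrite -[X in _ --> X]subr0; apply: cvgB; first exact: cvg_cst.
    exact: cvg_harmonic.
  exact: (cvg_comp _ _ h (@continuous_expR R (- s))).
- exact: cvg_cst.
Unshelve. all: by end_near. Qed.

Lemma measurable_kern_approx n t : measurable_fun setT (kern_approx n t).
Proof. exact: measurable_step_sum. Qed.

End grid.

Lemma sume_const_nat (R : realType) (a : \bar R) n : (0 <= a)%E ->
  (\sum_(i < n) a = n%:R%:E * a)%E.
Proof.
move=> a0; elim: n => [|n ih]; first by rewrite big_ord0 mul0e.
by rewrite big_ord_recr/= ih -natr1 EFinD ge0_muleDl ?lee_fin// mul1e.
Qed.

Lemma prodEFin (R : realType) (I : Type) (s : seq I) (f : I -> R) :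
  (\prod_(i <- s) (f i)%:E = (\prod_(i <- s) f i)%R%:E)%E.
Proof. by rewrite (big_morph EFin EFinM erefl). Qed.

Lemma eq_distribution_integral d1 d2 d (T1 : measurableType d1)
    (T2 : measurableType d2) (S : measurableType d) (R : realType)
    (m1 : {measure set T1 -> \bar R}) (m2 : {measure set T2 -> \bar R})
    (p1 : T1 -> S) (p2 : T2 -> S) (f : S -> \bar R) :
  measurable_fun setT p1 -> measurable_fun setT p2 ->
  (forall A, measurable A -> m1 (p1 @^-1` A) = m2 (p2 @^-1` A)) ->
  measurable_fun setT f -> (forall x, 0 <= f x)%E ->
  (\int[m1]_x f (p1 x) = \int[m2]_x f (p2 x))%E.
Proof.
move=> mp1 mp2 h mf f0.
rewrite -[LHS](@ge0_integral_pushforward _ _ _ _ _ p1 mp1 m1 setT f)//.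
rewrite -[RHS](@ge0_integral_pushforward _ _ _ _ _ p2 mp2 m2 setT f)//.
by apply: eq_measure_integral => A mA _; exact: h.
Qed.

Lemma integral_gt0 d (T : measurableType d) (R : realType) (P : probability T R)
    (f : T -> R) : measurable_fun setT f -> (forall x, 0 < f x) ->
  (0 < \int[P]_x (f x)%:E)%E.
Proof.
move=> mf f0; rewrite lt_neqAle integral_ge0 ?andbT; last first.
  by move=> x _; rewrite lee_fin ltW.
apply/eqP => h.
have h0 : (\int[P]_x `|(f x)%:E| = 0)%E.
  by rewrite h; apply: eq_integral => x _; rewrite gee0_abs// lee_fin ltW.
have mfE : measurable_fun setT (EFin \o f) by exact/measurable_EFinP.
have /ae_eq_integral_abs : (\int[P]_x `|(EFin \o f) x| = 0)%E by [].
move=> /(_ measurableT mfE) [N [mN N0 subN]].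
have : P setT = 0%E.
  apply: (subset_measure0 _ mN _ N0) => // x _; apply: subN => /= /(_ I)[] fx.
  by have := f0 x; rewrite fx ltxx.
by rewrite probability_setT => /eqP; rewrite onee_eq0.
Qed.

Lemma sigma_rv_comp (R : realType) (T : Type) (X : T -> R) (h : R -> R) (B : set R) :
  measurable_fun setT h -> measurable B -> sigma_rv X ((h \o X) @^-1` B).
Proof.
move=> mh mB; exists (h @^-1` B); last by rewrite setTI.
by rewrite -[X in measurable X]setTI; exact: mh.
Qed.

Lemma sigma_rv_measurable (R : realType) d (T : measurableType d) (X : T -> R) A :
  measurable_fun setT X -> sigma_rv X A -> measurable A.
Proof. by move=> mX [B mB <-]; exact: mX. Qed.

(** * Mean and Laplace transform of the increments over the grid *)

Section levy_increments.
Local Open Scope ereal_scope.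
Context (R : realType) d (T : measurableType d) (P : probability T R).
Variables (Y : T -> cumulative R R) (kappa : R)
  (rho : {sigma_finite_measure set R -> \bar R}).
Hypothesis levyY : double_sided_levy P (fun s w => Y w s).
Hypothesis meanY : 'E_P[fun w => Y w 1%R] = kappa%:E.
Hypothesis levyrho : driftless_levy_measure P (fun w => Y w 1%R) rho.

Lemma cumulative_le w s t : (s <= t)%R -> (Y w s <= Y w t)%R.
Proof. exact: cumulative_is_nondecreasing. Qed.

Lemma measurable_increment s t : measurable_fun setT (fun w => Y w t - Y w s)%R.
Proof. by apply: measurable_funB; exact: (levy_measurable levyY). Qed.

Lemma stationary_integral (f : R -> \bar R) (h s t : R) :
  measurable_fun setT f -> (forall x, 0 <= f x) -> (s <= t)%R ->
  \int[P]_w f (Y w (t + h) - Y w (s + h))%R = \int[P]_w f (Y w t - Y w s)%R.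
Proof.
move=> mf f0 st.
apply: (eq_distribution_integral (measurable_increment _ _)
  (measurable_increment _ _) _ mf f0) => A mA.
exact: (levy_stationary levyY).
Qed.

Lemma integral_increment01 (f : R -> \bar R) : measurable_fun setT f ->
  (forall x, 0 <= f x) ->
  \int[P]_w f (Y w 1 - Y w 0)%R = \int[P]_w f (Y w 1%R).
Proof.
move=> mf f0; apply: ge0_ae_eq_integral => //.
- exact: (measurableT_comp mf (measurable_increment _ _)).
- exact: (measurableT_comp mf (levy_measurable levyY 1%R)).
- have [N [mN N0 subN]] := levy_start levyY.
  exists N; split => // w /= h; apply: subN => /= Y0; apply: h => _.
  by rewrite Y0 subr0.
Qed.

Let unit_sum n w : (Y w 1 - Y w 0 =
  \sum_(i < n.+1) (Y w (i.+1%:R / n.+1%:R) - Y w (i%:R / n.+1%:R)))%R.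
Proof.
rewrite -(big_mkord xpredT (fun i => Y w (i.+1%:R / n.+1%:R) - Y w (i%:R / n.+1%:R))%R).
by rewrite telescope_sumr// divff ?pnatr_eq0// mul0r.
Qed.

Let unit_incr (f : R -> \bar R) n i : measurable_fun setT f ->
  (forall x, 0 <= f x) ->
  \int[P]_w f (Y w (i.+1%:R / n.+1%:R) - Y w (i%:R / n.+1%:R))%R =
  \int[P]_w f (Y w n.+1%:R^-1 - Y w 0)%R.
Proof.
move=> mf f0; rewrite -[RHS](stationary_integral (i%:R / n.+1%:R)%R mf f0)//.
by rewrite add0r -[in i.+1%:R]natr1 mulrDl mul1r addrC.
Qed.

Lemma grid_increment (f : R -> \bar R) n i : measurable_fun setT f ->
  (forall x, 0 <= f x) ->
  \int[P]_w f (Y w (grid R n i.+1) - Y w (grid R n i))%R =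
  \int[P]_w f (Y w n.+1%:R^-1 - Y w 0)%R.
Proof.
move=> mf f0; rewrite -[RHS](stationary_integral (grid R n i) mf f0)//.
by rewrite add0r -(grid_step R n i) subrK.
Qed.

(** By stationarity the increments over [n + 1] equal pieces of the unit interval have the law of a
    grid increment, and their sum has mean [kappa]. The absolute value gives an integrand
    nonnegative on the whole line. *)
Lemma grid_mean n i :
  \int[P]_w (Y w (grid R n i.+1) - Y w (grid R n i))%:E = (kappa / n.+1%:R)%:E.
Proof.
pose f (x : R) : \bar R := `|x|%:E.
have mf : measurable_fun setT f.
  by apply/measurable_EFinP; exact: normr_measurable.
have f0 x : 0 <= f x by rewrite lee_fin.
have absE w s t : (s <= t)%R -> (Y w t - Y w s)%:E = f (Y w t - Y w s)%R.
  by move=> st; rewrite /f ger0_norm// subr_ge0 cumulative_le.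
set a := \int[P]_w f (Y w n.+1%:R^-1 - Y w 0)%R.
have aE : n.+1%:R%:E * a = kappa%:E.
  transitivity (\int[P]_w (Y w 1 - Y w 0)%:E); last first.
    rewrite -meanY unlock; apply: ae_eq_integral => //.
    - by apply/measurable_EFinP; exact: measurable_increment.
    - by apply/measurable_EFinP; exact: (levy_measurable levyY).
    - have [N [mN N0 subN]] := levy_start levyY.
      exists N; split => // w /= h; apply: subN => /= Y0; apply: h => _.
      by rewrite Y0 subr0.
  transitivity (\int[P]_w \sum_(i < n.+1)
      f (Y w (i.+1%:R / n.+1%:R) - Y w (i%:R / n.+1%:R))%R).
    rewrite ge0_integral_sum//.
      under eq_bigr do rewrite unit_incr//.
      by rewrite sume_const_nat// integral_ge0.
    by move=> j; exact: (measurableT_comp mf (measurable_increment _ _)).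
  apply: eq_integral => w _; rewrite (unit_sum n) -sumEFin.
  apply: eq_bigr => j _; rewrite absE// ler_wpM2r ?invr_ge0// ler_nat.
  exact: leqnSn.
rewrite (eq_integral (fun w => f (Y w (grid R n i.+1) - Y w (grid R n i))%R)); last first.
  by move=> w _; rewrite absE// grid_le.
rewrite grid_increment// -/a mulrC EFinM -aE muleA -EFinM mulVf ?mul1e//.
Qed.

Let phi := levy_exponent rho.

Lemma levy_exponent_ge0 l : (0 <= l)%R -> 0 <= phi l.
Proof.
move=> l0; apply: integral_ge0 => x; rewrite /= in_itv/= andbT => x0.
by rewrite lee_fin subr_ge0 expRN_le1// mulr_ge0// ltW.
Qed.

Lemma levy_laplace01 l : (0 <= l)%R ->
  \int[P]_w (expR (- (l * (Y w 1 - Y w 0))))%:E = expeR (- phi l).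
Proof.
move=> l0; rewrite -(levyrho.2 l l0) unlock.
apply: (@integral_increment01 (fun x => (expR (- (l * x)))%:E)).
- by apply/measurable_EFinP; exact: measurable_expRN.
- by move=> x; rewrite lee_fin expR_ge0.
Qed.

(** An infinite exponent would make the Laplace transform vanish, although it integrates a positive
    function against a probability. *)
Lemma levy_exponent_lty l : (0 <= l)%R -> phi l < +oo.
Proof.
move=> l0; rewrite ltey; apply/eqP => phioo.
have := levy_laplace01 l0; rewrite phioo /= => h.
have : 0 < \int[P]_w (expR (- (l * (Y w 1 - Y w 0))))%:E.
  apply: integral_gt0 => [|w]; last exact: expR_gt0.
  exact: (measurableT_comp (measurable_expRN l) (measurable_increment _ _)).
by rewrite h ltxx.
Qed.

Let phir l := fine (phi l).

Let phiE l : (0 <= l)%R -> phi l = (phir l)%:E.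
Proof.
move=> l0; apply/esym/fineK.
by rewrite (ge0_fin_numE (levy_exponent_ge0 l0)); exact: levy_exponent_lty.
Qed.

Let exp01 l s t w : (0 <= l)%R -> (s <= t)%R ->
  (0 <= expR (- (l * (Y w t - Y w s))) <= 1)%R.
Proof.
move=> l0 st; rewrite expR_ge0 expRN_le1// mulr_ge0// subr_ge0.
exact: cumulative_le.
Qed.

Let indep_exp (s : nat -> R) (c : nat -> R) m :
  {homo s : i j / (i <= j)%N >-> (i <= j)%R} -> (forall i, (0 <= c i)%R) ->
  \int[P]_w (\prod_(i < m) expR (- (c i * (Y w (s i.+1) - Y w (s i)))))%:E =
  \prod_(i < m) \int[P]_w (expR (- (c i * (Y w (s i.+1) - Y w (s i)))))%:E.
Proof.
move=> hs c0.
apply: (indep_expectation_prod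
  (F := fun i : 'I_m => sigma_rv (fun w => Y w (s i.+1) - Y w (s i))%R)
  (Z := fun (i : 'I_m) w => expR (- (c i * (Y w (s i.+1) - Y w (s i)))))%R).
- exact: (levy_independent levyY).
- by move=> i A; apply: sigma_rv_measurable; exact: measurable_increment.
- move=> i B mB.
  exact: (sigma_rv_comp (fun w => Y w (s i.+1) - Y w (s i))%R (measurable_expRN (c i))).
- by move=> i w; apply: exp01 => //; exact: hs.
Qed.

(** By independence and stationarity, the power [n + 1] of this transform is the transform of the
    increment over the unit interval, and nonnegative roots are unique. *)
Lemma grid_laplace n i l : (0 <= l)%R ->
  \int[P]_w (expR (- (l * (Y w (grid R n i.+1) - Y w (grid R n i)))))%:E =
  (expR (- (phir l / n.+1%:R)))%:E.
Proof.
move=> l0; pose f (x : R) : \bar R := (expR (- (l * x)))%:E.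
have mf : measurable_fun setT f by apply/measurable_EFinP; exact: measurable_expRN.
have f0 x : 0 <= f x by rewrite lee_fin expR_ge0.
rewrite (grid_increment n i mf f0).
set a := \int[P]_w _.
have afin : a \is a fin_num.
  apply: integral_le1_fin => [|w]; last by apply: exp01; rewrite ?invr_ge0.
  exact: (measurableT_comp (measurable_expRN l) (measurable_increment _ _)).
have a0 : 0 <= a by apply: integral_ge0 => w _; exact: f0.
have : (fine a ^+ n.+1)%:E = expeR (- phi l).
  rewrite -levy_laplace01//.
  pose s (i : nat) : R := (i%:R / n.+1%:R)%R.
  have hs : {homo s : i j / (i <= j)%N >-> (i <= j)%R}.
    by move=> j k jk; rewrite ler_wpM2r ?invr_ge0// ler_nat.
  have := @indep_exp s (fun=> l) n.+1 hs (fun=> l0).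
  rewrite (eq_integral (fun w => (expR (- (l * (Y w 1 - Y w 0))))%:E)); last first.
    move=> w _; rewrite -expR_sum; congr (expR _)%:E.
    by rewrite sumrN -mulr_sumr (unit_sum n).
  move=> ->; rewrite (eq_bigr (fun=> (fine a)%:E)); last first.
    by move=> j _; rewrite (fineK afin); exact: (unit_incr n j mf f0).
  by rewrite prodEFin prodr_const card_ord.
rewrite phiE//= => -[] h; rewrite -(fineK afin); congr (_%:E).
apply/eqP; rewrite -(@eqrXn2 _ n.+1)// ?expR_ge0// ?fine_ge0//.
by rewrite h -expRM_natl mulrN mulrC divfK// pnatr_eq0.
Qed.

Lemma grid_sum_laplace n (c : nat -> R) m : (forall i, (0 <= c i)%R) ->
  \int[P]_w (expR (- \sum_(i < m)
      c i * (Y w (grid R n i.+1) - Y w (grid R n i))))%:E =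
  expeR (- \sum_(i < m) phi (c i) * n.+1%:R^-1%:E).
Proof.
move=> c0; have := @indep_exp (grid R n) c m (@grid_le R n) c0.
rewrite (eq_integral (fun w => (expR (- \sum_(i < m)
      c i * (Y w (grid R n i.+1) - Y w (grid R n i))))%:E)); last first.
  by move=> w _; rewrite -expR_sum -sumrN.
move=> ->.
rewrite (eq_bigr (fun i : 'I_m => (expR (- (phir (c i) / n.+1%:R)))%:E)); last first.
  by move=> i _; rewrite grid_laplace.
rewrite [in RHS](eq_bigr (fun i : 'I_m => (phir (c i) / n.+1%:R)%:E)); last first.
  by move=> i _; rewrite phiE// -EFinM.
rewrite sumEFin /= prodEFin; congr (_%:E).
by rewrite -expR_sum sumrN.
Qed.

End levy_increments.

Lemma lebesgue_stieltjes_measure_itvoc (R : realType) (f : cumulative R R) (a b : R) :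
  a <= b -> (lebesgue_stieltjes_measure f `]a, b]%classic = (f b - f a)%:E)%E.
Proof.
move=> ab; rewrite /lebesgue_stieltjes_measure/= /measure_extension/=.
by rewrite measurable_mu_extE//= ?wlength_itv_bnd// -?EFinB//; exact: is_ocitv.
Qed.

Lemma integral_expRN_itv (R : realType) (a : R) :
  (\int[lebesgue_measure]_(s in `]a, +oo[) (expR (- s))%:E = (expR (- a))%:E)%E.
Proof.
have ce : continuous (fun s : R => expR (- s)).
  move=> s; apply: continuous_comp; last exact: continuous_expR.
  exact: (@continuousN _ R^o).
rewrite integral_itv_obnd_cbnd; last first.
  apply/measurable_EFinP/measurable_funTS; exact: measurable_expRopp.
rewrite (@ge0_continuous_FTC2y _ _ (fun s => - expR (- s)) _ 0)//.
- by rewrite EFinN oppeK add0e.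
- exact: continuous_subspaceT.
- by rewrite -oppr0; apply: cvgN; exact: cvgr_expR.
- by apply: cvg_at_right_filter; apply: cvgN; exact: ce.
- move=> z _; rewrite derive1_comp// derive1N// derive1_id mulN1r derive1_comp// derive1E.
  have /funeqP -> := @derive_expR R.
  by rewrite derive1N// derive1_id mulrN1 opprK.
Qed.

Lemma lebesgue_cell (R : realType) n i :
  (lebesgue_measure (cell n i : set R) = (n.+1%:R^-1)%:E)%E.
Proof.
by rewrite /cell lebesgue_measure_itv/= lte_fin grid_lt -EFinB grid_step.
Qed.

Lemma lebesgue_step_sum (R : realType) n (c : nat -> R) (g : R -> \bar R) :
  g 0 = 0%E -> (forall i, 0 <= g (c i))%E ->
  (\int[lebesgue_measure]_s g (step_sum n c s) =
   \sum_(i < grid_size n) g (c i) * n.+1%:R^-1%:E)%E.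
Proof.
move=> g0 gc; rewrite (integral_step_sum lebesgue_measure n g0 gc).
by apply: eq_bigr => i _; congr (_ * _)%E; exact: lebesgue_cell.
Qed.

Lemma log_level_lt (R : realType) (H : R) (t : {nonneg R}) (s : R) : 0 < H ->
  (log_level H t < s%:E)%E = (expR (- s / H) < t%:num).
Proof.
move=> H0.
rewrite /log_level; case: eqVneq => [->|t0].
  by rewrite ltNge leey; apply/esym/negbTE; rewrite -leNgt expR_ge0.
have tp : (0 < t%:num)%R by rewrite lt_neqAle eq_sym t0 ge0.
rewrite lte_fin ln_powR -[in RHS](lnK tp) ltr_expR ltr_pdivrMr//.
by rewrite mulNr ltrNl mulrC.
Qed.

Lemma kern_le (R : realType) (H : R) (t u : {nonneg R}) (s : R) : 0 < H ->
  t%:num <= u%:num -> kern H t s <= kern H u s.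
Proof.
move=> H0 tu; rewrite /kern ler_wpM2l ?expR_ge0// !log_level_lt// ler_nat.
by case: ltP => // h; rewrite (lt_le_trans h tu).
Qed.

(** * Measurability, mean and monotonicity of the Sato process *)

Section sato.
Local Open Scope ereal_scope.
Context (R : realType) d (T : measurableType d) (P : probability T R).
Variables (H : R) (Y : T -> cumulative R R) (kappa : R)
  (rho : {sigma_finite_measure set R -> \bar R}).
Hypothesis H0 : (0 < H)%R.
Hypothesis levyY : double_sided_levy P (fun s w => Y w s).
Hypothesis meanY : 'E_P[fun w => Y w 1%R] = kappa%:E.
Hypothesis levyrho : driftless_levy_measure P (fun w => Y w 1%R) rho.

Lemma integral_kern (t : {nonneg R}) :
  \int[lebesgue_measure]_s (kern H t s)%:E = (t%:num `^ H)%:E.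
Proof.
rewrite (_ : (fun s => (kern H t s)%:E) =
    ((fun s => (expR (- s))%:E) \_ [set s | log_level H t < s%:E])); last first.
  by apply/funext => s; rewrite epatch_indic kernE EFinM.
rewrite -integral_mkcond /log_level; case: ifPn => [/eqP -> | t0].
  rewrite (_ : mkset _ = set0); last first.
    by apply/seteqP; split => // s /=; rewrite ltNge leey.
  by rewrite integral_set0 powR0// gt_eqF.
rewrite (_ : mkset _ = `]ln (t%:num `^ (- H)), +oo[%classic); last first.
  by apply/seteqP; split => s /=; rewrite in_itv/= andbT lte_fin.
rewrite integral_expRN_itv ln_powR mulNr opprK -ln_powR lnK//.
by rewrite posrE powR_gt0// lt_neqAle eq_sym t0 ge0.
Qed.

(** The path integral before [fine] is applied: limits and monotonicity hold for it on every path,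
    and it is finite almost surely because its mean is. *)
Let Psi t w := \int[lebesgue_stieltjes_measure (Y w)]_s (kern H t s)%:E.

Lemma satoE t w : sato H Y t w = fine (Psi t w).
Proof.
rewrite /sato /Psi; congr fine; rewrite integral_mkcond.
by apply: eq_integral => s _; rewrite epatch_indic kernE EFinM.
Qed.

Let Psi_ge0 t w : 0 <= Psi t w.
Proof. by apply: integral_ge0 => s _; rewrite lee_fin kern_ge0. Qed.

Lemma sato_ge0 t w : (0 <= sato H Y t w)%R.
Proof. by rewrite satoE fine_ge0. Qed.

Definition sato_approx n t w : R := (\sum_(i < grid_size n)
  cell_coef H n i t * (Y w (grid R n i.+1) - Y w (grid R n i)))%R.

Let psi_E n t w :
  \int[lebesgue_stieltjes_measure (Y w)]_s (kern_approx H n t s)%:E = (sato_approx n t w)%:E.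
Proof.
rewrite (integral_step_sum (lebesgue_stieltjes_measure (Y w)) n (g := EFin))//.
  rewrite /sato_approx -sumEFin; apply: eq_bigr => i _.
  rewrite [RHS]EFinM; congr (_ * _); apply: lebesgue_stieltjes_measure_itvoc.
  exact: ltW (grid_lt _ _ _).
by move=> i; rewrite lee_fin cell_coef_ge0.
Qed.

Let incr_ge0 n i w : (0 <= Y w (grid R n i.+1) - Y w (grid R n i))%R.
Proof. by rewrite subr_ge0; apply: cumulative_le; exact: ltW (grid_lt _ _ _). Qed.

Let psi_ge0 n t w : (0 <= sato_approx n t w)%R.
Proof. by apply: sumr_ge0 => i _; rewrite mulr_ge0// cell_coef_ge0. Qed.

Lemma measurable_sato_approx n t : measurable_fun setT (sato_approx n t).
Proof.
apply: measurable_sum => i; apply: measurable_funM => //.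
exact: (measurable_increment levyY).
Qed.

(** Used with the Stieltjes measure of each path and with the Lebesgue measure. *)
Let cvg_kernE (mu : {measure set (measurableTypeR R) -> \bar R}) t :
  \int[mu]_s (kern_approx H n t s)%:E @[n --> \oo] --> \int[mu]_s (kern H t s)%:E.
Proof.
apply: cvg_integral_le.
- by move=> n; apply/measurable_EFinP; exact: measurable_kern_approx.
- by move=> n s; rewrite lee_fin kern_approx_ge0.
- by move=> n s; rewrite lee_fin kern_approx_le.
- by move=> s; apply: cvg_EFin; [exact: nearW|exact: cvg_kern_approx].
Qed.

Let cvg_Psi t w : (sato_approx n t w)%:E @[n --> \oo] --> Psi t w.
Proof.
have := @cvg_kernE (lebesgue_stieltjes_measure (Y w)) t.
by under eq_fun do rewrite psi_E.
Qed.

Let psi_le n t w : (sato_approx n t w)%:E <= Psi t w.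
Proof.
rewrite -psi_E; apply: ge0_le_integral => //.
- by move=> s _; rewrite lee_fin kern_approx_ge0.
- by apply/measurable_EFinP; exact: measurable_kern_approx.
- by apply/measurable_EFinP; exact: measurable_kern.
- by move=> s _; rewrite lee_fin kern_approx_le.
Qed.

Let measurable_Psi t : measurable_fun setT (Psi t).
Proof.
apply: (emeasurable_fun_cvg (fun n w => (sato_approx n t w)%:E)) => [n|w _].
  by apply/measurable_EFinP; exact: measurable_sato_approx.
exact: cvg_Psi.
Qed.

Lemma measurable_sato t : measurable_fun setT (sato H Y t).
Proof.
rewrite (_ : sato H Y t = fine \o Psi t); last by apply/funext => w; exact: satoE.
by apply: measurableT_comp; [exact: fine_measurable|exact: measurable_Psi].
Qed.

(** Increments have mean [kappa] times the length of the cell, so each sum has mean [kappa] times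
    the Lebesgue integral of its step kernel; both sides converge. *)
Let mean_Psi t : \int[P]_w Psi t w = (kappa * t%:num `^ H)%:E.
Proof.
have c1 : \int[P]_w (sato_approx n t w)%:E @[n --> \oo] --> \int[P]_w Psi t w.
  apply: cvg_integral_le.
  - by move=> n; apply/measurable_EFinP; exact: measurable_sato_approx.
  - by move=> n w; rewrite lee_fin psi_ge0.
  - by move=> n w; exact: psi_le.
  - by move=> w; exact: cvg_Psi.
have c2 : kappa%:E * \int[lebesgue_measure]_s (kern_approx H n t s)%:E @[n --> \oo] -->
    (kappa * t%:num `^ H)%:E.
  rewrite EFinM -integral_kern; apply: cvgeZl => //.
rewrite -(cvg_lim _ c1)// -(cvg_lim _ c2)//.
congr (lim (_ @ \oo)); apply/funext => n.
rewrite (lebesgue_step_sum n (g := EFin))//; last first.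
  by move=> i; rewrite lee_fin cell_coef_ge0.
under [in RHS]eq_bigr do rewrite -EFinM.
rewrite sumEFin -EFinM /sato_approx.
under eq_integral do rewrite -sumEFin.
rewrite ge0_integral_sum//.
- under eq_bigr => i _.
    under eq_integral do rewrite EFinM.
    rewrite ge0_integralZl//; last 3 first.
    + by apply/measurable_EFinP; exact: (measurable_increment levyY).
    + by move=> w _; rewrite lee_fin.
    + by rewrite lee_fin cell_coef_ge0.
    rewrite (grid_mean levyY meanY) -EFinM.
    over.
  rewrite sumEFin mulr_sumr; congr (_%:E); apply: eq_bigr => i _.
  by rewrite mulrCA.
- move=> i; apply/measurable_EFinP/measurable_funM => //.
  exact: (measurable_increment levyY).
- by move=> i w _; rewrite lee_fin mulr_ge0// cell_coef_ge0.
Qed.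

Let Psi_fin t : {ae P, forall w, Psi t w \is a fin_num}.
Proof.
have iP : P.-integrable setT (Psi t).
  apply/integrableP; split; first exact: measurable_Psi.
  rewrite (eq_integral (Psi t)); last by move=> w _; rewrite gee0_abs.
  by rewrite mean_Psi ltry.
have [N [mN N0 subN]] := integrable_ae measurableT iP.
by exists N; split => // w /= h; apply: subN => /= h'; apply: h; exact: h'.
Qed.

Lemma sato_mean t : \int[P]_w (sato H Y t w)%:E = (kappa * t%:num `^ H)%:E.
Proof.
rewrite -mean_Psi; apply: ge0_ae_eq_integral => //.
- by apply/measurable_EFinP; exact: measurable_sato.
- by move=> w _; rewrite lee_fin sato_ge0.
- have [N [mN N0 subN]] := Psi_fin t.
  exists N; split => // w /= h; apply: subN => /= fw; apply: h => _.
  by rewrite satoE fineK.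
Qed.

(** [fine] sends [+oo] to 0, so the comparison is made off the null set where one of the two
    integrals is infinite. *)
Lemma sato_le_ae t u : (t%:num <= u%:num)%R ->
  {ae P, forall w, (sato H Y t w <= sato H Y u w)%R}.
Proof.
move=> tu.
have [N [mN N0 subN]] := Psi_fin t; have [M [mM M0 subM]] := Psi_fin u.
exists (N `|` M); split.
- exact: measurableU.
- exact: null_set_setU.
- move=> w h; apply: contrapT => /not_orP[wN wM]; apply: h => /=.
  have ht : Psi t w \is a fin_num by apply: contrapT => /subN.
  have hu : Psi u w \is a fin_num by apply: contrapT => /subM.
  rewrite 2!satoE; apply: (fine_le ht hu).
  apply: ge0_le_integral.
  + exact: measurableT.
  + by move=> s _; rewrite lee_fin; exact: kern_ge0.
  + by apply/measurable_EFinP; exact: measurable_kern.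
  + by apply/measurable_EFinP; exact: measurable_kern.
  + by move=> s _; rewrite lee_fin; exact: kern_le.
Qed.

Lemma cvg_sato_approx t : {ae P, forall w, sato_approx n t w @[n --> \oo] --> sato H Y t w}.
Proof.
have [N [mN N0 subN]] := Psi_fin t.
exists N; split => // w /= h; apply: subN => /= fw; apply: h.
have := @cvg_Psi t w; rewrite -(fineK fw) satoE => /fine_cvg.
exact.
Qed.

(** The derivative at 0 of the Laplace transform of the unit increment, with [W = 1]. The indicator
    and the absolute value put the integrand in the nonnegative form required on the whole line. It
    yields the bound of the exponent at [l] by [kappa l]. *)
Lemma levy_mean : \int[rho]_(x in `]0%R, +oo[) x%:E = kappa%:E.
Proof.
pose D : set R := `]0%R, +oo[%classic.
have mD : measurable D by exact: measurable_itv.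
have DE (h : R -> R) : \int[rho]_x (\1_D x * h x)%:E = \int[rho]_(x in D) (h x)%:E.
  rewrite [RHS]integral_mkcond; apply: eq_integral => x _.
  by rewrite epatch_indic muleC EFinM.
have absE (l : R) : \int[rho]_x (\1_D x * (1 - expR (- (l * `|x|))))%:E =
    levy_exponent rho l.
  rewrite (DE (fun x => 1 - expR (- (l * `|x|)))%R).
  by apply: eq_integral => x; rewrite inE /D/= in_itv/= andbT => x0; rewrite gtr0_norm.
have Z0 w : (0 <= Y w 1 - Y w 0)%R by rewrite subr_ge0 cumulative_le.
have EZ : \int[P]_w (Y w 1 - Y w 0)%:E = kappa%:E.
  rewrite -meanY unlock; apply: ae_eq_integral => //.
  - by apply/measurable_EFinP; exact: (measurable_increment levyY).
  - by apply/measurable_EFinP; exact: (levy_measurable levyY).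
  - have [N [mN N0 subN]] := levy_start levyY.
    exists N; split => // w /= h; apply: subN => /= Y0; apply: h => _.
    by rewrite Y0 subr0.
have c1 : \int[P]_w ((cst 1%R : T -> R) w)%:E = 1.
  rewrite (integral_cst P measurableT 1) mul1e; exact: probability_setT.
have EZ1 : \int[P]_w (cst 1%R w * (Y w 1 - Y w 0))%:E = kappa%:E.
  by rewrite -EZ; apply: eq_integral => w _; rewrite mul1r.
have h : \int[P]_w (cst 1%R w * (Y w 1 - Y w 0))%:E =
    \int[P]_w ((cst 1%R : T -> R) w)%:E * \int[rho]_x (\1_D x * `|x|)%:E.
  apply: (@laplace_derivative R _ _ P _ _ rho (cst 1%R)
    (fun w => Y w 1 - Y w 0)%R (\1_D) (fun x : R => `|x|%R)) => //.
  - exact: (measurable_increment levyY).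
  - by rewrite c1 lte01 ltry.
  - by rewrite EZ1 ltry.
  - rewrite (_ : \int[rho]_x _ = levy_exponent rho 1%R).
      exact: (levy_exponent_lty levyY levyrho ler01).
    by rewrite -absE; apply: eq_integral => x _; rewrite mul1r.
  - move=> n; rewrite c1 mul1e.
    rewrite (_ : \int[rho]_x _ = levy_exponent rho n.+1%:R^-1); last exact: absE.
    rewrite -(levy_laplace01 levyY levyrho) ?invr_ge0//.
    by apply: eq_integral => w _; rewrite mul1r.
move: h; rewrite EZ1 c1 mul1e (DE (fun x => `|x|%R)) => ->.
by apply: eq_integral => x; rewrite inE /D/= in_itv/= andbT => x0; rewrite gtr0_norm.
Qed.

End sato.

Lemma cvg_bigsum (R : realType) (I : eqType) (s : seq I) (u : I -> nat -> R) (l : I -> R) :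
  (forall i, i \in s -> u i n @[n --> \oo] --> l i) ->
  \sum_(i <- s) u i n @[n --> \oo] --> \sum_(i <- s) l i.
Proof.
elim: s => [|i s ih] h.
  by rewrite big_nil; under eq_fun do rewrite big_nil; exact: cvg_cst.
rewrite big_cons; under eq_fun do rewrite big_cons.
apply: cvgD; first by apply: h; rewrite mem_head.
by apply: ih => j js; apply: h; rewrite inE js orbT.
Qed.

(** * The Laplace functional of the Sato process *)

Section sato_laplace.
Local Open Scope ereal_scope.
Context (R : realType) d (T : measurableType d) (P : probability T R).
Variables (H : R) (Y : T -> cumulative R R) (kappa : R)
  (rho : {sigma_finite_measure set R -> \bar R}).
Hypothesis H0 : (0 < H)%R.
Hypothesis levyY : double_sided_levy P (fun s w => Y w s).
Hypothesis meanY : 'E_P[fun w => Y w 1%R] = kappa%:E.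
Hypothesis levyrho : driftless_levy_measure P (fun w => Y w 1%R) rho.

Let phi := levy_exponent rho.

Let D : set R := `]0%R, +oo[%classic.

Let mD : measurable D. Proof. exact: measurable_itv. Qed.

Let phi_le l : (0 <= l)%R -> phi l <= (l * kappa)%:E.
Proof.
move=> l0; rewrite EFinM -(levy_mean levyY meanY levyrho) -ge0_integralZl//; last first.
  by move=> x; rewrite /= in_itv/= andbT => x0; rewrite lee_fin ltW.
apply: ge0_le_integral => //.
- move=> x; rewrite /= in_itv/= andbT => x0.
  by rewrite lee_fin subr_ge0 expRN_le1// mulr_ge0// ltW.
- apply/measurable_EFinP/measurable_funTS/measurable_funB => //.
  exact: measurable_expRN.
- by apply/measurable_EFinP/measurable_funTS; exact: mulrl_measurable.
- by move=> x _; rewrite lee_fin onem_expRN_le.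
Qed.

Let phi0 : phi 0%R = 0.
Proof.
by apply: integral0_eq => x _; rewrite mul0r oppr0 expR0 subrr.
Qed.

Let phi_mono a b : (0 <= a)%R -> (a <= b)%R -> phi a <= phi b.
Proof.
move=> a0 ab; have mf l : measurable_fun D (fun x => (1 - expR (- (l * x)))%:E).
  apply/measurable_EFinP/measurable_funTS/measurable_funB => //.
  exact: measurable_expRN.
apply: (@ge0_le_integral _ _ _ rho D mD _ _ _ (mf a) (mf b)).
- move=> x; rewrite /D/= in_itv/= andbT => x0.
  by rewrite lee_fin subr_ge0 expRN_le1// mulr_ge0// ltW.
- move=> x; rewrite /D/= in_itv/= andbT => x0.
  by rewrite lee_fin lerD2l lerN2 ler_expR lerN2 ler_wpM2r// ltW.
Qed.

Let phi_cvg (a_ : nat -> R) (a C : R) : (forall n, (0 <= a_ n <= C)%R) ->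
  a_ n @[n --> \oo] --> a -> phi (a_ n) @[n --> \oo] --> phi a.
Proof.
move=> aC cva.
have C0 : (0 <= C)%R by have /andP[] := aC 0%N; exact: le_trans.
have mf l : measurable_fun D (fun x => (1 - expR (- (l * x)))%:E).
  apply/measurable_EFinP/measurable_funTS/measurable_funB => //.
  exact: measurable_expRN.
have [] := @dominated_convergence _ _ _ rho D mD
  (fun n x => (1 - expR (- (a_ n * x)))%:E) (fun x => (1 - expR (- (a * x)))%:E)
  (fun x => (1 - expR (- (C * x)))%:E).
- by move=> n; exact: mf.
- exact: mf.
- apply: aeW => x _; apply: cvg_EFin; first exact: nearW.
  apply: cvgB; first exact: cvg_cst.
  have h : (- (a_ n * x))%R @[n --> \oo] --> (- (a * x))%R by apply: cvgN; exact: cvgMl.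
  exact: (cvg_comp _ _ h (@continuous_expR R _)).
- apply/integrableP; split; first exact: mf.
  rewrite (eq_integral (fun x => (1 - expR (- (C * x)))%:E)).
    exact: (levy_exponent_lty levyY levyrho C0).
  move=> x; rewrite inE /D/= in_itv/= andbT => x0.
  by rewrite /= ger0_norm// subr_ge0 expRN_le1// mulr_ge0// ltW.
- apply: aeW => x n; rewrite /D/= in_itv/= andbT => x0; rewrite /= ger0_norm; last first.
    rewrite subr_ge0 expRN_le1// mulr_ge0// ?(ltW x0)//.
    by have /andP[] := aC n.
  rewrite lee_fin lerD2l lerN2 ler_expR lerN2 ler_wpM2r ?(ltW x0)//.
  by have /andP[] := aC n.
- by move=> _ _; exact.
Qed.

Variable sg : seq (R * {nonneg R}).
(** Only the combined kernel has to be nonnegative: single coefficients may be negative, so that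
    combinations of the increments [psi (max t a) - psi a] are covered as well. *)
Hypothesis sg_ge0 : forall s : R,
  (0 <= \sum_(p <- sg) p.1 * (log_level H p.2 < s%:E)%E%:R)%R.

Let f s : R := (\sum_(p <- sg) p.1 * kern H p.2 s)%R.
(** With absolute values on the coefficients, a majorant of [f] and of all its step approximations,
    which is integrable because each kernel is. *)
Let g s : R := (\sum_(p <- sg) `|p.1| * kern H p.2 s)%R.
Let c n i : R := (\sum_(p <- sg) p.1 * cell_coef H n i p.2)%R.

Let c_ge0 n i : (0 <= c n i)%R.
Proof.
rewrite /c (eq_bigr (fun p => expR (- grid R n i.+1) *
    (p.1 * (log_level H p.2 < (grid R n i)%:E)%E%:R))%R).
  by rewrite -mulr_sumr mulr_ge0// expR_ge0.
by move=> p _; rewrite /cell_coef mulrCA.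
Qed.

Let f_nE n s : (\sum_(p <- sg) p.1 * kern_approx H n p.2 s)%R = step_sum n (c n) s.
Proof.
rewrite /kern_approx /step_sum; under eq_bigr do rewrite mulr_sumr.
rewrite exchange_big/=; apply: eq_bigr => i _; rewrite /c mulr_suml.
by apply: eq_bigr => p _; rewrite mulrA.
Qed.

Let f_n_ge0 n s : (0 <= step_sum n (c n) s)%R.
Proof. by apply: step_sum_ge0 => i; exact: c_ge0. Qed.

Let f_n_le n s : (step_sum n (c n) s <= g s)%R.
Proof.
rewrite -f_nE; apply: ler_sum => p _.
apply: (@le_trans _ _ (`|p.1| * kern_approx H n p.2 s)%R).
  by rewrite ler_wpM2r ?kern_approx_ge0// ler_norm.
by rewrite ler_wpM2l// kern_approx_le.
Qed.

Let f_n_cvg s : step_sum n (c n) s @[n --> \oo] --> f s.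
Proof.
under eq_fun do rewrite -f_nE.
apply: cvg_bigsum => p _; apply: cvgMr; exact: cvg_kern_approx.
Qed.

Let f_ge0 s : (0 <= f s)%R.
Proof.
rewrite -(cvg_lim _ (@f_n_cvg s))//; apply: limr_ge.
  by apply/cvg_ex; exists (f s); exact: f_n_cvg.
by apply: nearW => n; exact: f_n_ge0.
Qed.

Let f_le s : (f s <= g s)%R.
Proof.
by apply: ler_sum => p _; rewrite ler_wpM2r ?kern_ge0// ler_norm.
Qed.

Let mf : measurable_fun setT f.
Proof. by apply: measurable_sum => p; apply: measurable_funM => //; exact: measurable_kern. Qed.

Let mg : measurable_fun setT g.
Proof. by apply: measurable_sum => p; apply: measurable_funM => //; exact: measurable_kern. Qed.

Let g_ge0 s : (0 <= g s)%R.
Proof. by apply: sumr_ge0 => p _; rewrite mulr_ge0// kern_ge0. Qed.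

Let int_g : \int[lebesgue_measure]_s (g s)%:E < +oo.
Proof.
under eq_integral do rewrite -sumEFin.
rewrite ge0_integral_sum//.
- rewrite (eq_bigr (fun p => (`|p.1| * p.2%:num `^ H)%:E)); last first.
    move=> p _; under eq_integral do rewrite EFinM.
    rewrite ge0_integralZl ?lee_fin//.
    + by rewrite integral_kern// EFinM.
    + by apply/measurable_EFinP; exact: measurable_kern.
    + by move=> s _; rewrite lee_fin kern_ge0.
  by rewrite sumEFin ltry.
- by move=> p; apply/measurable_EFinP/measurable_funM => //; exact: measurable_kern.
- by move=> p s _; rewrite lee_fin mulr_ge0// kern_ge0.
Qed.

Let kappa0 : (0 <= kappa)%R.
Proof.
rewrite -lee_fin -(levy_mean levyY meanY levyrho); apply: integral_ge0 => x.
by rewrite /= in_itv/= andbT => x0; rewrite lee_fin ltW.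
Qed.

Let phi_ge0 l : (0 <= l)%R -> 0 <= phi l.
Proof. exact: levy_exponent_ge0. Qed.

Hypothesis rho0 : rho `]-oo, 0%R]%classic = 0.

Let mphi (h : R -> R) : measurable_fun setT h -> (forall s, (0 <= h s)%R) ->
  measurable_fun setT (fun s : R => phi (h s)).
Proof. exact: measurable_levy_exponent_comp. Qed.

(** The exponent grows at most linearly, with slope [kappa], so integrability of [g] is enough. *)
Let int_phi_g : \int[lebesgue_measure]_s phi (g s) < +oo.
Proof.
apply: (@le_lt_trans _ _ (\int[lebesgue_measure]_s (kappa%:E * (g s)%:E))).
  apply: ge0_le_integral => //.
  - by move=> s _; exact: phi_ge0.
  - exact: mphi.
  - by apply: emeasurable_funM => //; exact/measurable_EFinP.
  - by move=> s _; rewrite -EFinM mulrC; exact: phi_le.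
rewrite ge0_integralZl ?lee_fin//.
- by rewrite lte_mul_pinfty// lee_fin.
- exact/measurable_EFinP.
- by move=> s _; rewrite lee_fin.
Qed.

Let cvg_rhs : \int[lebesgue_measure]_s phi (step_sum n (c n) s) @[n --> \oo] -->
  \int[lebesgue_measure]_s phi (f s).
Proof.
have [] := @dominated_convergence _ _ _ lebesgue_measure setT measurableT
  (fun n s => phi (step_sum n (c n) s)) (fun s => phi (f s)) (fun s => phi (g s)).
- by move=> n; apply: mphi => //; exact: measurable_step_sum.
- exact: mphi.
- apply: aeW => s _; apply: (@phi_cvg _ _ (g s)); last exact: f_n_cvg.
  by move=> n; rewrite f_n_ge0 f_n_le.
- apply/integrableP; split; first exact: mphi.
  apply: le_lt_trans int_phi_g; rewrite le_eqVlt; apply/orP; left; apply/eqP.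
  by apply: eq_integral => s _; rewrite gee0_abs// phi_ge0.
- apply: aeW => s n _; rewrite (gee0_abs (phi_ge0 (f_n_ge0 n s))).
  exact: phi_mono.
- by move=> _ _; exact.
Qed.

Let approx_laplace n :
  \int[P]_w (expR (- \sum_(p <- sg) p.1 * sato_approx H Y n p.2 w))%:E =
  expeR (- \int[lebesgue_measure]_s phi (step_sum n (c n) s)).
Proof.
rewrite (lebesgue_step_sum n phi0) => [|i]; last exact: phi_ge0.
rewrite -(grid_sum_laplace levyY levyrho n _ (c_ge0 n)).
apply: eq_integral => w _; congr (expR (- _))%:E.
rewrite /sato_approx; under eq_bigr do rewrite mulr_sumr.
rewrite exchange_big/=; apply: eq_bigr => i _; rewrite /c mulr_suml.
by apply: eq_bigr => p _; rewrite mulrA.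
Qed.

(** The formula holds for the sums, which are combinations of independent increments. The left side
    passes to the limit because the exponentials stay below 1, the right side under the bound by the
    exponent of [g]. *)
Lemma sato_laplace :
  \int[P]_w (expR (- \sum_(p <- sg) p.1 * sato H Y p.2 w))%:E =
  expeR (- \int[lebesgue_measure]_s phi (f s)).
Proof.
have approx_ge0 n w : (0 <= \sum_(p <- sg) p.1 * sato_approx H Y n p.2 w)%R.
  rewrite (_ : (\sum_(p <- sg) _)%R = (\sum_(i < grid_size n)
      c n i * (Y w (grid R n i.+1) - Y w (grid R n i)))%R).
    apply: sumr_ge0 => i _; rewrite mulr_ge0// subr_ge0.
    by apply: cumulative_le; exact: ltW (grid_lt _ _ _).
  rewrite /sato_approx; under eq_bigr do rewrite mulr_sumr.
  rewrite exchange_big/=; apply: eq_bigr => i _; rewrite /c mulr_suml.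
  by apply: eq_bigr => p _; rewrite mulrA.
have meas (h : {nonneg R} -> T -> R) : (forall t, measurable_fun setT (h t)) ->
    measurable_fun setT (fun w => (expR (- \sum_(p <- sg) p.1 * h p.2 w))%:E).
  move=> mh; apply/measurable_EFinP; apply: (measurableT_comp (@measurable_expRopp R)).
  by apply: measurable_sum => p; apply: measurable_funM.
(* The null set depends on the time; the list being finite, one null set serves all its times. *)
have ae_all : {ae P, forall w, forall p, p \in sg ->
    sato_approx H Y n p.2 w @[n --> \oo] --> sato H Y p.2 w}.
  elim: sg => [|p l ih]; first by apply: aeW.
  apply: filterS2 (cvg_sato_approx H0 levyY meanY p.2) ih => w hp hl q.
  by rewrite inE => /predU1P[->|]; [exact: hp|exact: hl].
have [] := @dominated_convergence _ _ _ P setT measurableT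
  (fun n w => (expR (- \sum_(p <- sg) p.1 * sato_approx H Y n p.2 w))%:E)
  (fun w => (expR (- \sum_(p <- sg) p.1 * sato H Y p.2 w))%:E) (cst 1).
- by move=> n; apply: meas => t; exact: (measurable_sato_approx _ levyY).
- by apply: meas => t; exact: (measurable_sato _ levyY).
- have [N [mN N0 subN]] := ae_all.
  exists N; split => // w /= nh; apply: subN => /= hl; apply: nh => _.
  apply: cvg_EFin; first exact: nearW.
  have h : (- \sum_(p <- sg) p.1 * sato_approx H Y n p.2 w)%R @[n --> \oo] -->
      (- \sum_(p <- sg) p.1 * sato H Y p.2 w)%R.
    by apply: cvgN; apply: cvg_bigsum => p /hl ?; exact: cvgMr.
  exact: (cvg_comp _ _ h (@continuous_expR R _)).
- by apply: finite_measure_integrable_cst.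
- apply: aeW => w n _; rewrite /= ger0_norm ?lee_fin ?expR_ge0//.
  exact: expRN_le1.
move=> _ _ lhs.
have fin : \int[lebesgue_measure]_s phi (f s) \is a fin_num.
  rewrite ge0_fin_numE; last by apply: integral_ge0 => s _; exact: phi_ge0.
  apply: le_lt_trans int_phi_g.
  apply: ge0_le_integral => [//|s _|||s _].
  - exact: phi_ge0.
  - exact: mphi.
  - exact: mphi.
  - exact: phi_mono.
(* The limit is finite, so the integrals are eventually finite and the continuity of the real
   exponential applies to their real values. *)
have /fine_cvgP[fin_n rhs] : \int[lebesgue_measure]_s phi (step_sum n (c n) s) @[n --> \oo] -->
    (fine (\int[lebesgue_measure]_s phi (f s)))%:E by rewrite fineK//; exact: cvg_rhs.
rewrite -(cvg_lim _ lhs)//.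
rewrite -(fineK fin) /=; apply/cvg_lim => //.
have h : (- fine (\int[lebesgue_measure]_s phi (step_sum n (c n) s)))%R @[n --> \oo] -->
   (- fine (\int[lebesgue_measure]_s phi (f s)))%R by exact: cvgN.
have h2 : (expR (- fine (\int[lebesgue_measure]_s phi (step_sum n (c n) s))))%:E @[n --> \oo]
    --> (expR (- fine (\int[lebesgue_measure]_s phi (f s))))%:E.
  apply: cvg_EFin; first exact: nearW.
  exact: (cvg_comp _ _ h (@continuous_expR R _)).
apply: cvg_trans h2; apply: near_eq_cvg; near=> n.
have fn : \int[lebesgue_measure]_s phi (step_sum n (c n) s) \is a fin_num.
  by near: n; exact: fin_n.
by rewrite approx_laplace -[in RHS](fineK fn).
Unshelve. all: by end_near. Qed.

End sato_laplace.

(** * Identification of the Lévy measure with the image measure *)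

Section levy_measure_sato.
Local Open Scope ereal_scope.
Context (R : realType) d (T : measurableType d) (P : probability T R).

Lemma levy_measure_laplace (X : {nonneg R} -> T -> R)
    (nu : {measure set (paths R) -> \bar R}) (sg : seq (R * {nonneg R})) :
  levy_measure_of P X nu -> nneg_coefs sg ->
  \int[P]_w (expR (- \sum_(p <- sg) p.1 * X p.2 w))%:E =
  expeR (- \int[nu]_y (1 - path_exp sg y)%:E).
Proof.
move=> [h _] /allP sg0.
have sg1 (i : 'I_(size sg)) : (0 <= (tnth (in_tuple sg) i).1)%R.
  by apply: sg0; have := mem_tnth i (in_tuple sg).
have := h _ (fun i => (tnth (in_tuple sg) i).1) (fun i => (tnth (in_tuple sg) i).2) sg1.
rewrite unlock => e; under eq_integral do rewrite big_tnth.
rewrite e; congr (expeR (- _)); apply: eq_integral => y _.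
by rewrite /path_exp [in RHS]big_tnth.
Qed.

Lemma levy_measure_finite (X : {nonneg R} -> T -> R)
    (nu : {measure set (paths R) -> \bar R}) (sg : seq (R * {nonneg R})) :
  (forall t, measurable_fun setT (X t)) ->
  levy_measure_of P X nu -> nneg_coefs sg ->
  \int[nu]_y (1 - path_exp sg y)%:E < +oo.
Proof.
move=> mX hnu sg0; rewrite ltey; apply/eqP => oo.
have := levy_measure_laplace hnu sg0; rewrite oo /= => e.
have : 0 < \int[P]_w (expR (- \sum_(p <- sg) p.1 * X p.2 w))%:E.
  apply: integral_gt0 => [|w]; last exact: expR_gt0.
  apply: (measurableT_comp (@measurable_expRopp R)).
  by apply: measurable_sum => p; apply: measurable_funM.
by rewrite e ltxx.
Qed.

Lemma sum_kern_ckern (H : R) (sg : seq (R * {nonneg R})) s :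
  s \notin [seq fine (log_level H p.2) | p <- sg] ->
  (\sum_(p <- sg) p.1 * kern H p.2 s = \sum_(p <- sg) p.1 * ckern H p.2 s)%R.
Proof.
move=> sL; apply: eq_big_seq => p psg; congr (_ * _)%R.
rewrite /kern /ckern le_eqVlt; case: eqP => // e.
by exfalso; move/negP: sL; apply; apply/mapP; exists p => //; rewrite e.
Qed.

Variables (H : R) (rho : {sigma_finite_measure set R -> \bar R}).
Hypothesis H0 : (0 < H)%R.
Hypothesis rho0 : rho `]-oo, 0%R]%classic = 0.

Lemma measurable_sum_kern (sg : seq (R * {nonneg R})) :
  measurable_fun setT (fun s => \sum_(p <- sg) p.1 * kern H p.2 s)%R.
Proof.
by apply: measurable_sum => p; apply: measurable_funM => //; exact: measurable_kern.
Qed.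

Lemma measurable_sum_ckern (sg : seq (R * {nonneg R})) :
  measurable_fun setT (fun s => \sum_(p <- sg) p.1 * ckern H p.2 s)%R.
Proof.
by apply: measurable_sum => p; apply: measurable_funM => //; exact: measurable_ckern.
Qed.

Lemma sum_kern_ge0 (sg : seq (R * {nonneg R})) s : nneg_coefs sg ->
  (0 <= \sum_(p <- sg) p.1 * kern H p.2 s)%R.
Proof.
move=> /allP sg0; rewrite big_seq; apply: sumr_ge0 => p psg.
by rewrite mulr_ge0 ?kern_ge0// sg0.
Qed.

Lemma sum_ckern_ge0 (sg : seq (R * {nonneg R})) s : nneg_coefs sg ->
  (0 <= \sum_(p <- sg) p.1 * ckern H p.2 s)%R.
Proof.
move=> /allP sg0; rewrite big_seq; apply: sumr_ge0 => p psg.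
by rewrite mulr_ge0 ?ckern_ge0// sg0.
Qed.

Lemma levy_exponent_kern (sg : seq (R * {nonneg R})) : nneg_coefs sg ->
  \int[lebesgue_measure]_s levy_exponent rho (\sum_(p <- sg) p.1 * kern H p.2 s)%R =
  \int[lebesgue_measure]_s levy_exponent rho (\sum_(p <- sg) p.1 * ckern H p.2 s)%R.
Proof.
move=> sg0.
apply: (integral_lebesgue_off_finite (L := [seq fine (log_level H p.2) | p <- sg])).
- apply: measurable_levy_exponent_comp => //; first exact: measurable_sum_kern.
  by move=> s; exact: sum_kern_ge0.
- apply: measurable_levy_exponent_comp => //; first exact: measurable_sum_ckern.
  by move=> s; exact: sum_ckern_ge0.
- by move=> s; apply: levy_exponent_ge0; exact: sum_kern_ge0.
- by move=> s; apply: levy_exponent_ge0; exact: sum_ckern_ge0.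
- by move=> s sL; rewrite sum_kern_ckern.
Qed.

Lemma nnum_ge0 (k : nat) : (0 <= k%:R :> R)%R. Proof. exact: ler0n. Qed.

(** A measurable set that misses the zero path. It carries the image measure because a jump path
    with [x > 0] stays positive after its jump time, hence at some integer time. *)
Let visible : set (paths R) :=
  \bigcup_k [set y : paths R | (0 < (y (NngNum (nnum_ge0 k)))%:num)%R].

Let measurable_visible : measurable visible.
Proof. by apply: bigcupT_measurable => k; exact: measurable_pos_at. Qed.

Let jump_visible s x : (0 < x)%R -> visible (jump_of H (s, x)).
Proof.
move=> x0; exists (Num.trunc (expR (- s / H))).+1 => //=.
have := @jump_num R H H0 s x
  (NngNum (nnum_ge0 (Num.trunc (expR (- s / H))).+1)) (ltW x0).
rewrite /= => ->; rewrite mulr_gt0// /ckern log_level_le//=.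
by rewrite ltW ?mulr1 ?expR_gt0// truncnS_gt.
Qed.

Lemma jump_measure_visible m : is_jump_measure H rho m ->
  exists S : set (paths R), [/\ measurable S, ~ S (@zero_path R) &
  forall A : set (paths R), measurable A -> m A = m (A `&` S)].
Proof.
move=> mE; exists visible; split => // [[k _] /=|A mA]; first by rewrite ltxx.
have mI B : measurable B -> m B = \int[lebesgue_measure]_s
    \int[rho]_(x in `]0%R, +oo[) (\1_B (jump_of H (s, x)) : R)%:E.
  move=> mB; rewrite -[B in LHS]setIT -integral_indic//; apply: mE.
    by apply/measurable_EFinP; exact: measurable_indic.
  by move=> y; rewrite lee_fin.
rewrite mI// mI; last exact: measurableI.
apply: eq_integral => s _; apply: eq_integral => x.
rewrite inE/= in_itv/= andbT => x0; congr (_%:E); rewrite indicI /=.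
by rewrite [X in (_ * X)%R]indicE mem_set ?mulr1//; exact: jump_visible.
Qed.

End levy_measure_sato.

Section sato_levy_measure.
Local Open Scope ereal_scope.
Context (R : realType) d (T : measurableType d) (P : probability T R).
Variables (H : R) (Y : T -> cumulative R R) (kappa : R)
  (rho : {sigma_finite_measure set R -> \bar R}).
Hypothesis H0 : (0 < H)%R.
Hypothesis levyY : double_sided_levy P (fun s w => Y w s).
Hypothesis meanY : 'E_P[fun w => Y w 1%R] = kappa%:E.
Hypothesis levyrho : driftless_levy_measure P (fun w => Y w 1%R) rho.

Let rho0 : rho `]-oo, 0%R]%classic = 0 := levyrho.1.

Lemma sato_laplace_nneg sg : nneg_coefs sg ->
  \int[P]_w (expR (- \sum_(p <- sg) p.1 * sato H Y p.2 w))%:E =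
  expeR (- \int[lebesgue_measure]_s
    levy_exponent rho (\sum_(p <- sg) p.1 * ckern H p.2 s)%R).
Proof.
move=> sg0; rewrite -(levy_exponent_kern H rho0 sg0).
apply: (sato_laplace H0 levyY meanY levyrho) => // s.
rewrite big_seq; apply: sumr_ge0 => p psg; rewrite mulr_ge0//.
by move/allP : sg0 => /(_ _ psg).
Qed.

Variable nu : {measure set (paths R) -> \bar R}.
Hypothesis hnu : levy_measure_of P (sato H Y) nu.

(** Injectivity of the exponential turns equal Laplace functionals into equal, finite integrals of
    [1 - e^(-<alpha, y>)], the input of the uniqueness of Lévy measures. *)
Lemma sato_levy_measure : is_jump_measure H rho nu.
Proof.
have [m mE] := jump_measure_exists H0 rho0.
have nuE A : measurable A -> nu A = m A.
  apply: levy_measure_unique.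
  - move=> s s0; apply: levy_measure_finite hnu s0 => t.
    exact: (measurable_sato H levyY).
  - move=> s s0; rewrite (jump_measure_laplace H0 mE s0).
    have := levy_measure_laplace hnu s0; rewrite sato_laplace_nneg//.
    by move=> /expeR_inj /oppe_inj.
  - exact: hnu.2.
  - exact: (jump_measure_visible H0 mE).
move=> F mF F0; rewrite -(mE F mF F0).
by apply: eq_measure_integral => A mA _; exact: nuE.
Qed.

End sato_levy_measure.

(** * Cutting the jumps at a level *)

Lemma ge0_integral_mrestr d (T : measurableType d) (R : realType)
    (mu : {measure set T -> \bar R}) (D : set T) (mD : measurable D)
    (f : T -> \bar R) : measurable_fun setT f -> (forall x, 0 <= f x)%E ->
  (\int[mrestr mu mD]_x f x = \int[mu]_x (f \_ D) x)%E.
Proof.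
move=> mf f0.
have mI : measurable_fun setT (\1_D : T -> R) by exact: measurable_indic.
have [m [mE i]] := weighted_measure mu mI (fun x => ler0n _ _).
transitivity (\int[m]_x f x)%E.
  apply: eq_measure_integral => A mA _.
  by rewrite mE /weighted integral_indic// setIC.
by rewrite i//; apply: eq_integral => x _; rewrite epatch_indic.
Qed.

Section sigma_process.
Context (R : realType) d (T : measurableType d) (X : {nonneg R} -> T -> R).

Lemma sigma_process_measurable A : (forall t, measurable_fun setT (X t)) ->
  sigma_process X A -> measurable A.
Proof.
move=> mX; apply: smallest_sub; first exact: sigma_algebra_measurable.
by move=> B [t _]; exact: sigma_rv_measurable.
Qed.

(** The sample space is retyped with the sigma-algebra generated by the process, so that the closure
    properties of measurable functions apply to it. *)
Lemma sigma_process_exp (sg : seq (R * {nonneg R})) (B : set R) : measurable B ->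
  sigma_process X ((fun w => expR (- \sum_(p <- sg) p.1 * X p.2 w)) @^-1` B).
Proof.
move=> mB; pose G := \bigcup_t sigma_rv (X t).
have mX t : measurable_fun (setT : set (g_sigma_algebraType G)) (X t).
  move=> _ C mC; rewrite setTI; apply: sub_sigma_algebra; exists t => //.
  by exists C => //; rewrite setTI.
have mZ : measurable_fun (setT : set (g_sigma_algebraType G))
    (fun w => expR (- \sum_(p <- sg) p.1 * X p.2 w)).
  apply: (measurableT_comp (@measurable_expRopp R)).
  by apply: measurable_sum => p; apply: measurable_funM.
by have := mZ measurableT B mB; rewrite setTI.
Qed.

End sigma_process.

Section jump_restriction.
Local Open Scope ereal_scope.
Context (R : realType) (H : R) (rho : {sigma_finite_measure set R -> \bar R}).
Hypotheses (H0 : (0 < H)%R) (rho0 : rho `]-oo, 0%R]%classic = 0).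

Definition jump_inner (F : paths R -> \bar R) (s : R) : \bar R :=
  \int[rho]_(x in `]0%R, +oo[) F (jump_of H (s, x)).

Lemma jump_inner_ge0 F s : (forall y, 0 <= F y) -> 0 <= jump_inner F s.
Proof. by move=> F0; apply: integral_ge0 => x _; exact: F0. Qed.

Lemma measurable_jump_inner F : measurable_fun setT F -> (forall y, 0 <= F y) ->
  measurable_fun setT (jump_inner F).
Proof.
move=> mF F0.
apply: (measurable_integral_rho rho0 (h := F \o jump_of H)) => [|p].
  exact: (measurableT_comp mF (measurable_jump_of H0)).
exact: F0.
Qed.

Lemma jump_inner_path_exp (sg : seq (R * {nonneg R})) s :
  jump_inner (fun y => (1 - path_exp sg y)%:E) s =
  levy_exponent rho (\sum_(p <- sg) p.1 * ckern H p.2 s)%R.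
Proof.
apply: eq_integral => x; rewrite inE/= in_itv/= andbT => x0.
rewrite /path_exp; congr (1 - expR (- _))%:E; rewrite mulr_suml.
by apply: eq_bigr => p _; rewrite (jump_num H0)// ?ltW// mulrA mulrAC.
Qed.

Variables (nu : {measure set (paths R) -> \bar R}) (a : {nonneg R}).
Hypotheses (hnu : is_jump_measure H rho nu) (a0 : (0 < a%:num)%R).

Let L : R := ln (a%:num `^ (- H)).

Lemma log_level_pos : log_level H a = L%:E.
Proof. by rewrite /log_level gt_eqF. Qed.

Lemma jump_pos s x : (0 < x)%R -> (0 < (jump_of H (s, x) a)%:num)%R = (L <= s)%R.
Proof.
move=> x0; rewrite (jump_num H0 s a (ltW x0)) pmulr_rgt0//.
rewrite /ckern log_level_pos lee_fin pmulr_rgt0 ?expR_gt0//.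
by case: (L <= s)%R; rewrite ?ltr01 ?ltxx.
Qed.

(** A jump at level exactly [L] is already positive at [a], although [L] belongs to the interval of
    the zero part; the correspondence between [D] and [I] is asked only off this one level. *)
Let restr (D : set (paths R)) (mD : measurable D) (I : set R) (F : paths R -> \bar R) :
  measurable I -> measurable_fun setT F -> (forall y, 0 <= F y) ->
  (forall s x, s != L -> (0 < x)%R -> (jump_of H (s, x) \in D) = (s \in I)) ->
  \int[mrestr nu mD]_y F y = \int[lebesgue_measure]_(s in I) jump_inner F s.
Proof.
move=> mI mF F0 DI; rewrite ge0_integral_mrestr//.
have mFD : measurable_fun setT (F \_ D).
  by apply/(measurable_restrictT _ _).1 => //; exact: measurable_funTS.
have FD0 y : 0 <= (F \_ D) y by rewrite patchE; case: ifP.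
rewrite (hnu mFD FD0) [RHS]integral_mkcond.
apply: (integral_lebesgue_off_finite (L := [:: L])).
- exact: measurable_jump_inner.
- apply/(measurable_restrictT _ _).1 => //; apply: measurable_funTS.
  exact: measurable_jump_inner.
- by move=> s; exact: (jump_inner_ge0 _ FD0).
- by move=> s; rewrite patchE; case: ifP => // _; exact: (jump_inner_ge0 _ F0).
- move=> s; rewrite inE => sL; rewrite [RHS]patchE.
  case: ifP => sI; last first.
    apply: integral0_eq => x; rewrite /= in_itv/= andbT => x0.
    by rewrite patchE DI// sI.
  apply: eq_integral => x; rewrite inE/= in_itv/= andbT => x0.
  by rewrite patchE DI// sI.
Qed.

Lemma jump_restr_zero (F : paths R -> \bar R) :
  measurable_fun setT F -> (forall y, 0 <= F y) ->
  \int[mrestr nu (measurable_zero_at a)]_y F y =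
  \int[lebesgue_measure]_(s in `]-oo, L]) jump_inner F s.
Proof.
move=> mF F0.
apply: (@restr _ (measurable_zero_at a) _ F (measurable_itv _) mF F0).
move=> s x sL x0; have -> : (s \in `]-oo, L]%classic) = (s <= L)%R.
  by apply/idP/idP; rewrite inE/= in_itv.
rewrite leNgt lt_neqAle eq_sym sL/= -(jump_pos s x0).
have v0 : (0 <= (jump_of H (s, x) a)%:num)%R by exact: ge0.
rewrite lt_neqAle v0 andbT negbK eq_sym.
by apply/idP/idP; rewrite inE/= => /eqP.
Qed.

Lemma jump_restr_pos (F : paths R -> \bar R) :
  measurable_fun setT F -> (forall y, 0 <= F y) ->
  \int[mrestr nu (measurable_pos_at a)]_y F y =
  \int[lebesgue_measure]_(s in `]L, +oo[) jump_inner F s.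
Proof.
move=> mF F0.
apply: (@restr _ (measurable_pos_at a) _ F (measurable_itv _) mF F0).
move=> s x sL x0; have -> : (s \in `]L, +oo[%classic) = (L < s)%R.
  by apply/idP/idP; rewrite inE/= in_itv/= andbT.
rewrite lt_neqAle eq_sym sL/=.
by rewrite -(jump_pos s x0); apply/idP/idP; rewrite inE.
Qed.

End jump_restriction.

Section max_min_levels.
Context (R : realType) (H : R) (H0 : 0 < H) (a : {nonneg R}) (a0 : 0 < a%:num).

Lemma log_level_max t s : (log_level H (Order.max t a) < s%:E)%E =
  (log_level H t < s%:E)%E || (log_level H a < s%:E)%E.
Proof.
rewrite !log_level_lt// -lt_max; congr (_ < _).
case: (leP t a) => h; first by rewrite max_r.
by rewrite max_l// ltW.
Qed.

Lemma log_level_min t s : (log_level H (Order.min t a) <= s%:E)%E =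
  (log_level H t <= s%:E)%E && (log_level H a <= s%:E)%E.
Proof.
rewrite !log_level_le// -le_min; congr (_ <= _).
case: (leP t a) => h; first by rewrite min_l.
by rewrite min_r// ltW.
Qed.

(** Of the levels counted at [max t a], those above the level of [a] are cancelled by the
    subtraction, and below it only those counted at [t] remain. Dually, the minimum keeps the levels
    of [t] from that of [a] on. *)
Lemma kern_max t s : kern H (Order.max t a) s - kern H a s =
  kern H t s * (s%:E <= log_level H a)%E%:R.
Proof.
rewrite /kern log_level_max -mulrBr -mulrA [X in _ = _ * (_ * X)](_ : _ =
  (~~ (log_level H a < s%:E)%E)%:R); last by rewrite -leNgt.
congr (_ * _); case: (log_level H a < s%:E)%E; rewrite ?orbT ?orbF ?subrr ?subr0.
  by rewrite mulr0.
by rewrite mulr1.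
Qed.

Lemma ckern_min t s : ckern H (Order.min t a) s =
  ckern H t s * (log_level H a <= s%:E)%E%:R.
Proof. by rewrite /ckern log_level_min -mulrA -natrM mulnb. Qed.

End max_min_levels.

Section decomposition.
Local Open Scope ereal_scope.
Context (R : realType) d (T : measurableType d) (P : probability T R).
Variables (H : R) (Y : T -> cumulative R R) (kappa : R)
  (rho : {sigma_finite_measure set R -> \bar R}).
Hypothesis H0 : (0 < H)%R.
Hypothesis levyY : double_sided_levy P (fun s w => Y w s).
Hypothesis meanY : 'E_P[fun w => Y w 1%R] = kappa%:E.
Hypothesis levyrho : driftless_levy_measure P (fun w => Y w 1%R) rho.
Variable nu : {measure set (paths R) -> \bar R}.
Hypothesis hnu : levy_measure_of P (sato H Y) nu.
Variables (a : {nonneg R}) (a0 : (0 < a%:num)%R).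

Let rho0 : rho `]-oo, 0%R]%classic = 0 := levyrho.1.
Let L : R := ln (a%:num `^ (- H)).
Let psi := sato H Y.
Let mpsi t : measurable_fun setT (psi t). Proof. exact: (measurable_sato H levyY). Qed.
Let psi0 t w : (0 <= psi t w)%R. Proof. exact: sato_ge0. Qed.
Let hjump : is_jump_measure H rho nu := sato_levy_measure H0 levyY meanY levyrho hnu.

Let phi sg s : \bar R := levy_exponent rho (\sum_(p <- sg) p.1 * ckern H p.2 s)%R.

Let mphi sg : nneg_coefs sg -> measurable_fun setT (phi sg).
Proof.
move=> sg0; apply: measurable_levy_exponent_comp => //.
  exact: (measurable_sum_ckern H sg).
by move=> s; exact: sum_ckern_ge0.
Qed.

Let psi_laplace sg : nneg_coefs sg ->
  \int[P]_w (expR (- \sum_(p <- sg) p.1 * psi p.2 w))%:E =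
  expeR (- \int[lebesgue_measure]_s phi sg s).
Proof. exact: (sato_laplace_nneg H0 levyY meanY levyrho). Qed.

Let phi0 sg s : nneg_coefs sg -> 0 <= phi sg s.
Proof. by move=> sg0; apply: levy_exponent_ge0; exact: sum_ckern_ge0. Qed.

Let levy0 : levy_exponent rho 0%R = 0.
Proof. by apply: integral0_eq => x _; rewrite mul0r oppr0 expR0 subrr. Qed.

Let m1pe sg : measurable_fun setT (fun y : paths R => (1 - path_exp sg y)%:E).
Proof.
by apply/measurable_EFinP; apply: measurable_funB => //; exact: measurable_path_exp.
Qed.

Let pe0 sg : nneg_coefs sg -> forall y : paths R, 0 <= (1 - path_exp sg y)%:E.
Proof. by move=> sg0 y; rewrite lee_fin subr_ge0 path_exp_le1. Qed.

Lemma phi_zero sg : nneg_coefs sg ->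
  \int[mrestr nu (measurable_zero_at a)]_y (1 - path_exp sg y)%:E =
  \int[lebesgue_measure]_(s in `]-oo, L]) phi sg s.
Proof.
move=> sg0; rewrite (jump_restr_zero H0 rho0 hjump a0 (m1pe sg) (pe0 sg0)).
by apply: eq_integral => s _; rewrite (jump_inner_path_exp rho H0).
Qed.

Lemma phi_pos sg : nneg_coefs sg ->
  \int[mrestr nu (measurable_pos_at a)]_y (1 - path_exp sg y)%:E =
  \int[lebesgue_measure]_(s in `]L, +oo[) phi sg s.
Proof.
move=> sg0; rewrite (jump_restr_pos H0 rho0 hjump a0 (m1pe sg) (pe0 sg0)).
by apply: eq_integral => s _; rewrite (jump_inner_path_exp rho H0).
Qed.

Let laplace_zero_part d' (T' : measurableType d') (P' : probability T' R)
    (X : {nonneg R} -> T' -> R) sg : nneg_coefs sg ->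
  levy_measure_of P' X (mrestr nu (measurable_zero_at a)) ->
  \int[P']_w (expR (- \sum_(p <- sg) p.1 * X p.2 w))%:E =
  expeR (- \int[lebesgue_measure]_(s in `]-oo, L]) phi sg s).
Proof. by move=> sg0 hX; rewrite (levy_measure_laplace hX sg0) phi_zero. Qed.

Let laplace_pos_part d' (T' : measurableType d') (P' : probability T' R)
    (X : {nonneg R} -> T' -> R) sg : nneg_coefs sg ->
  levy_measure_of P' X (mrestr nu (measurable_pos_at a)) ->
  \int[P']_w (expR (- \sum_(p <- sg) p.1 * X p.2 w))%:E =
  expeR (- \int[lebesgue_measure]_(s in `]L, +oo[) phi sg s).
Proof. by move=> sg0 hX; rewrite (levy_measure_laplace hX sg0) phi_pos. Qed.

Let PT d' (T' : measurableType d') (P' : probability T' R) : P' setT < +oo.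
Proof. by rewrite probability_setT ltry. Qed.

(** Replacing each time by its minimum with [a] multiplies the kernels by the indicator of [L <= s],
    which is the restriction of the Lévy measure up to the single level [L]. *)
Lemma eq_law_stopped d' (T' : measurableType d') (P' : probability T' R)
    (X : {nonneg R} -> T' -> R) :
  (forall t, measurable_fun setT (X t)) -> (forall t w, (0 <= X t w)%R) ->
  levy_measure_of P' X (mrestr nu (measurable_pos_at a)) ->
  eq_law P' X P (fun t w => psi (Order.min t a) w).
Proof.
move=> mX X0 hX.
apply: (@eq_law_laplace _ _ _ _ _ P' P X _ (PT P') mX (fun t => mpsi _) X0
  (fun t w => psi0 _ _)) => sg sg0.
rewrite (laplace_pos_part sg0 hX).
pose sm := [seq (p.1, Order.min p.2 a) | p <- sg].
have sm0 : nneg_coefs sm by rewrite /nneg_coefs all_map.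
transitivity (\int[P]_w (expR (- \sum_(p <- sm) p.1 * psi p.2 w))%:E); last first.
  by apply: eq_integral => w _; rewrite /sm big_map.
apply: etrans (esym (psi_laplace sm0)).
apply: (congr1 (fun x => expeR (- x))).
rewrite [LHS]integral_mkcond.
apply: (integral_lebesgue_off_finite (L := [:: L])).
- by apply/(measurable_restrictT _ _).1 => //; apply: measurable_funTS; exact: mphi.
- exact: mphi.
- by move=> s; rewrite patchE; case: ifP => // _; exact: phi0.
- by move=> s; exact: phi0.
move=> s; rewrite inE => sL; rewrite [RHS]/phi big_map /=.
under [in RHS]eq_bigr do rewrite (ckern_min H0) mulrA.
rewrite -mulr_suml (log_level_pos H a0) lee_fin patchE.
have -> : (s \in `]L, +oo[%classic) = (L <= s)%R.
  by rewrite le_eqVlt eq_sym (negbTE sL); apply/idP/idP; rewrite inE/= in_itv/= andbT.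
by case: (L <= s)%R; rewrite ?mulr1 ?mulr0 ?levy0.
Qed.

(** Here the list has negative coefficients: each term of [sg] gives one at [max t a] and an
    opposite one at [a]. The increments are nonnegative almost surely, whence the almost everywhere
    form of uniqueness. *)
Lemma eq_law_frozen d' (T' : measurableType d') (P' : probability T' R)
    (X : {nonneg R} -> T' -> R) :
  (forall t, measurable_fun setT (X t)) -> (forall t w, (0 <= X t w)%R) ->
  levy_measure_of P' X (mrestr nu (measurable_zero_at a)) ->
  eq_law P' X P (fun t w => psi (Order.max t a) w - psi a w)%R.
Proof.
move=> mX X0 hX; have mD t : measurable_fun setT (fun w => psi (Order.max t a) w - psi a w)%R.
  exact: (measurable_funB (mpsi _) (mpsi _)).
apply: (@eq_law_laplace_ae _ _ _ _ _ P' P X _ (PT P') mX mD (fun t => aeW _ (X0 t))).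
  move=> t; have ta : (a%:num <= (Order.max t a)%:num)%R.
    by have : (a <= Order.max t a)%O by rewrite le_max lexx orbT.
  apply: filterS (sato_le_ae H0 levyY meanY ta) => w h.
  by rewrite subr_ge0.
move=> sg sg0; rewrite (laplace_zero_part sg0 hX).
pose sm := [seq (p.1, Order.max p.2 a) | p <- sg] ++ [seq (- p.1, a)%R | p <- sg].
have smE (k : {nonneg R} -> R) : (\sum_(p <- sm) p.1 * k p.2 =
    \sum_(p <- sg) p.1 * (k (Order.max p.2 a) - k a))%R.
  rewrite big_cat/= !big_map -big_split/=; apply: eq_bigr => p _.
  by rewrite mulrBr mulNr.
have sm0 s : (0 <= \sum_(p <- sm) p.1 * (log_level H p.2 < s%:E)%E%:R :> R)%R.
  rewrite (smE (fun t => (log_level H t < s%:E)%E%:R)) big_seq.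
  apply: sumr_ge0 => p psg; rewrite mulr_ge0 ?(allP sg0)// subr_ge0 ler_nat.
  by rewrite (log_level_max H0); case: (log_level H a < s%:E); rewrite ?orbT.
transitivity (\int[P]_w (expR (- \sum_(p <- sm) p.1 * psi p.2 w))%:E); last first.
  by apply: eq_integral => w _; rewrite (smE (psi ^~ w)).
transitivity (expeR (- \int[lebesgue_measure]_s
    levy_exponent rho (\sum_(p <- sm) p.1 * kern H p.2 s)%R)); last first.
  exact/esym/(sato_laplace H0 levyY meanY levyrho sm0 rho0).
apply: (congr1 (fun x => expeR (- x))).
rewrite [LHS]integral_mkcond.
pose f s : R := (\sum_(p <- sg) p.1 * kern H p.2 s)%R.
have fE s : (\sum_(p <- sm) p.1 * kern H p.2 s = f s * (s <= L)%R%:R)%R.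
  rewrite (smE (kern H ^~ s)) /f mulr_suml; apply: eq_bigr => p _.
  by rewrite (kern_max H0) (log_level_pos H a0) lee_fin mulrA.
under [RHS]eq_integral do rewrite fE.
apply: (integral_lebesgue_off_finite
  (L := [seq fine (log_level H p.2) | p <- sg])).
- by apply/(measurable_restrictT _ _).1 => //; apply: measurable_funTS; exact: mphi.
- apply: measurable_levy_exponent_comp => // [|s].
    rewrite (_ : (fun s => _) = fun s => f s * \1_`]-oo, L] s)%R; last first.
      by apply/funext => s; rewrite indicE mem_setE in_itv.
    by apply: measurable_funM; [exact: measurable_sum_kern|exact: measurable_indic].
  by rewrite mulr_ge0//; exact: sum_kern_ge0.
- by move=> s; rewrite patchE; case: ifP => // _; exact: phi0.
- by move=> s; apply: levy_exponent_ge0; rewrite mulr_ge0//; exact: sum_kern_ge0.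
- move=> s sL; rewrite /f (sum_kern_ckern sL) patchE.
  have -> : (s \in `]-oo, L]%classic) = (s <= L)%R.
    by apply/idP/idP; rewrite inE/= in_itv.
  by case: (s <= L)%R; rewrite ?mulr1 ?mulr0 ?levy0.
Qed.

(** Independence multiplies the Laplace functionals and so adds the exponents, which are integrals
    over the two halves of the line cut at [L]. *)
Lemma eq_law_decomposition d' (T' : measurableType d') (P' : probability T' R)
    (X X' : {nonneg R} -> T' -> R) :
  (forall t, measurable_fun setT (X t)) -> (forall t w, (0 <= X t w)%R) ->
  (forall t, measurable_fun setT (X' t)) -> (forall t w, (0 <= X' t w)%R) ->
  levy_measure_of P' X (mrestr nu (measurable_zero_at a)) ->
  levy_measure_of P' X' (mrestr nu (measurable_pos_at a)) ->
  mutually_independent P' (tnth [tuple sigma_process X; sigma_process X']) ->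
  eq_law P psi P' (fun t w => X t w + X' t w)%R.
Proof.
move=> mX X0 mX' X'0 hX hX' ind; 
apply: (@eq_law_laplace _ _ _ _ _ P P' psi _ (PT P) mpsi
  (fun t => measurable_funD (mX t) (mX' t)) psi0
  (fun t w => addr_ge0 (X0 t w) (X'0 t w))) => sg sg0.
 rewrite (psi_laplace sg0).
transitivity (\int[P']_w (expR (- \sum_(p <- sg) p.1 * X p.2 w) *
    expR (- \sum_(p <- sg) p.1 * X' p.2 w))%:E); last first.
  apply: eq_integral => w _; rewrite -expRD -opprD -big_split/=.
  by congr (expR (- _))%:E; apply: eq_bigr => p _; rewrite mulrDr.
have e01 (Z : {nonneg R} -> T' -> R) w : (forall t w, (0 <= Z t w)%R) ->
    (0 <= expR (- \sum_(p <- sg) p.1 * Z p.2 w) <= 1)%R.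
  move=> Z0; rewrite expR_ge0 expRN_le1// big_seq.
  by apply: sumr_ge0 => p psg; rewrite mulr_ge0 ?(allP sg0).
rewrite (indep2_expectation ind).
- have I0 (D : set R) : 0 <= \int[lebesgue_measure]_(s in D) phi sg s.
    by apply: integral_ge0 => s _; exact: phi0.
  rewrite (laplace_zero_part sg0 hX) (laplace_pos_part sg0 hX') -expeRD.
  apply: (congr1 expeR).
  rewrite -oppeD; last by apply: ge0_adde_def; rewrite inE; exact: I0.
  apply: (congr1 oppe); rewrite -(itv_setU_setT false L).
  rewrite ge0_integral_setU//.
  + by apply: measurable_funTS; exact: mphi.
  + by move=> s _; exact: phi0.
  + apply/eqP/seteqP; split => s //= [].
    by rewrite !in_itv/= andbT ltNge => ->.
- by move=> A; exact: sigma_process_measurable.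
- by move=> A; exact: sigma_process_measurable.
- by move=> B; exact: sigma_process_exp.
- by move=> B; exact: sigma_process_exp.
- by move=> w; exact: e01.
- by move=> w; exact: e01.
Qed.

End decomposition.

(** * Size-biased laws *)

Section independent_laws.
Local Open Scope ereal_scope.
Context (R : realType) d (T : measurableType d) (P : probability T R).

Lemma integral_indic_rv d' (S : measurableType d') (X : {RV P >-> S}) (C : set S) :
  measurable C -> \int[P]_w (\1_C (X w))%:E = distribution P X C.
Proof.
move=> mC; have mXC : measurable (X @^-1` C).
  by rewrite -[X in measurable X]setTI; exact: measurable_funPT.
transitivity (P (X @^-1` C `&` setT)); last by rewrite setIT.
by rewrite -(integral_indic P measurableT mXC).
Qed.

Lemma indep_joint_law (U V : {RV P >-> R}) (F : set (set T)) (Z : T -> R)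
    (k : R * R -> \bar R) :
  mutually_independent P (tnth [tuple sigma_rv U; sigma_rv V; F]) ->
  (forall A, F A -> measurable A) ->
  (forall B, measurable B -> F (Z @^-1` B)) -> (forall w, (0 <= Z w <= 1)%R) ->
  measurable_fun setT k -> (forall p, 0 <= k p) ->
  \int[P]_w (k (U w, V w) * (Z w)%:E) = \int[P]_w (Z w)%:E *
    \int[distribution P U]_u \int[distribution P V]_v k (u, v).
Proof.
move=> ind mF FZ Z01 mk k0.
have mZ : measurable_fun setT Z.
  by move=> _ B mB; rewrite setTI; exact: mF (FZ _ mB).
have FX (X : {RV P >-> R}) A : sigma_rv X A -> measurable A.
  by apply: sigma_rv_measurable.
apply: (weighted_joint_law mZ Z01) => // A B mA mB.
have i01 (C : set R) x : (0 <= (\1_C x : R) <= 1)%R.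
  by rewrite indicE; case: (_ \in _); rewrite /= ?lexx ?ler01.
have := @indep3_expectation _ _ _ P _ _ _ (\1_A \o U) (\1_B \o V) Z ind
  (FX U) (FX V) mF.
move=> /(_ (fun C mC => sigma_rv_comp U (measurable_indic mA) mC)).
move=> /(_ (fun C mC => sigma_rv_comp V (measurable_indic mB) mC) FZ).
move=> /(_ (fun w => i01 A _) (fun w => i01 B _) Z01) e.
transitivity (\int[P]_w ((\1_A \o U) w * ((\1_B \o V) w * Z w))%:E).
  rewrite integral_mkcond; apply: eq_integral => w _.
  rewrite epatch_indic muleC -EFinM; congr (_%:E).
  by rewrite mulrA; congr (_ * _)%R; rewrite indicI.
by rewrite e (integral_indic_rv U mA) (integral_indic_rv V mB) muleA muleC.
Qed.

(** The statement for pairs is used twice: for [G] and [U] with weights that depend on [V], then for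
    the pair [W] of [G] and [U] together with [V], under the weight 1. *)
Lemma indep3_joint_law (G U V : {RV P >-> R}) (k : R * R * R -> \bar R) :
  mutually_independent P (tnth [tuple sigma_rv G; sigma_rv U; sigma_rv V]) ->
  measurable_fun setT k -> (forall p, 0 <= k p) ->
  \int[P]_w k (G w, U w, V w) =
  \int[distribution P G]_g \int[distribution P U]_u \int[distribution P V]_v
    k (g, u, v).
Proof.
move=> ind mk k0.
have mW : measurable_fun setT (fun w => (G w, U w)) by exact: measurable_fun_pair.
pose W : {RV P >-> (R * R)%type} :=
  HB.pack (fun w => (G w, U w)) (isMeasurableFun.Build _ _ _ _ _ mW).
have mV A : sigma_rv V A -> measurable A by exact: sigma_rv_measurable.
have jl (Z : T -> R) (h : R * R -> \bar R) :
    (forall B, measurable B -> sigma_rv V (Z @^-1` B)) ->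
    (forall w, (0 <= Z w <= 1)%R) ->
    measurable_fun setT h -> (forall p, 0 <= h p) ->
    \int[P]_w (h (W w) * (Z w)%:E) = \int[P]_w (Z w)%:E *
      \int[distribution P G]_g \int[distribution P U]_u h (g, u).
  by move=> VZ Z01 mh h0; exact: (indep_joint_law ind mV VZ Z01 mh h0).
have c01 (w : T) : (0 <= (cst 1%R w : R) <= 1)%R by rewrite /= ler01 lexx.
have V1 (B : set R) : measurable B -> sigma_rv V ((cst 1%R : T -> R) @^-1` B).
  move=> mB.
  exact: (sigma_rv_comp V (h := cst 1%R) (@measurable_cst _ _ _ _ _ _) mB).
have I1 : \int[P]_w ((cst 1%R : T -> R) w)%:E = 1.
  by apply: etrans (integral_cst P measurableT 1) _; rewrite mul1e; exact: probability_setT.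
have W1 h : measurable_fun setT h -> (forall p, 0 <= h p) ->
    \int[P]_w h (W w) =
    \int[distribution P G]_g \int[distribution P U]_u h (g, u).
  move=> mh h0; have := jl (cst 1%R) h V1 c01 mh h0.
  under eq_integral do rewrite mule1.
  by move=> ->; rewrite I1 mul1e.
pose h p := \int[distribution P V]_v k (p, v).
have h0 p : 0 <= h p by apply: integral_ge0.
have mh : measurable_fun setT h.
  exact: (measurable_fun_fubini_tonelli_F _ mk).
rewrite -(W1 h mh h0).
transitivity (\int[distribution P W]_p h p); last first.
  by rewrite ge0_integral_distribution.
have UVZ A B : measurable A -> measurable B ->
    \int[P]_(w in W @^-1` A `&` V @^-1` B) ((cst 1%R : T -> R) w)%:E =
    \int[P]_w ((cst 1%R : T -> R) w)%:E * (distribution P W A * distribution P V B).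
  move=> mA mB.
  transitivity (\int[P]_w ((\1_A (W w))%:E * (\1_B (V w))%:E)).
    rewrite integral_mkcond; apply: eq_integral => w _.
    by rewrite epatch_indic mul1e -EFinM indicI.
  rewrite (jl (\1_B \o V) (EFin \o \1_A)).
  + rewrite -W1; last 2 first.
    * by apply/measurable_EFinP; exact: measurable_indic.
    * by move=> p; rewrite lee_fin.
    rewrite I1 mul1e muleC.
    congr (_ * _); [exact: integral_indic_rv|].
    exact: integral_indic_rv.
  + by move=> C mC; exact: (sigma_rv_comp V (measurable_indic mB) mC).
  + by move=> w; rewrite /= indicE; case: (_ \in _); rewrite /= ?lexx ?ler01.
  + by apply/measurable_EFinP; exact: measurable_indic.
  + by move=> p; rewrite lee_fin.
have := @weighted_joint_law _ _ _ P _ _ _ _ W V (cst 1%R)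
  (distribution P W) (distribution P V) (measurable_cst _) c01 UVZ k mk k0.
under eq_integral do rewrite mule1.
by move=> ->; rewrite I1 mul1e.
Qed.

End independent_laws.

(** * Integrals against the size-biased, exponential and uniform laws *)

Section one_dimensional_laws.
Local Open Scope ereal_scope.
Context (R : realType).

Lemma integral_size_biased (rho m : {measure set R -> \bar R}) (c : R)
    (f : R -> \bar R) : (0 <= c)%R -> rho `]-oo, 0%R]%classic = 0 ->
  (forall B, measurable B -> m B = \int[rho]_(x in B) (c * x)%:E) ->
  measurable_fun setT f -> (forall x, 0 <= f x) ->
  \int[m]_x f x = \int[rho]_(x in `]0%R, +oo[) (f x * (c * x)%:E).
Proof.
move=> c0 rho0 mE mf f0.
have mcx : measurable_fun setT (fun x : R => c * x)%R by exact: measurable_funM.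
have mZ : measurable_fun setT (fun x : R => `|c * x|)%R.
  exact: (measurableT_comp (@normr_measurable R setT) mcx).
have [w [wE wi]] := weighted_measure rho mZ (fun x => normr_ge0 _).
have N0 : rho.-negligible `]-oo, 0%R]%classic.
  by exists `]-oo, 0%R]%classic; split => //; exact: measurable_itv.
have pos : {ae rho, forall x, (0 < x)%R}.
  apply: negligibleS N0 => x /= /negP; rewrite -leNgt => x0.
  by rewrite in_itv.
transitivity (\int[w]_x f x).
  apply: eq_measure_integral => B mB _; rewrite mE// wE /weighted.
  apply: ae_eq_integral => //.
  - exact/measurable_funTS/measurable_EFinP.
  - exact/measurable_funTS/measurable_EFinP.
  - by apply: filterS pos => x x0 _; rewrite ger0_norm// mulr_ge0// ltW.
have mfZ : measurable_fun setT (fun x => f x * (`|c * x|)%:E).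
  by apply: emeasurable_funM => //; exact/measurable_EFinP.
rewrite wi// (ge0_negligible_integral _ _ mfZ _ rho0)//; last first.
  by move=> x _; rewrite mule_ge0// lee_fin.
rewrite setTD setCitvl; apply: eq_integral => x.
by rewrite inE/= in_itv/= andbT => x0; rewrite ger0_norm// mulr_ge0// ltW.
Qed.

Lemma integral_exponential1 (f : R -> \bar R) : measurable_fun setT f ->
  (forall x, 0 <= f x) ->
  \int[exponential_prob 1]_x f x =
  \int[lebesgue_measure]_(x in `[0%R, +oo[) (f x * (expR (- x))%:E).
Proof.
move=> mf f0.
have mZ : measurable_fun setT (exponential_pdf 1 : R -> R).
  exact: measurable_exponential_pdf.
have Z0 x : (0 <= exponential_pdf 1 x :> R)%R by apply: exponential_pdf_ge0.
have [w [wE wi]] := weighted_measure lebesgue_measure mZ Z0.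
transitivity (\int[w]_x f x).
  by apply: eq_measure_integral => B mB _; rewrite wE.
rewrite wi// [RHS]integral_mkcond; apply: eq_integral => x _.
rewrite /exponential_pdf !patchE; case: ifP => _; last by rewrite mule0.
by rewrite mul1r mulN1r.
Qed.

Lemma measure_eq_rays (m1 m2 : {measure set (measurableTypeR R) -> \bar R}) :
  (m1 setT < +oo) ->
  (forall a : R, m1 `]a, +oo[%classic = m2 `]a, +oo[%classic) ->
  forall A, measurable A -> m1 A = m2 A.
Proof.
move=> m1oo h A mA; apply: (@measure_unique _ R (measurableTypeR R)
  (@RGenOInfty.G R) (fun n => `](- n%:R)%R, +oo[%classic) _ _ _ _ m1 m2 _ _ A mA).
- exact: RGenOInfty.measurableE.
- move=> _ _ [a ->] [b ->]; exists (Num.max a b).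
  apply/seteqP; split => x /=; rewrite !in_itv/= !andbT gt_max.
    by move=> [-> ->].
  by move=> /andP[].
- by move=> n; exists (- n%:R)%R.
- apply/seteqP; split => // x _; exists (Num.trunc `|x|).+1 => //=.
  rewrite in_itv/= andbT ltrNl; apply: le_lt_trans (ler_norm _) _.
  by rewrite normrN truncnS_gt.
- by move=> _ [a ->].
- move=> n; apply: le_lt_trans m1oo; apply: le_measure; rewrite ?inE//.
Qed.

(** [L - ln u] is [L] plus a standard exponential variable when [u] is uniform. *)
Lemma integral_uniform_exp (L : R) (k g : R -> \bar R) :
  measurable_fun setT k -> (forall s, 0 <= k s) ->
  measurable_fun setT g -> (forall s, 0 <= g s) ->
  (forall u : R, (0 < u <= 1)%R -> g u = k (L - ln u)%R) ->
  \int[uniform_prob (@ltr01 R)]_u g u =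
  (expR L)%:E * \int[lebesgue_measure]_(s in `]L, +oo[) (k s * (expR (- s))%:E).
Proof.
move=> mk k0 mg g0 gk.
have mln : measurable_fun setT (fun u : R => L - ln u)%R.
  by apply: measurable_funB => //; exact: measurable_ln.
pose Z s : R := (expR (L - s) * \1_`]L, +oo[ s)%R.
have mZ : measurable_fun setT Z.
  apply: measurable_funM; last exact: measurable_indic.
  by apply: (measurableT_comp (@measurable_expR R)); exact: measurable_funB.
have Z0 s : (0 <= Z s)%R by rewrite mulr_ge0// expR_ge0.
have [m1 m1E] := @pushforward_measure_of _ _ (measurableTypeR R)
  (measurableTypeR R) R (uniform_prob (@ltr01 R)) (fun u : R => L - ln u)%R mln.
have [m2 [m2E m2i]] := weighted_measure lebesgue_measure mZ Z0.
have m1A A : measurable A -> m1 A =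
    lebesgue_measure ([set u | A (L - ln u)%R] `&` `[0%R, 1%R]%classic).
  move=> mA.
  have mIA : measurable_fun setT (fun s => (\1_A s : R)%:E).
    by apply/measurable_EFinP; exact: measurable_indic.
  have iA0 s : 0 <= (\1_A s : R)%:E by rewrite lee_fin.
  have -> : m1 A = \int[m1]_s (\1_A s)%:E by rewrite integral_indic// setIT.
  rewrite m1E// integral_uniform//; last exact: (measurableT_comp mIA mln).
  rewrite subr0 invr1 mul1e -(integral_indic lebesgue_measure)//.
  by rewrite -[X in measurable X]setTI; exact: (mln measurableT A mA).
have m1oo : m1 setT < +oo.
  rewrite m1A// setTI.
  by rewrite (lebesgue_measure_itv `[0%R, 1%R])/= lte01 sube0 ltry.
have ray (a : R) : m1 `]a, +oo[%classic = m2 `]a, +oo[%classic.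
  rewrite m1A; last exact: measurable_itv.
  rewrite m2E /weighted.
  (* The survival function at [a] of [L] plus a standard exponential variable. *)
  transitivity (expR (L - Num.max a L))%:E; last first.
    transitivity (\int[lebesgue_measure]_(s in `]Num.max a L, +oo[)
        ((expR L)%:E * (expR (- s))%:E)).
      rewrite ge0_integralZl//; last first.
        by apply: measurable_funTS; apply/measurable_EFinP; exact: measurable_expRopp.
      by rewrite integral_expRN_itv -EFinM expRD.
    rewrite [LHS]integral_mkcond [RHS]integral_mkcond.
    congr integral; apply/funext => s.
    rewrite !epatch_indic /Z -!EFinM; congr (_%:E); rewrite expRD !indicE.
    rewrite !mem_setE !in_itv/= !andbT gt_max -!mulrA -natrM mulnb.
    by rewrite andbC.
  have [aL|La] := ltP a L.
    rewrite subrr expR0.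
    transitivity (lebesgue_measure (`[0%R, 1%R]%classic : set R)); last first.
      by rewrite lebesgue_measure_itv/= lte01 sube0.
    congr (lebesgue_measure _); apply/seteqP; split => u /=; rewrite !in_itv/= ?andbT.
      by move=> [].
    move=> u1; split=> //; rewrite ltrBrDr -ltrBrDl.
    by apply: le_lt_trans (_ : 0 < _)%R; [rewrite ln_le0//; case/andP : u1|rewrite subr_gt0].
  have e1 : (expR (L - a) <= 1)%R by rewrite -expR0 ler_expR subr_le0.
  transitivity (lebesgue_measure (`]0%R, expR (L - a)%R[%classic : set R)); last first.
    by rewrite lebesgue_measure_itv/= lte_fin expR_gt0 sube0.
  congr (lebesgue_measure _); apply/seteqP; split => u /=; rewrite !in_itv/= ?andbT.
    move=> [h /andP[u0 u1]].
    (* By convention [ln 0 = 0]: the point [u = 0] is sent to [L], which does not exceed [a] in this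
       case. *)
    have up : (0 < u)%R.
      rewrite lt_neqAle u0 andbT; apply/eqP => u00; move: h.
      by rewrite -u00 ln0// subr0 ltNge La.
    rewrite up -ltr_ln ?posrE ?expR_gt0// expRK; move: h; lra.
  move=> /andP[u0 ue]; split; last by rewrite (ltW u0)/= ltW// (lt_le_trans ue).
  by move: ue; rewrite -ltr_ln ?posrE ?expR_gt0// expRK => ?; lra.
transitivity (\int[m1]_s k s).
  rewrite m1E// !integral_uniform//; last exact: (measurableT_comp mk mln).
  congr (_ * _).
  (* The endpoints are dropped because [g] and [k] are related only for [0 < u <= 1]. *)
  rewrite (@integral_itv_bndoo _ 0%R 1%R g true false); last exact: measurable_funTS.
  rewrite (@integral_itv_bndoo _ 0%R 1%R (fun u => k (L - ln u)%R) true false).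
    2: by apply: measurable_funTS; exact: (measurableT_comp mk mln).
  apply: eq_integral => u; rewrite inE/= in_itv/= => /andP[u0 u1].
  by rewrite gk// u0 ltW.
have e := @measure_eq_rays m1 m2 m1oo ray.
transitivity (\int[m2]_s k s).
  by apply: eq_measure_integral => A mA _; exact: e.
rewrite m2i// -ge0_integralZl//; last 2 first.
- apply: measurable_funTS; apply: emeasurable_funM => //.
  by apply/measurable_EFinP; exact: measurable_expRopp.
- by move=> s _; rewrite mule_ge0// lee_fin expR_ge0.
rewrite [RHS]integral_mkcond; congr integral; apply/funext => s.
rewrite epatch_indic /Z expRD !EFinM muleA; congr (_ * _).
by rewrite muleCA.
Qed.

End one_dimensional_laws.

Section step_paths.
Context (R : realType).

Lemma measurable_step_path d (T : measurableType d) (f g : T -> R) :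
  measurable_fun setT f -> measurable_fun setT g ->
  measurable_fun setT (fun w => step_path (f w) (g w)).
Proof.
move=> mf mg; apply: measurable_to_paths => t.
rewrite (_ : (fun w => _) = fun w => `|f w * \1_[set w | g w <= t%:num] w|).
  apply: measurableT_comp; first exact: normr_measurable.
  apply: measurable_funM => //; apply: measurable_indic.
  rewrite [X in measurable X](_ : _ = g @^-1` `]-oo, t%:num]%classic).
    by rewrite -[X in measurable X]setTI; apply: mg => //; exact: measurable_itv.
  by apply/seteqP; split => w; rewrite /= in_itv.
by apply/funext => w /=; rewrite /step !indicE !mem_setE in_itv/= andbT.
Qed.

Lemma jump_of_uniform (H g u x : R) : 0 < H -> 0 < g -> 0 < u ->
  jump_of H (ln (g `^ (- H)) - ln u, x) =
  step_path (g `^ H * u * x) (g * u `^ H^-1).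
Proof.
move=> H0 g0 u0; rewrite /jump_of /=.
have e : expR (- (ln (g `^ (- H)) - ln u)) = g `^ H * u.
  rewrite opprB expRD lnK ?posrE// ln_powR mulNr opprK -ln_powR.
  by rewrite lnK ?posrE ?powR_gt0// mulrC.
rewrite e mulrC; congr step_path.
transitivity (expR (ln g + H^-1 * ln u)); last first.
  by rewrite expRD lnK ?posrE// /powR gt_eqF.
by congr expR; rewrite ln_powR; field; rewrite gt_eqF.
Qed.

End step_paths.

Section size_bias.
Local Open Scope ereal_scope.
Context (R : realType) d (T : measurableType d) (P : probability T R).

Lemma distribution_null (X : {RV P >-> R}) (A : set R) : measurable A ->
  distribution P X A = 0 -> {ae P, forall w, ~ A (X w)}.
Proof.
move=> mA XA; exists (X @^-1` A); split => //.
- by rewrite -[Y in measurable Y]setTI; exact: measurable_funPT.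
- by move=> w /= /contrapT.
Qed.

(** Differentiate the Laplace functional of [X] in the coefficient at [a]. *)
Lemma levy_measure_palm (X : {nonneg R} -> T -> R)
    (nu : {measure set (paths R) -> \bar R}) (a : {nonneg R})
    (sg : seq (R * {nonneg R})) :
  (forall t, measurable_fun setT (X t)) -> (forall t w, (0 <= X t w)%R) ->
  \int[P]_w (X a w)%:E < +oo ->
  levy_measure_of P X nu -> nneg_coefs sg ->
  \int[P]_w (expR (- \sum_(p <- sg) p.1 * X p.2 w) * X a w)%:E =
  \int[P]_w (expR (- \sum_(p <- sg) p.1 * X p.2 w))%:E *
  \int[nu]_y (path_exp sg y * (y a)%:num)%:E.
Proof.
move=> mX X0 Xoo hX sg0.
pose W w := expR (- \sum_(p <- sg) p.1 * X p.2 w).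
have mW : measurable_fun setT W.
  apply: (measurableT_comp (@measurable_expRopp R)).
  by apply: measurable_sum => p; apply: measurable_funM.
have W0 w : (0 <= W w)%R by exact: expR_ge0.
have W1 w : (W w <= 1)%R.
  apply: expRN_le1; rewrite big_seq.
  by apply: sumr_ge0 => p psg; rewrite mulr_ge0 ?(allP sg0).
have mb := measurable_path_exp sg.
have me := measurable_eval a.
have mbe l : measurable_fun setT
    (fun y : paths R => (path_exp sg y * (1 - expR (- (l * (y a)%:num))))%:E).
  apply/measurable_EFinP; apply: measurable_funM => //.
  by apply: measurable_funB => //; exact: (measurableT_comp (measurable_expRN l) me).
have be0 l y : (0 <= l)%R ->
    0 <= (path_exp sg y * (1 - expR (- (l * (y a)%:num))))%:E.
  move=> l0; rewrite lee_fin mulr_ge0 ?path_exp_ge0// subr_ge0 expRN_le1//.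
  by rewrite mulr_ge0.
have m1 s : measurable_fun setT (fun y : paths R => (1 - path_exp s y)%:E).
  by apply/measurable_EFinP; apply: measurable_funB => //; exact: measurable_path_exp.
have split_exp l y : (1 - path_exp ((l, a) :: sg) y)%:E =
    (1 - path_exp sg y)%:E +
    (path_exp sg y * (1 - expR (- (l * (y a)%:num))))%:E.
  by rewrite path_exp_cons -EFinD; congr (_%:E) => /=; ring.
have int_split l : (0 <= l)%R -> \int[nu]_y (1 - path_exp ((l, a) :: sg) y)%:E =
    \int[nu]_y (1 - path_exp sg y)%:E + \int[nu]_y
      (path_exp sg y * (1 - expR (- (l * (y a)%:num))))%:E.
  move=> l0; under eq_integral do rewrite split_exp.
  rewrite ge0_integralD//.
  - by move=> y _; rewrite lee_fin subr_ge0 path_exp_le1.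
  - by move=> y _; exact: be0.
have sg1 l : (0 <= l)%R -> nneg_coefs ((l, a) :: sg) by move=> l0 /=; rewrite l0.
apply: (@laplace_derivative R _ _ P _ _ nu W (X a) (path_exp sg)
  (fun y => (y a)%:num)) => //.
- by move=> y; exact: path_exp_ge0.
- rewrite integral_gt0//; last by move=> w; exact: expR_gt0.
  have W01 w : (0 <= W w <= 1)%R by rewrite W0 W1.
  have := integral_le1_fin P mW W01; rewrite ge0_fin_numE//.
  by apply: integral_ge0 => w _; rewrite lee_fin.
- apply: le_lt_trans Xoo; apply: ge0_le_integral => //.
  + by move=> w _; rewrite lee_fin mulr_ge0.
  + by apply/measurable_EFinP; exact: measurable_funM.
  + exact/measurable_EFinP.
  + by move=> w _; rewrite lee_fin ler_piMl.
(* Finiteness at step 1: the functional of the list extended by the coefficient 1 at [a] is finite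
   and dominates the tilted integral. *)
- have := levy_measure_finite mX hX (sg1 _ ler01); rewrite int_split//.
  apply: le_lt_trans.
  under [X in _ <= _ + X]eq_integral do rewrite mul1r.
  apply: leeDr; apply: integral_ge0 => y _.
  by rewrite lee_fin subr_ge0 path_exp_le1.
- move=> n; have n0 : (0 <= (n.+1%:R^-1 : R))%R by rewrite invr_ge0.
  have := levy_measure_laplace hX (sg1 _ n0).
  rewrite int_split// oppeD; last first.
    by apply: ge0_adde_def; rewrite inE integral_ge0// => y _;
      [rewrite lee_fin subr_ge0 path_exp_le1|exact: be0].
  rewrite expeRD -(levy_measure_laplace hX sg0) => <-.
  apply: eq_integral => w _; rewrite big_cons opprD expRD mulrC; congr (_%:E).
Qed.

End size_bias.

Section palm_jump.
Local Open Scope ereal_scope.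
Context (R : realType) (H : R) (rho : {sigma_finite_measure set R -> \bar R}).
Hypotheses (H0 : (0 < H)%R) (rho0 : rho `]-oo, 0%R]%classic = 0).

Variables (kappa : R) (PV : probability R R).
Hypothesis kappa0 : (0 < kappa)%R.
Hypothesis PVE : forall B, measurable B ->
  PV B = \int[rho]_(x in B) (kappa^-1 * x)%:E.

Let k0 : (0 <= kappa^-1)%R. Proof. by rewrite invr_ge0 ltW. Qed.

(** Both laws become densities against [ds] and [rho(dx)]: the level [L - ln u] has density
    [e^(L - s)] beyond [L], and [v] contributes the factor [kappa^-1 x]. *)
Lemma integral_uniform_size_biased (L : R) (q : R * R -> \bar R)
    (h : measurableTypeR R * R -> \bar R) :
  measurable_fun setT q -> (forall p, 0 <= q p) ->
  measurable_fun setT h -> (forall p, 0 <= h p) ->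
  (forall u x : R, (0 < u <= 1)%R -> (0 < x)%R -> q (u, x) = h ((L - ln u)%R, x)) ->
  \int[uniform_prob (@ltr01 R)]_u \int[PV]_v q (u, v) =
  (expR L)%:E * \int[lebesgue_measure]_(s in `]L, +oo[)
    (\int[rho]_(x in `]0%R, +oo[) (h (s, x) * (kappa^-1 * x)%:E) *
      (expR (- s))%:E).
Proof.
move=> mq q0 mh h0 qh.
pose kk (p : measurableTypeR R * R) : \bar R := h p * (kappa^-1 * `|p.2|)%:E.
have mkk : measurable_fun setT kk.
  apply: emeasurable_funM => //; apply/measurable_EFinP; apply: measurable_funM => //.
  exact: (measurableT_comp (@normr_measurable R setT) measurable_snd).
have kk0 p : 0 <= kk p by rewrite mule_ge0// lee_fin mulr_ge0.
have kkE s : \int[rho]_(x in `]0%R, +oo[) (h (s, x) * (kappa^-1 * x)%:E) =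
    \int[rho]_(x in `]0%R, +oo[) kk (s, x).
  apply: eq_integral => x; rewrite inE/= in_itv/= andbT => x0.
  by rewrite /kk /= gtr0_norm.
apply: (@integral_uniform_exp R _
  (fun s => \int[rho]_(x in `]0%R, +oo[) (h (s, x) * (kappa^-1 * x)%:E))).
- under eq_fun do rewrite kkE; exact: (measurable_integral_rho rho0).
- by move=> s; rewrite kkE; exact: integral_ge0.
- exact: (@measurable_fun_fubini_tonelli_F _ _ _ _ _ PV q mq q0).
- by move=> u; apply: integral_ge0 => v _; exact: (q0 (u, v)).
- move=> u u01.
  rewrite (integral_size_biased k0 rho0 PVE (f := fun v => q (u, v))).
  + apply: eq_integral => x; rewrite inE/= in_itv/= andbT => x0.
    by rewrite qh.
  + exact: (measurableT_comp mq).
  + by move=> v; exact: q0.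
Qed.

Variable nu : {measure set (paths R) -> \bar R}.
Hypothesis hnu : is_jump_measure H rho nu.
Variables (a : {nonneg R}) (a0 : (0 < a%:num)%R).

(** The value at [a] of a jump path is [x e^(-s)] from the level [L] on: [x] supplies the size
    biasing and [e^(-s)] the density of the level. The constant is matched by [e^L = a^(-H)]. *)
Lemma palm_jump_measure (h : paths R -> R) :
  measurable_fun setT h -> (forall y, (0 <= h y)%R) ->
  \int[nu]_y (h y * (y a)%:num)%:E = (kappa * a%:num `^ H)%:E *
  \int[uniform_prob (@ltr01 R)]_u \int[PV]_v
    (h (step_path (a%:num `^ H * u * v) (a%:num * u `^ H^-1)))%:E.
Proof.
move=> mh h0; set L := ln (a%:num `^ (- H)).
pose q (p : R * R) :=
  (h (step_path (a%:num `^ H * p.1 * p.2) (a%:num * p.1 `^ H^-1)))%:E.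
have mq : measurable_fun setT q.
  apply/measurable_EFinP; apply: (measurableT_comp mh).
  apply: measurable_step_path.
    apply: measurable_funM => //; exact: measurable_funM.
  apply: measurable_funM => //.
  exact: (measurableT_comp (measurable_powR _)).
have q0 p : 0 <= q p by rewrite lee_fin.
have mhj : measurable_fun setT (fun p => (h (jump_of H p))%:E).
  by apply/measurable_EFinP; exact: (measurableT_comp mh (measurable_jump_of H0)).
rewrite (integral_uniform_size_biased (L := L) mq q0 mhj); last 2 first.
- by move=> p; rewrite lee_fin.
- by move=> u x /andP[u0 _] x0; rewrite /q /L jump_of_uniform.
rewrite muleA.
have -> : (kappa * a%:num `^ H)%:E * (expR L)%:E = kappa%:E.
  rewrite -EFinM /L lnK ?posrE ?powR_gt0// powRN mulfK//.
  by rewrite gt_eqF// powR_gt0.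
have me := measurable_eval a.
have mhy : measurable_fun setT (fun y : paths R => (h y * (y a)%:num)%:E).
  by apply/measurable_EFinP; exact: measurable_funM.
rewrite (hnu mhy); last by move=> y; rewrite lee_fin mulr_ge0.
pose kk (p : measurableTypeR R * R) : \bar R := (h (jump_of H p) * `|p.2|)%:E.
have mkk : measurable_fun setT kk.
  apply/measurable_EFinP; apply: measurable_funM.
    exact: (measurableT_comp mh (measurable_jump_of H0)).
  exact: (measurableT_comp (@normr_measurable R setT) measurable_snd).
have kk0 p : 0 <= kk p by rewrite lee_fin mulr_ge0.
pose K s := \int[rho]_(x in `]0%R, +oo[) kk (s, x).
have K0 s : 0 <= K s by exact: integral_ge0.
have mK : measurable_fun setT K by exact: (measurable_integral_rho rho0).
have KE (c : R) s : (0 <= c)%R ->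
    \int[rho]_(x in `]0%R, +oo[) ((h (jump_of H (s, x)))%:E * (c * x)%:E) = c%:E * K s.
  move=> c0; rewrite /K -ge0_integralZl//.
    apply: eq_integral => x; rewrite inE/= in_itv/= andbT => x0.
    by rewrite /kk /= gtr0_norm// -!EFinM mulrCA.
  exact/measurable_funTS/(measurableT_comp mkk).
transitivity (\int[lebesgue_measure]_s (K s * (ckern H a s)%:E)).
  apply: eq_integral => s _.
  rewrite muleC -KE ?ckern_ge0//; apply: eq_integral => x.
  rewrite inE/= in_itv/= andbT => x0.
  by rewrite (jump_num H0 s a (ltW x0)) [(x * _)%R]mulrC EFinM.
transitivity (\int[lebesgue_measure]_(s in `]L, +oo[) (K s * (expR (- s))%:E)).
  rewrite [RHS]integral_mkcond.
  have mKE (f : R -> R) : measurable_fun setT f ->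
      measurable_fun setT (fun s => K s * (f s)%:E).
    by move=> mf; apply: emeasurable_funM => //; exact/measurable_EFinP.
  apply: (integral_lebesgue_off_finite (L := [:: L])).
  - exact: mKE (measurable_ckern H a).
  - apply/(measurable_restrictT _ _).1 => //; apply: measurable_funTS.
    exact: mKE (@measurable_expRopp R).
  - by move=> s; rewrite mule_ge0// lee_fin ckern_ge0.
  - move=> s; rewrite patchE; case: ifP => // _.
    by rewrite mule_ge0// lee_fin expR_ge0.
  - move=> s; rewrite inE => sL; rewrite /ckern (log_level_pos H a0) lee_fin patchE.
    have -> : (s \in `]L, +oo[%classic) = (L <= s)%R.
      by rewrite le_eqVlt eq_sym (negbTE sL); apply/idP/idP; rewrite inE/= in_itv/= andbT.
    by case: (L <= s)%R; rewrite ?mulr1 ?mulr0 ?mule0.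
rewrite -ge0_integralZl//; last 3 first.
- apply: measurable_funTS; under eq_fun do rewrite KE//.
  apply: emeasurable_funM; first exact: emeasurable_funM.
  by apply/measurable_EFinP; exact: measurable_expRopp.
- by move=> s _; rewrite KE// !mule_ge0// lee_fin ?expR_ge0.
- by rewrite lee_fin ltW.
congr integral; apply/funext => s.
by rewrite KE// !muleA -EFinM divff ?mul1e// gt_eqF.
Qed.

End palm_jump.

(** [R] and [measurableTypeR R] have the same measurable sets but different
    displays. *)
Lemma eq_measurableTypeR_integral (R : realType) (m1 : {measure set R -> \bar R})
    (m2 : {measure set (measurableTypeR R) -> \bar R}) (f : R -> \bar R) :
  (forall B, measurable B -> m1 B = m2 B) -> measurable_fun setT f ->
  (forall x, 0 <= f x)%E -> (\int[m1]_x f x = \int[m2]_x f x)%E.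
Proof.
move=> h mf f0.
have mi : measurable_fun (setT : set (measurableTypeR R))
  (id : measurableTypeR R -> R) by exact: measurable_id.
have mj : measurable_fun (setT : set R) (id : R -> R) by exact: measurable_id.
exact: (eq_distribution_integral mj mi h mf f0).
Qed.

Section size_biased_process.
Local Open Scope ereal_scope.
Context (R : realType) d (T : measurableType d) (P : probability T R).

Lemma uniform_rv_pos (U : {RV P >-> R}) :
  (forall B, measurable B -> distribution P U B = uniform_prob (@ltr01 R) B) ->
  {ae P, forall w, (0 < U w)%R}.
Proof.
move=> hU.
have : {ae P, forall w, ~ `]-oo, 0%R]%classic (U w)}.
  apply: distribution_null; first exact: measurable_itv.
  rewrite hU; last exact: measurable_itv.
  rewrite -(setIT `]-oo, 0%R]%classic) -integral_indic//.
  rewrite integral_uniform//; last by apply/measurable_EFinP; exact: measurable_indic.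
  rewrite (@integral_itv_bndoo _ 0%R 1%R (fun x => (\1_`]-oo, 0%R] x)%:E) true false).
    rewrite (eq_integral (cst 0)) ?integral0 ?mule0// => x.
    rewrite inE/= in_itv/= => /andP[x0 _].
    by rewrite indicE memNset//= in_itv/= => /le_lt_trans /(_ x0); rewrite ltxx.
  by apply: measurable_funTS; apply/measurable_EFinP; exact: measurable_indic.
by apply: filterS => w /negP; rewrite in_itv/= -ltNge.
Qed.

Lemma size_biased_rv_pos (V : {RV P >-> R}) (rho : {measure set R -> \bar R})
    (c : R) : (0 <= c)%R -> rho `]-oo, 0%R]%classic = 0 ->
  (forall B, measurable B -> distribution P V B = \int[rho]_(x in B) (c * x)%:E) ->
  {ae P, forall w, (0 < V w)%R}.
Proof.
move=> c0 rho0 hV.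
have : {ae P, forall w, ~ `]-oo, 0%R]%classic (V w)}.
  apply: distribution_null; first exact: measurable_itv.
  rewrite -(setIT `]-oo, 0%R]%classic) -integral_indic//.
  rewrite (integral_size_biased c0 rho0 hV)//.
    apply: integral0_eq => x; rewrite /= in_itv/= andbT => x0.
    rewrite indicE memNset ?mul0e//= in_itv/= => /le_lt_trans /(_ x0).
    by rewrite ltxx.
  by apply/measurable_EFinP; exact: measurable_indic.
by apply: filterS => w /negP; rewrite in_itv/= -ltNge.
Qed.

Variables (H : R) (Y : T -> cumulative R R) (kappa : R)
  (rho : {sigma_finite_measure set R -> \bar R}).
Hypothesis H0 : (0 < H)%R.
Hypothesis levyY : double_sided_levy P (fun s w => Y w s).
Hypothesis meanY : 'E_P[fun w => Y w 1%R] = kappa%:E.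
Hypothesis kappa0 : (0 < kappa)%R.
Hypothesis levyrho : driftless_levy_measure P (fun w => Y w 1%R) rho.
Variable nu : {measure set (paths R) -> \bar R}.
Hypothesis hnu : levy_measure_of P (sato H Y) nu.

Let rho0 : rho `]-oo, 0%R]%classic = 0 := levyrho.1.
Let psi := sato H Y.
Let mpsi t : measurable_fun setT (psi t). Proof. exact: (measurable_sato H levyY). Qed.
Let psi0 t w : (0 <= psi t w)%R. Proof. exact: sato_ge0. Qed.
Let hjump : is_jump_measure H rho nu := sato_levy_measure H0 levyY meanY levyrho hnu.

(** By independence the Laplace functional of the sum is that of [psi] times the expectation of the
    exponential of the added step. Differentiating the functional of [psi] at [a] gives the same
    product times the mean [kappa a^H], which is the normalisation. *)
Lemma eq_law_size_bias (a : {nonneg R}) (U V : {RV P >-> R}) : (0 < a%:num)%R ->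
  (forall B, measurable B -> distribution P U B = uniform_prob (@ltr01 R) B) ->
  (forall B, measurable B ->
    distribution P V B = \int[rho]_(x in B) (kappa^-1 * x)%:E) ->
  mutually_independent P
    (tnth [tuple sigma_rv U; sigma_rv V; sigma_process psi]) ->
  eq_law P (fun t w => psi t w + step (a%:num `^ H * U w * V w)
                         (a%:num * U w `^ H^-1) t%:num)%R
         (weighted P (fun w => psi a w / (kappa * a%:num `^ H))%R) psi.
Proof.
move=> a0 hU hV ind.
have k0 : (0 <= kappa^-1)%R by rewrite invr_ge0 ltW.
have c0 : (0 < kappa * a%:num `^ H)%R by rewrite mulr_gt0// powR_gt0.
pose Z w : R := (psi a w / (kappa * a%:num `^ H))%R.
have Z0 w : (0 <= Z w)%R by rewrite divr_ge0// ltW.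
have mZ : measurable_fun setT Z by exact: measurable_funM.
have [m [mE mi]] := weighted_measure P mZ Z0.
have mc : measurable_fun setT (fun w => a%:num `^ H * U w * V w)%R.
  by apply: measurable_funM => //; exact: measurable_funM.
have mu : measurable_fun setT (fun w => a%:num * U w `^ H^-1)%R.
  by apply: measurable_funM => //; exact: (measurableT_comp (measurable_powR _)).
pose X (t : {nonneg R}) w : R := (psi t w + step (a%:num `^ H * U w * V w)
                         (a%:num * U w `^ H^-1) t%:num)%R.
have mX t : measurable_fun setT (X t).
  apply: measurable_funD; first exact: mpsi.
  rewrite (_ : (fun w => _) = fun w => (a%:num `^ H * U w * V w) *
      \1_[set w | a%:num * U w `^ H^-1 <= t%:num] w)%R; last first.
    by apply/funext => w; rewrite /step !indicE !mem_setE in_itv/= andbT.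
  apply: measurable_funM => //; apply: measurable_indic.
  rewrite [A in measurable A](_ : _ =
      (fun w => a%:num * U w `^ H^-1)%R @^-1` `]-oo, t%:num]%classic).
    by rewrite -[A in measurable A]setTI; apply: mu => //; exact: measurable_itv.
  by apply/seteqP; split => w; rewrite /= in_itv.
have UV0 : {ae P, forall w, (0 <= a%:num `^ H * U w * V w)%R}.
  apply: filterS2 (uniform_rv_pos hU) (size_biased_rv_pos k0 rho0 hV) => w Uw Vw.
  by rewrite !mulr_ge0 ?powR_ge0// ltW.
have X0 t : {ae P, forall w, (0 <= X t w)%R}.
  by apply: filterS UV0 => w h; rewrite addr_ge0// mulr_ge0.
suff : eq_law P X m psi by move=> h n t B mB; rewrite -mE; exact: h.
have PT : P setT < +oo by rewrite probability_setT ltry.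
apply: (@eq_law_laplace_ae _ _ _ _ _ P m X psi PT mX mpsi X0
  (fun t => aeW _ (psi0 t))) => sg sg0.
pose W w := expR (- \sum_(p <- sg) p.1 * psi p.2 w).
have mWp (f : T -> R) : measurable_fun setT f ->
    measurable_fun setT (fun w => expR (- f w)).
  by move=> mt; exact: (measurableT_comp (@measurable_expRopp R)).
have mW : measurable_fun setT W.
  by apply: mWp; apply: measurable_sum => p; apply: measurable_funM.
have W0 w : (0 <= W w)%R by exact: expR_ge0.
have W01 w : (0 <= W w <= 1)%R.
  rewrite W0 expRN_le1// big_seq.
  by apply: sumr_ge0 => p psg; rewrite mulr_ge0 ?(allP sg0).
pose S (p : R * R) := step_path (a%:num `^ H * p.1 * p.2) (a%:num * p.1 `^ H^-1).
have mS : measurable_fun setT S.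
  apply: measurable_step_path.
    by apply: measurable_funM => //; exact: measurable_funM.
  by apply: measurable_funM => //; exact: (measurableT_comp (measurable_powR _)).
pose k p := (path_exp sg (S p))%:E.
have mk : measurable_fun setT k.
  by apply/measurable_EFinP; exact: (measurableT_comp (measurable_path_exp sg) mS).
have kpos p : 0 <= k p by rewrite lee_fin path_exp_ge0.
(* [k] goes through [step_path] and its absolute value; [U] and [V] are positive almost surely, so
   it agrees with [step] there. *)
transitivity (\int[P]_w (k (U w, V w) * (W w)%:E)).
  apply: ge0_ae_eq_integral => //.
  - apply/measurable_EFinP; apply: mWp; apply: measurable_sum => p.
    exact: measurable_funM.
  - apply: emeasurable_funM; last exact/measurable_EFinP.
    apply: (measurableT_comp mk); exact: measurable_fun_pair.
  - by move=> w _; rewrite mule_ge0// lee_fin.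
  - apply: filterS UV0 => w h _; rewrite /k /path_exp /W -EFinM -expRD.
    congr (expR _)%:E; rewrite -opprD; apply: (congr1 -%R); rewrite -big_split/=.
    apply: eq_bigr => p _; rewrite (ger0_norm (mulr_ge0 _ _))//.
    by rewrite /X mulrDr addrC.
have FP A : sigma_process psi A -> measurable A by exact: sigma_process_measurable.
have FW B : measurable B -> sigma_process psi (W @^-1` B).
  by exact: sigma_process_exp.
rewrite (indep_joint_law ind FP FW W01 mk kpos).
have -> : \int[distribution P U]_u \int[distribution P V]_v k (u, v) =
    \int[uniform_prob (@ltr01 R)]_u \int[distribution P V]_v k (u, v).
  apply: (eq_measurableTypeR_integral hU).
    exact: (@measurable_fun_fubini_tonelli_F _ _ _ _ _ (distribution P V) k mk kpos).
  by move=> u; exact: integral_ge0.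
have mWE : measurable_fun setT (fun w => (W w)%:E) by exact/measurable_EFinP.
rewrite mi; last 2 first.
- exact: mWE.
- by move=> w; rewrite lee_fin.
have mean : \int[P]_w (psi a w)%:E < +oo.
  by rewrite (sato_mean H0 levyY meanY) ltry.
have palm := levy_measure_palm mpsi psi0 mean hnu sg0.
rewrite (palm_jump_measure H0 rho0 kappa0 hV hjump a0 (measurable_path_exp sg)) in palm;
  last by move=> y; exact: path_exp_ge0.
transitivity ((kappa * a%:num `^ H)^-1%:E * \int[P]_w (W w * psi a w)%:E).
  rewrite palm muleCA [X in _ = _ * X]muleA -EFinM mulVf ?gt_eqF// mul1e.
  by [].
rewrite -ge0_integralZl//.
- by apply: eq_integral => w _; rewrite -2!EFinM; congr (_%:E); rewrite mulrC -mulrA.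
- by apply/measurable_EFinP; exact: measurable_funM.
- by move=> w _; rewrite lee_fin mulr_ge0.
- by rewrite lee_fin invr_ge0 ltW.
Qed.

End size_biased_process.

(** * The exponential representation *)

Section jump_representation.
Local Open Scope ereal_scope.
Context (R : realType) (H : R) (rho : {sigma_finite_measure set R -> \bar R}).
Hypotheses (H0 : (0 < H)%R) (rho0 : rho `]-oo, 0%R]%classic = 0).
Variables (kappa : R) (PV : probability R R).
Hypothesis kappa0 : (0 < kappa)%R.
Hypothesis PVE : forall B, measurable B ->
  PV B = \int[rho]_(x in B) (kappa^-1 * x)%:E.
Variable F : paths R -> \bar R.
Hypotheses (mF : measurable_fun setT F) (F0 : forall y, 0 <= F y).

(** The absolute value only makes it total: [u * v] is positive almost surely. *)
Definition jump_weight (g u v : R) : R :=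
  (`|(u * v)^-1| * expR (g * u `^ H^-1))%R.

Definition random_jump (p : R * R * R) : paths R :=
  step_path (p.1.1 `^ H * p.1.2 * p.2) (p.1.1 * p.1.2 `^ H^-1).

Definition weighted_jump (p : R * R * R) : \bar R :=
  (jump_weight p.1.1 p.1.2 p.2)%:E * F (random_jump p).

Lemma measurable_random_jump : measurable_fun setT random_jump.
Proof.
apply: measurable_step_path.
  apply: measurable_funM => //; apply: measurable_funM.
    apply: (measurableT_comp (measurable_powR _)).
    exact: (measurableT_comp measurable_fst).
  exact: (measurableT_comp measurable_snd).
apply: measurable_funM; first exact: (measurableT_comp measurable_fst).
apply: (measurableT_comp (measurable_powR _)).
exact: (measurableT_comp measurable_snd).
Qed.

Lemma measurable_weighted_jump : measurable_fun setT weighted_jump.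
Proof.
apply: emeasurable_funM; last exact: (measurableT_comp mF measurable_random_jump).
apply/measurable_EFinP; apply: measurable_funM.
  apply: (measurableT_comp (@normr_measurable R setT)).
  apply: measurable_fun_inv; apply: measurable_funM => //.
  exact: (measurableT_comp measurable_snd).
apply: (measurableT_comp (@measurable_expR R)).
apply: measurable_funM; first exact: (measurableT_comp measurable_fst).
apply: (measurableT_comp (measurable_powR _)).
exact: (measurableT_comp measurable_snd).
Qed.

Lemma weighted_jump_ge0 p : 0 <= weighted_jump p.
Proof. by rewrite mule_ge0// lee_fin mulr_ge0// expR_ge0. Qed.

(** At fixed [g], the factor [(u v)^-1] cancels the density of the level and the size biasing. What
    remains is [ds] times [rho(dx)] beyond the level of [g], with the weight [exp (e^(-s/H))]. *)
Lemma integral_weighted_jump (g : R) : (0 < g)%R ->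
  kappa%:E * \int[uniform_prob (@ltr01 R)]_u \int[PV]_v weighted_jump (g, u, v) =
  \int[lebesgue_measure]_(s in `]ln (g `^ (- H)), +oo[)
    ((expR (expR (- s / H)))%:E * jump_inner H rho F s).
Proof.
move=> g0; set L := ln (g `^ (- H)).
pose q (p : R * R) := weighted_jump (g, p.1, p.2).
have mgp : measurable_fun setT (fun p : R * R => (g, p.1, p.2)).
  apply: measurable_fun_pair; last exact: measurable_snd.
  by apply: measurable_fun_pair; [exact: measurable_cst|exact: measurable_fst].
have mq : measurable_fun setT q.
  exact: (measurableT_comp measurable_weighted_jump mgp).
have q0 p : 0 <= q p by exact: weighted_jump_ge0.
(* With [u = e^(L - s)]: the first factor is [u^-1], and [e^(-s/H)] is [g u^(1/H)]. *)
pose c (s : R) : R := (expR (s - L) * expR (expR (- s / H)))%R.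
pose h (p : measurableTypeR R * R) : \bar R :=
  (c p.1 * `|p.2^-1|)%:E * F (jump_of H p).
have mc : measurable_fun setT c.
  apply: measurable_funM.
    by apply: (measurableT_comp (@measurable_expR R)); exact: measurable_funB.
  apply: (measurableT_comp (@measurable_expR R)).
  apply: (measurableT_comp (@measurable_expR R)).
  by apply: measurable_funM => //; exact: oppr_measurable.
have c0 s : (0 <= c s)%R by rewrite mulr_ge0// expR_ge0.
have mh : measurable_fun setT h.
  apply: emeasurable_funM; last exact: (measurableT_comp mF (measurable_jump_of H0)).
  apply/measurable_EFinP; apply: measurable_funM.
    exact: (measurableT_comp mc measurable_fst).
  apply: (measurableT_comp (@normr_measurable R setT)).
  exact: (measurable_fun_inv measurable_snd).
have h0 p : 0 <= h p by rewrite mule_ge0// lee_fin mulr_ge0.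
rewrite (@integral_uniform_size_biased _ _ rho0 kappa PV kappa0 PVE L q h mq q0 mh h0);
    last first.
  move=> u x /andP[u0 _] x0; rewrite /q /h /weighted_jump /random_jump /=.
  rewrite (jump_of_uniform x H0 g0 u0); congr (_%:E * _).
  rewrite /jump_weight /c invfM normrM (gtr0_norm (x := u^-1)) ?invr_gt0//.
  rewrite mulrAC; congr (_ * _ * _)%R.
    by rewrite addrC addKr -lnV// lnK// posrE invr_gt0.
  congr expR; transitivity (expR (ln g + H^-1 * ln u)).
    by rewrite expRD lnK ?posrE// /powR gt_eqF.
  by congr expR; rewrite /L ln_powR; field; rewrite gt_eqF.
have J0 s : 0 <= jump_inner H rho F s by exact: jump_inner_ge0.
have mJ := measurable_jump_inner H0 rho0 mF F0.
have hE s : \int[rho]_(x in `]0%R, +oo[) (h (s, x) * (kappa^-1 * x)%:E) =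
    (kappa^-1 * c s)%:E * jump_inner H rho F s.
  rewrite /jump_inner -ge0_integralZl//.
  - apply: eq_integral => x; rewrite inE/= in_itv/= andbT => x0.
    rewrite /h /= muleAC -EFinM; congr (_%:E * _).
    rewrite gtr0_norm ?invr_gt0//; field; rewrite !gt_eqF//.
  - apply: measurable_funTS.
    exact: (measurableT_comp (measurableT_comp mF (measurable_jump_of H0))).
  - by rewrite lee_fin mulr_ge0// invr_ge0 ltW.
under eq_integral do rewrite hE.
rewrite muleA -EFinM.
rewrite -ge0_integralZl//; last 3 first.
- apply: measurable_funTS; apply: emeasurable_funM.
    apply: emeasurable_funM; last exact: mJ.
    by apply/measurable_EFinP; exact: measurable_funM.
  by apply/measurable_EFinP; exact: measurable_expRopp.
- move=> s _; rewrite !mule_ge0// lee_fin ?expR_ge0// mulr_ge0// invr_ge0 ltW//.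
- by rewrite lee_fin mulr_ge0 ?expR_ge0// ltW.
apply: eq_integral => s _.
rewrite muleAC -EFinM muleA -EFinM; congr (_%:E * _).
rewrite /c expRB expRN; field.
by rewrite !gt_eqF ?expR_gt0.
Qed.

End jump_representation.

Section jump_law.
Local Open Scope ereal_scope.
Context (R : realType) (H : R) (rho : {sigma_finite_measure set R -> \bar R}).
Hypotheses (H0 : (0 < H)%R) (rho0 : rho `]-oo, 0%R]%classic = 0).

(** For [g] exponential, [-H ln g < s] has probability [expR (- expR (- s / H))]. *)
Lemma integral_exponential_level (J : R -> \bar R) (f : R -> \bar R) :
  measurable_fun setT J -> (forall s, 0 <= J s) ->
  measurable_fun setT f -> (forall g, 0 <= f g) ->
  (forall g, (0 < g)%R -> f g = \int[lebesgue_measure]_(s in `]ln (g `^ (- H)), +oo[)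
    ((expR (expR (- s / H)))%:E * J s)) ->
  \int[exponential_prob 1]_g f g = \int[lebesgue_measure]_s J s.
Proof.
move=> mJ J0 mf f0 fE.
(* The joint integrand in [g] and [s], with the range of [s] rewritten as a condition on [g], ready
   for exchanging the integrals. *)
pose M (p : measurableTypeR R * measurableTypeR R) : \bar R :=
  (expR (- p.1) * \1_[set p | (expR (- p.2 / H) < p.1)%R] p *
    expR (expR (- p.2 / H)))%:E * J p.2.
have ml : measurable_fun setT
    (fun p : measurableTypeR R * measurableTypeR R => expR (- p.2 / H)).
  apply: (measurableT_comp (@measurable_expR R)).
  apply: measurable_funM => //.
  exact: (measurableT_comp (@oppr_measurable R setT) measurable_snd).
have mM : measurable_fun setT M.
  apply: emeasurable_funM; last exact: (measurableT_comp mJ measurable_snd).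
  apply/measurable_EFinP; apply: measurable_funM.
    apply: measurable_funM.
      exact: (measurableT_comp (@measurable_expRopp R) measurable_fst).
    apply: measurable_indic.
    rewrite [A in measurable A](_ : _ = (fun p => p.1 - expR (- p.2 / H))%R @^-1`
      `]0%R, +oo[%classic).
      rewrite -[A in measurable A]setTI.
      by apply: (measurable_funB measurable_fst ml) => //; exact: measurable_itv.
    by apply/seteqP; split => p; rewrite /= in_itv/= andbT subr_gt0.
  exact: (measurableT_comp (@measurable_expR R)).
have M0 p : 0 <= M p.
  by rewrite mule_ge0// lee_fin !mulr_ge0// expR_ge0.
rewrite integral_exponential1//.
transitivity (\int[lebesgue_measure]_g fubini_F lebesgue_measure M g).
  rewrite integral_mkcond.
  have mfe : measurable_fun setT (fun g => f g * (expR (- g))%:E).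
    by apply: emeasurable_funM => //; apply/measurable_EFinP; exact: measurable_expRopp.
  apply: (integral_lebesgue_off_finite (L := [:: 0%R])).
  - by apply/(measurable_restrictT _ _).1 => //; exact: measurable_funTS.
  - exact: (@measurable_fun_fubini_tonelli_F _ _ _ _ _ lebesgue_measure M mM M0).
  - move=> g; rewrite patchE; case: ifP => // _.
    by rewrite mule_ge0// lee_fin expR_ge0.
  - by move=> g; exact: integral_ge0.
  move=> g; rewrite inE => gn0; rewrite patchE /fubini_F.
  have -> : (g \in `[0%R, +oo[%classic) = (0 <= g)%R.
    by apply/idP/idP; rewrite inE/= in_itv/= andbT.
  case: ifPn => g0; last first.
    rewrite (eq_integral (cst 0)) ?integral0// => s _.
    rewrite /M /= indicE memNset ?mulr0 ?mul0r ?mul0e//=.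
    by move=> /(le_lt_trans (expR_ge0 _))/ltW g0'; rewrite g0' in g0.
  have gp : (0 < g)%R by rewrite lt_neqAle eq_sym gn0.
  rewrite fE// muleC -ge0_integralZl//; last 2 first.
  - apply: measurable_funTS; apply: emeasurable_funM => //.
    apply/measurable_EFinP; apply: (measurableT_comp (@measurable_expR R)).
    apply: (measurableT_comp (@measurable_expR R)).
    by apply: measurable_funM => //; exact: oppr_measurable.
  - by move=> s _; rewrite mule_ge0// lee_fin expR_ge0.
  rewrite integral_mkcond; congr integral; apply/funext => s.
  rewrite epatch_indic /M /= muleAC muleA -!EFinM; congr (_%:E * _).
  congr (_ * _ * _)%R.
  have e : (ln (g `^ (- H)) < s)%R = (expR (- s / H) < g)%R.
    have := log_level_lt (NngNum (ltW gp)) s H0.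
    by rewrite /log_level/= gt_eqF// lte_fin.
  rewrite !indicE; apply: (congr1 (fun b : bool => b%:R : R)%R).
  by apply/idP/idP; rewrite !inE/= in_itv/= andbT e.
rewrite -(@fubini_tonelli1 _ _ _ _ _ lebesgue_measure lebesgue_measure M mM M0).
rewrite (@fubini_tonelli2 _ _ _ _ _ lebesgue_measure lebesgue_measure M mM M0).
apply: eq_integral => s _; rewrite /fubini_G.
set c := expR (- s / H).
(* At fixed [s], the exponential tail beyond [c] is [e^(-c)], and the weight is [e^c]. *)
transitivity (\int[lebesgue_measure]_(g in `]c, +oo[)
    (((expR c)%:E * J s) * (expR (- g))%:E)).
  rewrite [RHS]integral_mkcond; congr integral; apply/funext => g.
  transitivity ((expR (- g) * \1_`]c, +oo[ g * expR c)%:E * J s).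
    rewrite /M /= !indicE.
    apply: (congr1 (fun b : bool => (expR (- g) * b%:R * expR c)%:E * J s)).
    by apply/idP/idP; rewrite !inE/= in_itv/= andbT.
  rewrite epatch_indic -!muleA -EFinM muleCA -EFinM [RHS]muleC; congr (_%:E * _).
  by rewrite mulrC.
rewrite ge0_integralZl//; last 2 first.
- by apply: measurable_funTS; apply/measurable_EFinP; exact: measurable_expRopp.
- by rewrite mule_ge0// lee_fin expR_ge0.
by rewrite integral_expRN_itv muleAC -EFinM -expRD subrr expR0 mul1e.
Qed.

Variables (kappa : R) (nu : {measure set (paths R) -> \bar R}).
Hypothesis kappa0 : (0 < kappa)%R.
Hypothesis hnu : is_jump_measure H rho nu.
Variables (d : measure_display) (T : measurableType d) (P : probability T R).
Variables G U V : {RV P >-> R}.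
Hypothesis hG : forall B, measurable B -> distribution P G B = exponential_prob 1 B.
Hypothesis hU : forall B, measurable B ->
  distribution P U B = uniform_prob (@ltr01 R) B.
Hypothesis hV : forall B, measurable B ->
  distribution P V B = \int[rho]_(x in B) (kappa^-1 * x)%:E.
Hypothesis ind : mutually_independent P
  (tnth [tuple sigma_rv G; sigma_rv U; sigma_rv V]).

Lemma jump_measure_law (F : paths R -> \bar R) :
  measurable_fun setT F -> (forall y, 0 <= F y) ->
  \int[nu]_y F y = kappa%:E * \int[P]_w weighted_jump H F (G w, U w, V w).
Proof.
move=> mF F0.
have mj := measurable_weighted_jump H mF.
have j0 := weighted_jump_ge0 H F0.
rewrite (hnu mF F0) (indep3_joint_law ind mj j0).
pose K2 (p : R * R) := \int[distribution P V]_v weighted_jump H F (p, v).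
have mK2 : measurable_fun setT K2.
  exact: (@measurable_fun_fubini_tonelli_F _ _ _ _ _ (distribution P V) _ mj j0).
have K20 p : 0 <= K2 p by exact: integral_ge0.
pose K1 (g : R) := \int[distribution P U]_u K2 (g, u).
have mK1 : measurable_fun setT K1.
  exact: (@measurable_fun_fubini_tonelli_F _ _ _ _ _ (distribution P U) K2 mK2 K20).
have K10 g : 0 <= K1 g by exact: integral_ge0.
rewrite (eq_measurableTypeR_integral hG mK1 K10) -ge0_integralZl//; last first.
  by rewrite lee_fin ltW.
apply/esym; apply: integral_exponential_level.
- exact: measurable_jump_inner.
- by move=> s; exact: jump_inner_ge0.
- exact: emeasurable_funM.
- by move=> g; rewrite mule_ge0// lee_fin ltW.
- move=> g g0; rewrite -(integral_weighted_jump H0 rho0 kappa0 hV mF F0 g0).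
  congr (_ * _); apply: (eq_measurableTypeR_integral hU).
    exact: (measurableT_comp mK2).
  by move=> u; exact: K20.
Qed.

Let k0 : (0 <= kappa^-1)%R. Proof. by rewrite invr_ge0 ltW. Qed.

Let weight w : R := ((U w * V w)^-1 * expR (G w * U w `^ H^-1))%R.
Let jump w := step_path (G w `^ H * U w * V w) (G w * U w `^ H^-1).

(** The weight of the statement is signed as written; it equals its everywhere nonnegative version
    because [U] and [V] are positive almost surely. *)
Let weightE : {ae P, forall w, weight w = jump_weight H (G w) (U w) (V w)}.
Proof.
apply: filterS2 (uniform_rv_pos hU) (size_biased_rv_pos k0 rho0 hV) => w Uw Vw.
by rewrite /weight /jump_weight ger0_norm// invr_ge0 mulr_ge0// ltW.
Qed.

Let mweight : measurable_fun setT weight.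
Proof.
apply: measurable_funM; first by apply: measurable_fun_inv; exact: measurable_funM.
apply: (measurableT_comp (@measurable_expR R)); apply: measurable_funM => //.
exact: (measurableT_comp (measurable_powR _)).
Qed.

Let mGUV : measurable_fun setT (fun w => (G w, U w, V w)).
Proof. by apply: measurable_fun_pair => //; exact: measurable_fun_pair. Qed.

Lemma jump_measure_expectation (F : paths R -> R) :
  measurable_fun setT F -> (forall y, (0 <= F y)%R) ->
  \int[nu]_y (F y)%:E = kappa%:E * 'E_P[fun w => (weight w * F (jump w))%R].
Proof.
move=> mF F0; have mFE : measurable_fun setT (EFin \o F) by exact/measurable_EFinP.
rewrite (jump_measure_law mFE); last by move=> y; rewrite lee_fin.
congr (_ * _); rewrite unlock; apply: ae_eq_integral => //.
- exact: (measurableT_comp (measurable_weighted_jump H mFE) mGUV).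
- apply/measurable_EFinP; apply: measurable_funM => //.
  exact: (measurableT_comp mF (measurableT_comp (measurable_random_jump H) mGUV)).
- by apply: filterS weightE => w e _; rewrite /weighted_jump /= -e.
Qed.

Lemma jump_measure_weighted A : measurable A ->
  nu A = weighted P (fun w => kappa * weight w)%R (jump @^-1` A).
Proof.
move=> mA.
have mI : measurable_fun setT (fun y : paths R => (\1_A y : R)%:E).
  by apply/measurable_EFinP; exact: measurable_indic.
have mjA : measurable (jump @^-1` A).
  rewrite -[X in measurable X]setTI.
  exact: (measurableT_comp (measurable_random_jump H) mGUV).
have j0 := weighted_jump_ge0 H (F := fun y : paths R => (\1_A y : R)%:E).
rewrite -[A in LHS]setIT -integral_indic// (jump_measure_law mI); last first.
  by move=> y; rewrite lee_fin.
rewrite -ge0_integralZl//; last 3 first.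
- exact: (measurableT_comp (measurable_weighted_jump H mI) mGUV).
- by move=> w _; apply: j0 => y; rewrite lee_fin.
- by rewrite lee_fin ltW.
rewrite /weighted [RHS]integral_mkcond; apply: ae_eq_integral => //.
- apply: emeasurable_funM => //.
  exact: (measurableT_comp (measurable_weighted_jump H mI) mGUV).
- apply/(measurable_restrictT _ _).1 => //; apply: measurable_funTS.
  by apply/measurable_EFinP; exact: measurable_funM.
- apply: filterS weightE => w e _; rewrite /weighted_jump /= -e epatch_indic.
  by rewrite -!EFinM mulrA.
Qed.

End jump_law.

(** Stated for a plain measure, since it serves to prove that [rho] is sigma-finite: an infinite
    integral would make a positive expectation vanish. *)
Lemma levy_measure_integral_lty (R : realType) d (T : measurableType d)
    (P : probability T R) (Y : R -> T -> R) (rho : {measure set R -> \bar R}) :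
  double_sided_levy P Y -> driftless_levy_measure P (Y 1) rho ->
  (\int[rho]_(x in `]0%R, +oo[) (1 - expR (- x))%:E < +oo)%E.
Proof.
move=> levyY [_ /(_ 1 ler01)]; rewrite unlock; under [in RHS]eq_integral do rewrite mul1r.
move=> e; rewrite ltey; apply/eqP => oo; move: e; rewrite oo /= => e.
have : (0 < \int[P]_w (expR (- (1 * Y 1 w)))%:E)%E.
  apply: integral_gt0 => [|w]; last exact: expR_gt0.
  exact: (measurableT_comp (measurable_expRN 1) (levy_measurable levyY 1)).
by rewrite e ltxx.
Qed.

Theorem mainTheorem2 (R : realType) (d : measure_display)
    (Omega : measurableType d) (P : probability Omega R)
    (H : R) (Ybar : Omega -> cumulative R R) (kappa : R)
    (rho : {measure set R -> \bar R})
    (nu : {measure set (paths R) -> \bar R}) :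
  let psi := sato H Ybar in
  0 < H ->
  double_sided_levy P (fun s w => Ybar w s) ->
  'E_P[fun w => Ybar w 1%R]%E = kappa%:E ->
  0 < kappa ->
  driftless_levy_measure P (fun w => Ybar w 1) rho ->
  levy_measure_of P psi nu ->
  [/\ 'E_P[psi 1%:nng%R]%E = kappa%:E,
      (* (a2) *)
      (forall (a : {nonneg R}) (U V : {RV P >-> R}),
        0 < a%:num ->
        (forall B : set R, measurable B ->
           distribution P U B = uniform_prob (@ltr01 R) B) ->
        (forall B : set R, measurable B ->
           distribution P V B = (\int[rho]_(x in B) (kappa^-1 * x)%:E)%E) ->
        mutually_independent P
          (tnth [tuple sigma_rv U; sigma_rv V; sigma_process psi]) ->
        eq_law P (fun t w => psi t w +
                    step (a%:num `^ H * U w * V w)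
                         (a%:num * U w `^ H^-1) t%:num)
               (weighted P (fun w => psi a w / (kappa * a%:num `^ H))) psi),
      (* (b2) *)
      (forall (d' : measure_display) (Omega' : measurableType d')
              (P' : probability Omega' R) (G U V : {RV P' >-> R}),
        (forall B : set R, measurable B ->
           distribution P' G B = exponential_prob 1 B) ->
        (forall B : set R, measurable B ->
           distribution P' U B = uniform_prob (@ltr01 R) B) ->
        (forall B : set R, measurable B ->
           distribution P' V B = (\int[rho]_(x in B) (kappa^-1 * x)%:E)%E) ->
        mutually_independent P'
          (tnth [tuple sigma_rv G; sigma_rv U; sigma_rv V]) ->
        let jump w := step_path (G w `^ H * U w * V w) (G w * U w `^ H^-1) in
        let weight w := (U w * V w)^-1 * expR (G w * U w `^ H^-1) in
        (forall F : paths R -> R, measurable_fun setT F ->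
           (forall y, 0 <= F y) ->
           (\int[nu]_y (F y)%:E =
           kappa%:E * 'E_P'[fun w => (weight w * F (jump w))%R])%E) /\
        (forall A : set (paths R), measurable A ->
           nu A = weighted P' (fun w => kappa * weight w) (jump @^-1` A))) &
      (* (c2) *)
      (forall a : {nonneg R}, 0 < a%:num ->
        let nu_a := mrestr nu (measurable_zero_at a) in
        let nut_a := mrestr nu (measurable_pos_at a) in
        (forall (d' : measure_display) (Omega' : measurableType d')
                (P' : probability Omega' R)
                (X L : {nonneg R} -> {RV P' >-> R}),
          (forall t w, 0 <= X t w) ->
          (forall t w, 0 <= L t w) ->
          levy_measure_of P' X nu_a ->
          levy_measure_of P' L nut_a ->
          mutually_independent P'
            (tnth [tuple sigma_process X; sigma_process L]) ->
          [/\ eq_law P psi P' (fun t w => X t w + L t w),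
              eq_law P' X P (fun t w => psi (Order.max t a) w - psi a w) &
              eq_law P' L P (fun t w => psi (Order.min t a) w)]) /\
        (forall F : paths R -> R, measurable_fun setT F ->
           (forall y, 0 <= F y) ->
           (\int[nu_a]_y (F y)%:E =
             \int[lebesgue_measure]_(s in `]-oo, ln (a%:num `^ (- H))])
               \int[rho]_(x in `]0%R, +oo[)
                 (F (step_path (x * expR (- s)) (expR (- s / H))))%:E)%E /\
           (\int[nut_a]_y (F y)%:E =
             \int[lebesgue_measure]_(s in `]ln (a%:num `^ (- H)), +oo[)
               \int[rho]_(x in `]0%R, +oo[)
                 (F (step_path (x * expR (- s)) (expR (- s / H))))%:E)%E))].

Proof.
move=> psi H0 levyY meanY kappa0 levyrho hnu.
(* From here on [rho] is replaced by the same measure with its sigma-finite structure, so that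
   product measures and Tonelli are available. *)
have [rho' rhoE] : exists rho' : {sigma_finite_measure set R -> \bar R},
    rho = rho' :> {measure set R -> \bar R}.
  apply: sigma_finite_measure_of; apply: levy_sigma_finite levyrho.1 _.
  exact: (levy_measure_integral_lty levyY levyrho).
move: levyrho; rewrite {}rhoE => {rho} levyrho.
have mpsi t : measurable_fun setT (psi t) by exact: (measurable_sato H levyY).
have hjump := sato_levy_measure H0 levyY meanY levyrho hnu.
split.
- rewrite unlock (sato_mean H0 levyY meanY); congr (_%:E).
  by rewrite powR1 mulr1.
- move=> a U V a0 hU hV ind.
  exact: (eq_law_size_bias H0 levyY meanY kappa0 levyrho hnu a0 hU hV ind).
- move=> d' Omega' P' G U V hG hU hV ind jump weight; split=> [F mF F0|A mA].
    exact: (jump_measure_expectation H0 levyrho.1 kappa0 hjump hG hU hV ind mF F0).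
  exact: (jump_measure_weighted H0 levyrho.1 kappa0 hjump hG hU hV ind mA).
- move=> a a0 nu_a nut_a; split=> [d' Omega' P' X L X0 L0 hX hL ind|F mF F0].
    have mX t : measurable_fun setT (X t) by [].
    have mL t : measurable_fun setT (L t) by [].
    split.
    + exact: (eq_law_decomposition H0 levyY meanY levyrho hnu a0 mX X0 mL L0 hX hL ind).
    + exact: (eq_law_frozen H0 levyY meanY levyrho hnu a0 mX X0 hX).
    + exact: (eq_law_stopped H0 levyY meanY levyrho hnu a0 mL L0 hL).
  have mFE : measurable_fun setT (EFin \o F) by exact/measurable_EFinP.
  have FE0 y : (0 <= (EFin \o F) y)%E by rewrite lee_fin.
  split.
    exact: (jump_restr_zero H0 levyrho.1 hjump a0 mFE FE0).
  exact: (jump_restr_pos H0 levyrho.1 hjump a0 mFE FE0).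
Qed.
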